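(* Let $Y$ be a linearly ordered set. The linear basis (over $\Bbbk$) of the free commutative conformal algebra $\mathrm{ComConf}(Y,N=3)$ generated by $Y$ relative to the locality function $N=3$ consists of the following conformal monomials, where $x_i,y_i,y,z,u\in Y$: 1. $L_0^{x_1}\cdots L_0^{x_n}L_1^{y_1}\cdots L_1^{y_m}L_2^zu$, with $x_i\le x_{i+1}$, $y_i\le y_{i+1}\le z\le u$ (that is, $x_1\le\dots\le x_n$ and $y_1\le\dots\le y_m\le z\le u$), $n,m\ge0$; 2. $L_0^{x_1}\cdots L_0^{x_n}L_1^{y_1}\cdots L_1^{y_m}\partial^sz$, with $x_1\le\dots\le x_n$, $y_1\le\dots\le y_m\le z$, $n,m\ge0$, $s\ge1$; 3. $L_0^{x_1}\cdots L_0^{x_n}L_1^{y_1}\cdots L_1^{y_m}z$, with $x_1\le\dots\le x_n$, $y_1\le\dots\le y_m\le z$, $n\ge0$, and $m=0$ or $m\ge2$; 4. $L_0^{x_1}\cdots L_0^{x_n}L_1^yz$, with $x_1\le\dots\le x_n$, and ($x_n\le y$ or $y\le z$), $n\ge0$ (for $n=0$ there is no condition on $y,z$). Moreover, let $\mathfrak g$ be a Lie algebra over $\Bbbk$ with a symmetric invariant bilinear form $\langle\cdot|\cdot\rangle$, let $X_1$ be a linearly well-ordered linear basis of $\mathfrak g$, $X=X_1\cup\{e\}$, and $Y=X_1$. Then the conformal monomials of the four families 1, 2, 3, 4 (with $Y=X_1$) together with the torsion element $e$ form a linear basis of $U=U(K(\mathfrak g);X,N=3)$.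
   Context: Let $\Bbbk$ be a field of characteristic zero and $H=\Bbbk[\partial]$. Conformal algebras. A conformal algebra is an $H$-module $V$ with bilinear operations $(\cdot_{(n)}\cdot)$, $n\in\mathbb Z_+=\{0,1,2,\dots\}$, such that for all $u,v\in V$: $u_{(n)}v=0$ for all sufficiently large $n$; $(\partial u)_{(n)}v=-n\,u_{(n-1)}v$; $u_{(n)}\partial v=\partial(u_{(n)}v)+n\,u_{(n-1)}v$. It is associative if $u_{(n)}(v_{(m)}w)=\sum_{s=0}^n\binom ns(u_{(n-s)}v)_{(m+s)}w$ for all $u,v,w$ and $n,m\ge 0$. In an associative conformal algebra put $\{u_{(n)}v\}=\sum_{s\ge0}\frac{(-1)^{n+s}}{s!}\partial^s(u_{(n+s)}v)$ and $[u_{(n)}v]=u_{(n)}v-\{v_{(n)}u\}$; it is commutative if $[u_{(n)}v]=0$ for all $u,v$ and all $n\ge0$. $\mathrm{Conf}(X,N)$ (resp. $\mathrm{ComConf}(X,N)$) is the free associative (resp. associative commutative) conformal algebra generated by the set $X$ relative to locality $N$: it is universal among associative (resp. associative commutative) conformal algebras generated by (images of) $X$ in which $x_{(n)}y=0$ for all $x,y\in X$, $n\ge N$. In any of these algebras, for a generator $a$ let $L_n^au=a_{(n)}u$; thus $L_{n_1}^{a_1}\cdots L_{n_k}^{a_k}\partial^sz$ denotes $a_1{}_{(n_1)}(a_2{}_{(n_2)}(\cdots(a_k{}_{(n_k)}\partial^sz)\cdots))$. $K(\mathfrak g)=(H\otimes\mathfrak g)\oplus\Bbbk e$ with $\partial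 e=0$ is the Lie conformal algebra with $[a_{(0)}b]=[a,b]$, $[a_{(1)}b]=\langle a|b\rangle e$, $[a_{(n)}b]=0$ for $n\ge2$ ($a,b\in\mathfrak g$), and all brackets with $e$ zero. $U(K(\mathfrak g);X,N)$ is the quotient of $\mathrm{Conf}(X,N)$, $X=X_1\cup\{e\}$, by the conformal ideal generated by the relations $\partial e=0$; $[x_{(0)}y]=[x,y]$, $[x_{(1)}y]=\langle x|y\rangle e$, $[x_{(n)}y]=0$ ($n\ge2$) for $x,y\in X_1$; and $[x_{(n)}e]=[e_{(n)}x]=[e_{(n)}e]=0$ for $n\ge0$, where $[u_{(n)}v]=u_{(n)}v-\sum_{s\ge0}\frac{(-1)^{n+s}}{s!}\partial^s(v_{(n+s)}u)$ is the commutator in the associative conformal algebra $\mathrm{Conf}(X,N)$ and $[x,y]\in\mathfrak g$ is expanded in the basis $X_1$. *)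

(* Defs.v *)
From HB Require Import structures.
From mathcomp Require Import all_boot all_order all_algebra.
From mathcomp Require Import boolp classical_sets cardinality fsbigop wochoice.

Set Implicit Arguments.
Unset Strict Implicit.
Unset Printing Implicit Defensive.

Import Order.TTheory GRing.Theory.

Local Open Scope ring_scope.
Local Open Scope classical_set_scope.

(* An H-module for H = k[partial] is a k-vector space with a linear
   endomorphism, here der.  The natural-number predecessor in nprod_derl and
   nprod_derr is harmless: for n = 0 the term carries the coefficient 0. *)
HB.mixin Record Lmodule_isConfAlg (k : fieldType) V of GRing.Lmodule k V := {
  der : V -> V;
  nprod : nat -> V -> V -> V;
  der_linear : linear der;
  nprod_bilinear : forall n, bilinear_for *:%R *:%R (nprod n);
  nprod_local : forall u v : V,
    exists M, forall n, (M <= n)%N -> nprod n u v = 0;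
  nprod_derl : forall n (u v : V),
    nprod n (der u) v = - (n%:R *: nprod n.-1 u v);
  nprod_derr : forall n (u v : V),
    nprod n u (der v) = der (nprod n u v) + n%:R *: nprod n.-1 u v
}.

#[short(type="confAlgType")]
HB.structure Definition ConfAlg (k : fieldType) :=
  {V of GRing.Lmodule k V & Lmodule_isConfAlg k V}.

Notation "u *_( n ) v" := (nprod n u v)
  (at level 40, n at level 200, v at next level,
   format "u  *_( n )  v") : ring_scope.

HB.mixin Record ConfAlg_isAssoc (k : fieldType) V of ConfAlg k V := {
  nprodA : forall n m (u v w : V),
    u *_(n) (v *_(m) w) =
      \sum_(s < n.+1) 'C(n, s)%:R *: ((u *_(n - s) v) *_(m + s) w)
}.

#[short(type="assocConfAlgType")]
HB.structure Definition AssocConfAlg (k : fieldType) :=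
  {V of ConfAlg k V & ConfAlg_isAssoc k V}.

(* {u_(n) v}; the sum over all s : nat is finitely supported by locality. *)
Definition nprod_op (k : fieldType) (V : confAlgType k) (n : nat) (u v : V)
    : V :=
  \sum_(s \in [set: nat])
    ((-1) ^+ (n + s) / (s`!)%:R : k) *: iter s der (u *_(n + s) v).

Definition nbracket (k : fieldType) (V : confAlgType k) (n : nat) (u v : V)
    : V :=
  u *_(n) v - nprod_op n v u.

HB.mixin Record AssocConfAlg_isCom (k : fieldType) V of AssocConfAlg k V := {
  nbracket_eq0 : forall n (u v : V), nbracket n u v = 0
}.

#[short(type="comConfAlgType")]
HB.structure Definition ComConfAlg (k : fieldType) :=
  {V of AssocConfAlg k V & AssocConfAlg_isCom k V}.

Definition conf_morphism (k : fieldType) (V W : confAlgType k) (f : V -> W)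
    : Prop :=
  [/\ linear f,
      forall u, f (der u) = der (f u)
    & forall n u v, f (u *_(n) v) = f u *_(n) f v].

Definition conf_submodule (k : fieldType) (V : confAlgType k) (S : set V)
    : Prop :=
  [/\ S 0,
      forall (a : k) u v, S u -> S v -> S (a *: u + v)
    & forall u, S u -> S (der u)].

Definition conf_subalgebra (k : fieldType) (V : confAlgType k) (S : set V)
    : Prop :=
  conf_submodule S /\ forall n u v, S u -> S v -> S (u *_(n) v).

Definition conf_ideal (k : fieldType) (V : confAlgType k) (I : set V) : Prop :=
  conf_submodule I /\
  forall n u v, I u -> I (u *_(n) v) /\ I (v *_(n) u).

Definition conf_ideal_gen (k : fieldType) (V : confAlgType k) (R : set V)
    : set V :=
  [set v | forall I : set V, conf_ideal I -> R `<=` I -> I v].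

Definition conf_generates (k : fieldType) (X : Type) (V : confAlgType k)
    (i : X -> V) : Prop :=
  forall S : set V, conf_subalgebra S -> (forall x, S (i x)) -> S = [set: V].

Definition local_generators (k : fieldType) (X : Type) (N : nat)
    (V : confAlgType k) (i : X -> V) : Prop :=
  conf_generates i /\ forall x y n, (N <= n)%N -> i x *_(n) i y = 0.

(* (C, i) is Conf(X, N). *)
Definition is_Conf (k : fieldType) (X : Type) (N : nat)
    (C : assocConfAlgType k) (i : X -> C) : Prop :=
  local_generators N i /\
  forall (A : assocConfAlgType k) (j : X -> A), local_generators N j ->
    exists! f : C -> A, conf_morphism f /\ forall x, f (i x) = j x.

(* (C, i) is ComConf(X, N). *)
Definition is_ComConf (k : fieldType) (X : Type) (N : nat)
    (C : comConfAlgType k) (i : X -> C) : Prop :=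
  local_generators N i /\
  forall (A : comConfAlgType k) (j : X -> A), local_generators N j ->
    exists! f : C -> A, conf_morphism f /\ forall x, f (i x) = j x.

(* p presents U as the quotient of V by the conformal ideal generated by R. *)
Definition is_conf_quotient (k : fieldType) (V : confAlgType k) (R : set V)
    (U : confAlgType k) (p : V -> U) : Prop :=
  [/\ conf_morphism p,
      forall u, exists v, p v = u
    & forall v, p v = 0 <-> conf_ideal_gen R v].

(* The subfamily of f indexed by P is a (possibly infinite) linear basis. *)
Definition is_linear_basis (k : fieldType) (V : lmodType k) (I : eqType)
    (P : set I) (f : I -> V) : Prop :=
  (forall (s : seq I) (c : I -> k), uniq s -> {in s, forall i, P i} ->
     \sum_(i <- s) c i *: f i = 0 -> {in s, forall i, c i = 0}) /\
  (forall v : V, exists (s : seq I) (c : I -> k),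
     {in s, forall i, P i} /\ v = \sum_(i <- s) c i *: f i).

(* The word ([:: (n1, a1); ...; (nk, ak)], s, z) stands for the conformal
   monomial L_{n1}^{a1} ... L_{nk}^{ak} partial^s z. *)
Definition word (Y : Type) : Type := (seq (nat * Y) * nat * Y)%type.

Definition word_val (k : fieldType) (V : confAlgType k) (Y : Type) (i : Y -> V)
    (w : word Y) : V :=
  let: (l, s, z) := w in
  foldr (fun (na : nat * Y) u => i na.2 *_(na.1) u) (iter s der (i z)) l.

Definition Lpow (Y : Type) (n : nat) (xs : seq Y) : seq (nat * Y) :=
  [seq (n, x) | x <- xs].

Inductive basic_word (d : Order.disp_t) (Y : orderType d) : word Y -> Prop :=
| basic_word1 xs ys z u :
    sorted <=%O xs -> sorted <=%O (ys ++ [:: z; u]) ->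
    basic_word (Lpow 0 xs ++ Lpow 1 ys ++ [:: (2%N, z)], 0%N, u)
| basic_word2 xs ys s z :
    sorted <=%O xs -> sorted <=%O (rcons ys z) -> (1 <= s)%N ->
    basic_word (Lpow 0 xs ++ Lpow 1 ys, s, z)
| basic_word3 xs ys z :
    sorted <=%O xs -> sorted <=%O (rcons ys z) ->
    size ys = 0%N \/ (2 <= size ys)%N ->
    basic_word (Lpow 0 xs ++ Lpow 1 ys, 0%N, z)
| basic_word4 xs y z :
    sorted <=%O xs ->
    [\/ xs = [::], (last y xs <= y)%O | (y <= z)%O] ->
    basic_word (Lpow 0 xs ++ [:: (1%N, y)], 0%N, z).

HB.mixin Record Lmodule_isLie (k : fieldType) g of GRing.Lmodule k g := {
  lie : g -> g -> g;
  lie_bilinear : bilinear_for *:%R *:%R lie;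
  liexx : forall a : g, lie a a = 0;
  lie_jacobi : forall a b c : g,
    lie a (lie b c) + lie b (lie c a) + lie c (lie a b) = 0
}.

#[short(type="lieAlgType")]
HB.structure Definition LieAlg (k : fieldType) :=
  {g of GRing.Lmodule k g & Lmodule_isLie k g}.

(* Relations of U(K(g); X, N) in Conf(X, N), where X = option X1: Some x is
   the basis vector b x of g and None is e.  In Kac_rel_lie0 the vector
   [b x, b y] is expanded in the basis b. *)
Inductive Kac_relation (k : fieldType) (g : lieAlgType k) (B : g -> g -> k)
    (X1 : eqType) (b : X1 -> g) (F : confAlgType k) (i : option X1 -> F)
    : set F :=
| Kac_rel_der_e : Kac_relation B b i (der (i None))
| Kac_rel_lie0 x y (s : seq X1) (c : X1 -> k) :
    lie (b x) (b y) = \sum_(z <- s) c z *: b z ->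
    Kac_relation B b i
      (nbracket 0 (i (Some x)) (i (Some y)) - \sum_(z <- s) c z *: i (Some z))
| Kac_rel_lie1 x y :
    Kac_relation B b i
      (nbracket 1 (i (Some x)) (i (Some y)) - B (b x) (b y) *: i None)
| Kac_rel_lie2 x y n : (2 <= n)%N ->
    Kac_relation B b i (nbracket n (i (Some x)) (i (Some y)))
| Kac_rel_xe x n : Kac_relation B b i (nbracket n (i (Some x)) (i None))
| Kac_rel_ex x n : Kac_relation B b i (nbracket n (i None) (i (Some x)))
| Kac_rel_ee n : Kac_relation B b i (nbracket n (i None) (i None)).

(* (U, j) is U(K(g); X, N) with the images j of the generators. *)
Definition is_UK (k : fieldType) (g : lieAlgType k) (B : g -> g -> k)
    (X1 : eqType) (b : X1 -> g) (N : nat) (U : confAlgType k)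
    (j : option X1 -> U) : Prop :=
  exists (F : assocConfAlgType k) (i : option X1 -> F) (p : F -> U),
    [/\ is_Conf N i, is_conf_quotient (Kac_relation B b i) p
      & forall x, j x = p (i x)].

(* Main.v *)
(* Write d for partial. Spanning: monomials are straightened modulo shorter ones, using
   L_1^y L_2^z u = L_1^z L_2^y u and, modulo shorter monomials,
     L_1^y d^(s+1) z - L_1^z d^(s+1) y = (s + 3) (L_0^y d^s z - L_0^z d^s y),
     L_1^a (L_1^y z - L_1^z y) = L_0^y L_2^a z - L_0^z L_2^a y,
     L_0^t (L_1^y z - L_1^z y) = L_0^z (L_1^y t - L_1^t y) + L_0^y (L_1^t z - L_1^z t).

   Independence: for an associative algebra P, the current algebra P[d] is an associative
   conformal algebra in which the elements p_x + d c_x (p_x, c_x in P) have locality 3.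
   For P the polynomial algebra in the p_x and c_x, the coefficients of the monomials of
   the four families are triangular, which settles ComConf(Y, 3).  For U, let P be free on
   the p_x and c_x and send e to 0.  A functional on P that factors through the universal
   enveloping algebra of g[eps]/(eps^2), with p_x = x and c_x = x eps, vanishes on the
   coefficients of the ideal of relations; by the PBW theorem these functionals recover
   the polynomial model on the top-degree part, whence independence modulo e.

   That e is not 0 in U: let P be free on the p_x, c_x and e.  A functional psi on P cuts
   out a conformal ideal of P[d], namely the w with psi (m w(nu) m') = 0 for all products
   m, m' of factors p_x - lam c_x whose parameters lam, together with nu, are balanced (total
   momentum 0).  Take for psi the first-order part, in the parameters, of the coefficient
   of e in the PBW normal form of the product of the x t^lam in the affine Lie algebra
   with [x t^m, y t^n] = [x, y] t^(m+n) + m delta_(m+n) <x|y> e. *)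
From HB Require Import structures.
Require Import Defs.
From mathcomp Require Import all_boot all_order all_algebra.
From mathcomp Require Import boolp classical_sets cardinality fsbigop wochoice.
From mathcomp Require Import finmap monalg.
From mathcomp Require Import ring lra zify.

Set Implicit Arguments.
Unset Strict Implicit.
Unset Printing Implicit Defensive.

Import Order.TTheory GRing.Theory.

Local Open Scope ring_scope.

(** The spanning argument is run once for both algebras: it concerns an algebra generated by Y and a
    torsion element e, with given structure constants and form, and the commutative case takes e = 0
    and zero constants. Everything rests on the operators L_n^x commuting up to shorter terms.

    The condition of family 4 comes from a Pluecker relation. In the polynomial model L_1^y z -
    L_1^z y is 2 (p_y c_z - p_z c_y); such a difference satisfies no linear relation by itself, but
    its multiples by p_t satisfy a cyclic one. So a word with one L_1 and no d cannot simply be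
    sorted.

    For U no quotient of P is formed: a functional on the free algebra, defined on words by
    straightening, and the largest ideal inside its kernel replace the enveloping algebra.

    The obstacle to detecting e is that psi (m w(nu) m') is polynomial in the parameters, whereas
    the affine bracket contains a delta. The central term counts only when just its two letters are
    left, and there balance forces m + n = 0. Hence on balanced words the coefficient of e is linear
    in the exponents, and its first-order part suffices. *)

(** * Equations between linear combinations, by reflection *)

Section LinearCombinationNormalForm.
Variables (k : fieldType) (V : lmodType k).

Inductive lexp :=
| LVar of nat | LZero | LAdd of lexp & lexp | LOpp of lexp
| LScale of k & lexp.

Fixpoint leval (env : seq V) (e : lexp) : V :=
  match e with
  | LVar n => nth 0 env n
  | LZero => 0
  | LAdd a b => leval env a + leval env b
  | LOpp a => - leval env a
  | LScale c a => c *: leval env a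
  end.

(** The test is [eqn] rather than [==] so that [cbn] evaluates it on the numerals produced by
    reification. *)
Fixpoint lcoef (i : nat) (e : lexp) : k :=
  match e with
  | LVar n => if eqn n i then 1 else 0
  | LZero => 0
  | LAdd a b => lcoef i a + lcoef i b
  | LOpp a => - lcoef i a
  | LScale c a => c * lcoef i a
  end.

Fixpoint same_coefs (n : nat) (a b : lexp) : Prop :=
  if n is m.+1 then lcoef m a = lcoef m b /\ same_coefs m a b else True.

Lemma levalE env e :
  leval env e = \sum_(i < size env) lcoef i e *: nth 0 env i.
Proof.
have eqE (a b : nat) : eqn a b = (a == b) by [].
elim: e => [n||a IHa b IHb|a IHa|c a IHa] /=; rewrite ?IHa ?IHb.
- have [lt_n|le_n] := ltnP n (size env).
    rewrite (bigD1 (Ordinal lt_n)) //= eqE eqxx scale1r big1 ?addr0 // => i.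
    by rewrite -val_eqE /= eqE eq_sym => /negbTE ->; rewrite scale0r.
  rewrite nth_default // big1 // => i _; rewrite eqE; case: eqP => [eni|].
    by move: (ltn_ord i); rewrite -eni ltnNge le_n.
  by rewrite scale0r.
- by rewrite big1 // => i _; rewrite scale0r.
- by rewrite -big_split; apply: eq_bigr => i _; rewrite scalerDl.
- by rewrite -sumrN; apply: eq_bigr => i _; rewrite scaleNr.
- by rewrite scaler_sumr; apply: eq_bigr => i _; rewrite scalerA.
Qed.

Lemma leval_eq env a b : same_coefs (size env) a b -> leval env a = leval env b.
Proof.
rewrite !levalE => H; apply: eq_bigr => i _; congr (_ *: _).
move: (size env) H i; elim=> [|n IHn] /= H i; first by case: i.
case: H => e1 /IHn IH.
have [->//|lt_i] := eqVneq (i : nat) n.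
have lt_in : (i < n)%N by rewrite ltn_neqAle lt_i -ltnS ltn_ord.
exact: (IH (Ordinal lt_in)).
Qed.

End LinearCombinationNormalForm.

Ltac lin_insert x l :=
  let rec go m :=
    lazymatch m with
    | @nil _ => constr:(true)
    | cons x _ => constr:(false)
    | cons _ ?m' => go m'
    end in
  let b := go l in
  lazymatch b with
  | true => constr:(cons x l)
  | false => l
  end.

Ltac lin_atoms l t :=
  lazymatch t with
  | (?a + ?b)%R => let l1 := lin_atoms l a in lin_atoms l1 b
  | (- ?a)%R => lin_atoms l a
  | (?c *: ?a)%R => lin_atoms l a
  | 0%R => l
  | _ => lin_insert t l
  end.

Ltac lin_index x l :=
  lazymatch l with
  | cons x _ => constr:(0%nat)
  | cons _ ?m => let n := lin_index x m in constr:(S n)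
  end.

Ltac lin_reify k l t :=
  lazymatch t with
  | (?a + ?b)%R =>
      let ra := lin_reify k l a in let rb := lin_reify k l b in
      constr:(@LAdd k ra rb)
  | (- ?a)%R => let ra := lin_reify k l a in constr:(@LOpp k ra)
  | (?c *: ?a)%R => let ra := lin_reify k l a in constr:(@LScale k c ra)
  | 0%R => constr:(@LZero k)
  | _ => let n := lin_index t l in constr:(@LVar k n)
  end.

(* Reduces an equation between linear combinations to the equations between the
   coefficients of each (syntactic) atom. *)
Ltac linear_combination_in k V :=
  lazymatch goal with
  | |- ?a = ?b =>
    let l0 := lin_atoms (@nil V) a in
    let l := lin_atoms l0 b in
    let ra := lin_reify k l a in
    let rb := lin_reify k l b in
    change (@leval k V l ra = @leval k V l rb);
    apply: leval_eq; cbn [size same_coefs lcoef eqn]; repeat split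
  end.

(** * Conformal algebras *)

Section ConformalAlgebra.
Variables (k : fieldType) (V : confAlgType k).
Implicit Types u v w : V.

HB.instance Definition _ := GRing.isLinear.Build k V V _ (@der k V) der_linear.
HB.instance Definition _ n u :=
  GRing.isLinear.Build k V V _ (nprod n u) ((nprod_bilinear n).2 u).

Lemma nprodPl n v a u1 u2 :
  (a *: u1 + u2) *_(n) v = a *: (u1 *_(n) v) + u2 *_(n) v.
Proof. exact: (nprod_bilinear n).1. Qed.
Lemma nprodDl n v u1 u2 : (u1 + u2) *_(n) v = u1 *_(n) v + u2 *_(n) v.
Proof. by have:= nprodPl n v 1 u1 u2; rewrite !scale1r. Qed.
Lemma nprod0l n v : 0 *_(n) v = 0.
Proof.
by have /eqP := nprodDl n v 0 0; rewrite addr0 -subr_eq subrr => /eqP.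
Qed.
Lemma nprodZl n v a u : (a *: u) *_(n) v = a *: (u *_(n) v).
Proof. by have := nprodPl n v a u 0; rewrite !addr0 nprod0l addr0. Qed.
Lemma nprodNl n v u : (- u) *_(n) v = - (u *_(n) v).
Proof. by rewrite -scaleN1r nprodZl scaleN1r. Qed.
Lemma nprod_suml n v (I : Type) (r : seq I) (F : I -> V) :
  (\sum_(i <- r) F i) *_(n) v = \sum_(i <- r) F i *_(n) v.
Proof.
by elim: r => [|i r IH]; rewrite ?big_nil ?nprod0l // !big_cons nprodDl IH.
Qed.

Lemma nprodDr n u v1 v2 : u *_(n) (v1 + v2) = u *_(n) v1 + u *_(n) v2.
Proof. exact: linearD. Qed.
Lemma nprod0r n u : u *_(n) 0 = 0.
Proof. exact: linear0. Qed.
Lemma nprodZr n u a v : u *_(n) (a *: v) = a *: (u *_(n) v).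
Proof. exact: linearZ. Qed.
Lemma nprodNr n u v : u *_(n) (- v) = - (u *_(n) v).
Proof. exact: linearN. Qed.
Lemma derD u v : der (u + v) = der u + der v. Proof. exact: linearD. Qed.
Lemma derN u : der (- u) = - der u. Proof. exact: linearN. Qed.
Lemma der0 : der (0 : V) = 0. Proof. exact: linear0. Qed.
Lemma derZ a u : der (a *: u) = a *: der u. Proof. exact: linearZ. Qed.

Lemma iter_der_linear s : linear (iter s (@der k V)).
Proof. by move=> a u v; elim: s => //= s ->; rewrite linearP. Qed.
HB.instance Definition _ s :=
  GRing.isLinear.Build k V V _ (iter s (@der k V)) (iter_der_linear s).

Lemma fsbig_natE (M : nat) (F : nat -> V) :
  (forall s, (M <= s)%N -> F s = 0) ->
  \sum_(s \in [set: nat]) F s = \sum_(s < M) F s.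
Proof.
move=> F0; rewrite (@fsbigE _ _ _ _ _ (index_iota 0 M)) ?iota_uniq //.
- by rewrite big_mkord; apply: eq_bigl => i; rewrite in_setT.
- by move=> i _; rewrite mem_index_iota leq0n /= -leqNgt => /F0.
Qed.

Lemma nprod_opE M n u v : (forall m, (M <= m)%N -> u *_(m) v = 0) ->
  nprod_op n u v =
  \sum_(s < M) ((-1) ^+ (n + s) / (s`!)%:R : k) *: iter s der (u *_(n + s) v).
Proof.
move=> loc; apply: fsbig_natE => s le_s.
by rewrite loc ?(leq_trans le_s) ?leq_addl // linear0 scaler0.
Qed.

Lemma nprod_op0 u v : (forall m, (3 <= m)%N -> u *_(m) v = 0) ->
  nprod_op 0 u v =
  u *_(0) v - der (u *_(1) v) + (2%:R^-1 : k) *: der (der (u *_(2) v)).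
Proof.
move=> loc; rewrite (nprod_opE _ loc) !big_ord_recl big_ord0 /= !addr0.
rewrite !expr0 /bump /= !add0n sqrrN !expr1n expr1 (_ : 2`! = 2)%N //.
by rewrite !divr1 scale1r scaleN1r addrA mul1r.
Qed.

Lemma nprod_op1 u v : (forall m, (3 <= m)%N -> u *_(m) v = 0) ->
  nprod_op 1 u v = - (u *_(1) v) + der (u *_(2) v).
Proof.
move=> loc; rewrite (nprod_opE _ loc) !big_ord_recl big_ord0 /= !addr0.
rewrite /bump /= !add1n sqrrN !expr1n expr1 !divr1 scale1r scaleN1r.
by rewrite (loc 3%N) // !linear0 !addr0.
Qed.

Lemma nprod_op2 u v : (forall m, (3 <= m)%N -> u *_(m) v = 0) ->
  nprod_op 2 u v = u *_(2) v.
Proof.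
move=> loc; rewrite (nprod_opE _ loc) !big_ord_recl big_ord0 /= !addr0.
rewrite sqrrN !expr1n divr1 scale1r.
by rewrite (loc (2 + 1)%N) // (loc (2 + 2)%N) //= !linear0 !addr0.
Qed.

Lemma nprod_op_ge3 u v n : (forall m, (3 <= m)%N -> u *_(m) v = 0) ->
  (3 <= n)%N -> nprod_op n u v = 0.
Proof.
move=> loc n3; rewrite (nprod_opE _ loc) big1 // => s _.
by rewrite loc ?linear0 ?(leq_trans n3) ?leq_addr.
Qed.

End ConformalAlgebra.

(** * Sesquilinearity of the opposite products *)

Section NprodOpSesquilinear.
Variables (k : fieldType) (char0 : [pchar k] =i pred0) (V : confAlgType k).
Implicit Types u v w : V.

Lemma natf_neq0S n : (n.+1%:R : k) != 0.
Proof. by move: (pcharf0P k).1 => /(_ char0) ->. Qed.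

Lemma factf_neq0 n : (n`!%:R : k) != 0.
Proof. by rewrite -(prednK (fact_gt0 n)) natf_neq0S. Qed.

Lemma nprod_bound u v : exists M, forall n,
  (M <= n)%N -> u *_(n) v = 0 /\ u *_(n.-1) v = 0.
Proof.
have [M HM] := nprod_local u v; exists M.+1 => -[//|n] leMn.
by split; apply: HM => //; apply: leq_trans leMn.
Qed.

(** Expanding [u *_(n + s) (der v)] turns the s-th term into a term of the right-hand side plus
    [F s.+1 - F s], and these differences telescope. With its arguments exchanged, the opposite
    product is thus sesquilinear like the product itself. *)
Lemma nprod_op_derr n u v :
  nprod_op n u (der v) = - (n%:R *: nprod_op n.-1 u v).
Proof.
have [M HM] := nprod_bound u v.
have loc m : (M <= m)%N -> u *_(m) v = 0 by move=> /HM [].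
have loc1 m : (M <= m)%N -> u *_(m) (der v) = 0.
  by move=> /HM [h1 h2]; rewrite nprod_derr h1 h2 linear0 scaler0 addr0.
rewrite (nprod_opE n loc1).
pose F s : V := if s is t.+1 then ((-1) ^+ (n + t) / t`!%:R : k) *:
  iter t.+1 der (u *_(n + t) v) else 0.
have E s : ((-1) ^+ (n + s) / s`!%:R : k) *: iter s der (u *_(n + s) (der v)) =
  F s.+1 - F s - (n%:R * ((-1) ^+ (n.-1 + s) / s`!%:R) : k) *:
    iter s der (u *_(n.-1 + s) v).
  rewrite nprod_derr linearD linearZ /= -iterSr /= scalerDr -addrA; congr (_ + _).
  case: s => [|s].
    rewrite /= !addn0 oppr0 scalerA sub0r; have [->|n0] := posnP n.
      by rewrite mulr0 mul0r !scale0r oppr0.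
    rewrite -scaleNr; congr (_ *: _); rewrite -{1}(prednK n0) exprS.
    by field; rewrite oner_neq0.
  have [n0|n0] := posnP n.
    rewrite /F n0 !add0n mul0r scale0r subr0 scalerA -scaleNr; congr (_ *: _).
    rewrite exprS factS natrM; field.
    by rewrite factf_neq0 nat1r natf_neq0S.
  rewrite /F -(prednK n0) /= !addSn !addnS /= scalerA -!scaleNr -scalerDl.
  congr (_ *: _); rewrite !exprS factS natrM.
  by field; rewrite factf_neq0 nat1r natf_neq0S.
transitivity (\sum_(s < M) ((F s.+1 - F s) - (n%:R * ((-1) ^+ (n.-1 + s) / s`!%:R) : k) *:
    iter s der (u *_(n.-1 + s) v))).
  by apply: eq_bigr => s _; rewrite E.
rewrite big_split /= sumrN -(big_mkord xpredT (fun s => F s.+1 - F s)).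
rewrite telescope_sumr // subr0.
have -> : F M = 0.
  case: M HM {loc loc1} => [//|M] HM /=.
  rewrite (HM (n + M).+1 _).2 ?linear0 ?scaler0 //.
  by rewrite ltnS leq_addl.
rewrite add0r; congr (- _); rewrite (nprod_opE _ loc) scaler_sumr.
by apply: eq_bigr => s _; rewrite scalerA.
Qed.

Lemma nprod_op_derl n u v :
  nprod_op n (der u) v = der (nprod_op n u v) + n%:R *: nprod_op n.-1 u v.
Proof.
have [M HM] := nprod_bound u v.
have loc m : (M <= m)%N -> u *_(m) v = 0 by move=> /HM [].
have loc1 m : (M <= m)%N -> (der u) *_(m) v = 0.
  by move=> /HM [h1 h2]; rewrite nprod_derl h2 scaler0 oppr0.
rewrite (nprod_opE n loc1) !(nprod_opE _ loc) linear_sum scaler_sumr -big_split /=.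
pose F s : V := if s is t.+1 then ((-1) ^+ (n + t) / t`!%:R : k) *:
  iter t.+1 der (u *_(n + t) v) else 0.
apply/eqP; rewrite -subr_eq0 -sumrB; apply/eqP.
rewrite (eq_bigr (fun s : 'I_M => - (F s.+1 - F s))); last first.
  move=> [s /= _] _.
  have -> : der (((-1) ^+ (n + s) / s`!%:R : k) *: iter s der (u *_(n + s) v)) =
    F s.+1 by rewrite linearZ.
  rewrite opprB [F _ + _]addrC opprD addrA; congr (_ - _).
  rewrite nprod_derl linearN linearZ /= scalerN !scalerA.
  case: s => [|s].
    rewrite /= !addn0; have [->|n0] := posnP n.
      by rewrite mulr0 mul0r !scale0r !oppr0 ?addr0.
    rewrite -!scaleNr -scalerDl (_ : _ + _ = 0) ?scale0r //.
    by rewrite -{1}(prednK n0) exprS; field; rewrite oner_neq0.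
  rewrite addnS /=; have [n0|n0] := posnP n.
    rewrite /F n0 !add0n mul0r scale0r subr0 -scaleNr; congr (_ *: _).
    by rewrite exprS factS natrM; field; rewrite factf_neq0 nat1r natf_neq0S.
  rewrite /F -(prednK n0) /= !addSn !addnS /= -!scaleNr -scalerDl.
  congr (_ *: _); rewrite !exprS factS natrM.
  by field; rewrite factf_neq0 nat1r natf_neq0S.
rewrite sumrN -(big_mkord xpredT (fun s => F s.+1 - F s)) telescope_sumr // subr0.
case: M HM {loc loc1} => [|M] HM /=; first by rewrite oppr0.
by rewrite (HM (n + M).+1 _).2 ?linear0 ?scaler0 ?oppr0 // ltnS leq_addl.
Qed.

End NprodOpSesquilinear.

Lemma conf_morphism_nprod_op (k : fieldType) (V W : confAlgType k) (f : V -> W) n u v :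
  conf_morphism f -> f (nprod_op n u v) = nprod_op n (f u) (f v).
Proof.
case=> fL fD fP; have [M HM] := nprod_local u v.
have f0 : f 0 = 0 by have := fL (-1) 0 0; rewrite scaler0 addr0 scaleN1r addNr.
have loc m : (M <= m)%N -> f u *_(m) f v = 0 by move=> /HM; rewrite -fP => ->.
have iterE s x : f (iter s der x) = iter s der (f x).
  by elim: s => //= s <-; rewrite fD.
rewrite (nprod_opE n HM) (nprod_opE n loc); elim/big_rec2: _ => // i y x _ <-.
by rewrite fL -fP iterE.
Qed.

Section ConformalSubmodule.
Variables (k : fieldType) (V : confAlgType k) (S : set V).
Hypothesis S_sub : conf_submodule S.

Lemma conf_submoduleD u v : S u -> S v -> S (u + v).
Proof. by have [_ SL _] := S_sub; move=> Su Sv; rewrite -[u]scale1r; apply: SL. Qed.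
Lemma conf_submoduleZ a u : S u -> S (a *: u).
Proof. by have [S0 SL _] := S_sub; move=> Su; rewrite -[_ *: _]addr0; apply: SL. Qed.
Lemma conf_submoduleN u : S u -> S (- u).
Proof. by rewrite -scaleN1r; apply: conf_submoduleZ. Qed.

End ConformalSubmodule.

(** Associativity solved for its term s = 0. The other products [u *_(n - s.+1) v] have a smaller
    index, so facts about [u *_(n) v] can be proved by induction on n. *)
Lemma nprodAr (k : fieldType) (V : assocConfAlgType k) n m (u v w : V) :
  (u *_(n) v) *_(m) w = u *_(n) (v *_(m) w) -
    \sum_(s < n) 'C(n, s.+1)%:R *: ((u *_(n - s.+1) v) *_(m + s.+1) w).
Proof.
rewrite nprodA big_ord_recl /= bin0 scale1r subn0 addn0.
by under eq_bigr => s _ do rewrite /bump /= add1n; rewrite addrK.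
Qed.

(** * Subalgebras and lifting along the universal properties *)

Section ConformalSubalgebra.
Variables (k : fieldType) (A : confAlgType k) (S : set A).
Hypothesis S_sub : conf_subalgebra S.

(** The closure proof is an argument so that the module structures declared below can be attached to
    the predicate. *)
Definition subalg_pred of conf_subalgebra S : {pred A} := fun v => `[< S v >].

Lemma subalg_predP v : reflect (S v) (v \in subalg_pred S_sub).
Proof. exact: asboolP. Qed.

Lemma subalg_submod : submod_closed (subalg_pred S_sub).
Proof.
have [[S0 SL _] _] := S_sub.
by split=> [|a u v /subalg_predP Su /subalg_predP Sv]; apply/subalg_predP => //; apply: SL.
Qed.
HB.instance Definition _ :=
  GRing.isSubmodClosed.Build k A (subalg_pred S_sub) subalg_submod.

Record subalg : predArgType :=
  SubAlg { subalg_val : A; subalg_valP : subalg_val \in subalg_pred S_sub }.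
HB.instance Definition _ := [isSub for subalg_val].
HB.instance Definition _ := [Choice of subalg by <:].
HB.instance Definition _ := [SubChoice_isSubLmodule of subalg by <:].

Implicit Types u v w : subalg.

Lemma subalgP u : S (val u).
Proof. exact/subalg_predP/valP. Qed.

Lemma subalg_der_proof u : der (val u) \in subalg_pred S_sub.
Proof.
by apply/subalg_predP; have [[_ _ SD] _] := S_sub; apply: SD; apply: subalgP.
Qed.
Definition subalg_der u : subalg := SubAlg (subalg_der_proof u).

Lemma subalg_nprod_proof n u v : val u *_(n) val v \in subalg_pred S_sub.
Proof.
by apply/subalg_predP; have [_ SM] := S_sub; apply: SM; apply: subalgP.
Qed.
Definition subalg_nprod n u v : subalg := SubAlg (subalg_nprod_proof n u v).

Lemma subalg_der_linear : linear subalg_der.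
Proof. by move=> a u v; apply: val_inj; rewrite /= linearP. Qed.
Lemma subalg_nprod_bilinear n : bilinear_for *:%R *:%R (subalg_nprod n).
Proof.
split=> [v a u w|u a v w]; apply: val_inj => /=; first by rewrite nprodPl.
by rewrite linearP.
Qed.
Lemma subalg_nprod_local u v :
  exists M, forall n, (M <= n)%N -> subalg_nprod n u v = 0.
Proof.
have [M HM] := nprod_local (val u) (val v).
by exists M => n /HM h; apply: val_inj; rewrite /= h.
Qed.
Lemma subalg_nprod_derl n u v :
  subalg_nprod n (subalg_der u) v = - (n%:R *: subalg_nprod n.-1 u v).
Proof. by apply: val_inj; rewrite /= nprod_derl. Qed.
Lemma subalg_nprod_derr n u v :
  subalg_nprod n u (subalg_der v) =
  subalg_der (subalg_nprod n u v) + n%:R *: subalg_nprod n.-1 u v.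
Proof. by apply: val_inj; rewrite /= nprod_derr. Qed.

HB.instance Definition _ := Lmodule_isConfAlg.Build k subalg subalg_der_linear
  subalg_nprod_bilinear subalg_nprod_local subalg_nprod_derl subalg_nprod_derr.

Lemma val_subalg_nprod n u v : val (u *_(n) v) = val u *_(n) val v.
Proof. by []. Qed.
Lemma subalg_val_morph : conf_morphism (val : subalg -> A).
Proof. by split=> // a u v; rewrite linearP. Qed.

End ConformalSubalgebra.

Section AssocSubalgebra.
Variables (k : fieldType) (A : assocConfAlgType k) (S : set A).
Hypothesis S_sub : conf_subalgebra S.

Lemma subalg_nprodA n m (u v w : subalg S_sub) :
  u *_(n) (v *_(m) w) =
  \sum_(s < n.+1) 'C(n, s)%:R *: ((u *_(n - s) v) *_(m + s) w).
Proof.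
apply: val_inj; rewrite linear_sum !val_subalg_nprod nprodA.
by apply: eq_bigr.
Qed.
HB.instance Definition _ :=
  ConfAlg_isAssoc.Build k (subalg S_sub) subalg_nprodA.
End AssocSubalgebra.

Section ComSubalgebra.
Variables (k : fieldType) (A : comConfAlgType k) (S : set A).
Hypothesis S_sub : conf_subalgebra S.

Lemma subalg_nbracket_eq0 n (u v : subalg S_sub) : nbracket n u v = 0.
Proof.
apply: val_inj; rewrite /nbracket linearB /= -[RHS](nbracket_eq0 n (val u) (val v)).
by rewrite (conf_morphism_nprod_op _ _ _ (subalg_val_morph S_sub)).
Qed.
HB.instance Definition _ :=
  AssocConfAlg_isCom.Build k (subalg S_sub) subalg_nbracket_eq0.
End ComSubalgebra.

Section Generated.
Variables (k : fieldType) (X : Type) (A : confAlgType k) (j : X -> A).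

Definition generated : set A :=
  [set v | forall S : set A, conf_subalgebra S -> (forall x, S (j x)) -> S v]%classic.

Lemma generated_subalgebra : conf_subalgebra generated.
Proof.
split; first split.
- by move=> S [[]].
- by move=> a u v gu gv S Ssub Sj; case: (Ssub) => -[_ SL _] _; apply: SL; [apply: gu|apply: gv].
- by move=> u gu S Ssub Sj; case: (Ssub) => -[_ _ SD] _; apply: SD; apply: gu.
- by move=> n u v gu gv S Ssub Sj; case: (Ssub) => _ SM; apply: SM; [apply: gu|apply: gv].
Qed.

Lemma generated_gen x : generated (j x).
Proof. by move=> S _; apply. Qed.

Definition gen_subalg (x : X) : subalg generated_subalgebra :=
  SubAlg (introT (subalg_predP generated_subalgebra _) (generated_gen x)).

Lemma gen_subalg_generates : conf_generates gen_subalg.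
Proof.
move=> T [[T0 TL TD] TM] Tj; apply/seteqP; split=> // u _.
pose T' : set A := [set v | exists2 w, T w & val w = v]%classic.
have T'_sub : conf_subalgebra T'.
  split; first split; first by exists 0.
  - by move=> a _ _ [w Tw <-] [w' Tw' <-]; exists (a *: w + w'); rewrite ?linearP; first exact: TL.
  - by move=> _ [w Tw <-]; exists (der w); first exact: TD.
  - by move=> n _ _ [w Tw <-] [w' Tw' <-]; exists (w *_(n) w'); first exact: TM.
have [|w Tw /val_inj <- //] := subalgP u T' T'_sub.
by move=> x; exists (gen_subalg x).
Qed.

Lemma gen_subalg_local N : (forall x y n, (N <= n)%N -> j x *_(n) j y = 0) ->
  local_generators N gen_subalg.
Proof.
move=> loc; split; first exact: gen_subalg_generates.
by move=> x y n le_n; apply: val_inj; rewrite /= loc.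
Qed.

End Generated.

(** The universal property speaks only of targets generated by the images of X. For an arbitrary
    target it is applied to the subalgebra generated by [j], followed by the inclusion. *)
Lemma is_Conf_lift (k : fieldType) (X : Type) (N : nat) (C : assocConfAlgType k)
    (i : X -> C) (A : assocConfAlgType k) (j : X -> A) :
  is_Conf N i -> (forall x y n, (N <= n)%N -> j x *_(n) j y = 0) ->
  exists2 f : C -> A, conf_morphism f & forall x, f (i x) = j x.
Proof.
move=> [_ univ] /gen_subalg_local /univ [f [[[fL fD fM] fj] _]].
exists (val \o f) => [|x /=]; last by rewrite fj.
by split=> [a u v|u|n u v] /=; rewrite ?fL ?fD ?fM.
Qed.

Lemma is_ComConf_lift (k : fieldType) (X : Type) (N : nat) (C : comConfAlgType k)
    (i : X -> C) (A : comConfAlgType k) (j : X -> A) :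
  is_ComConf N i -> (forall x y n, (N <= n)%N -> j x *_(n) j y = 0) ->
  exists2 f : C -> A, conf_morphism f & forall x, f (i x) = j x.
Proof.
move=> [_ univ] /gen_subalg_local /univ [f [[[fL fD fM] fj] _]].
exists (val \o f) => [|x /=]; last by rewrite fj.
by split=> [a u v|u|n u v] /=; rewrite ?fL ?fD ?fM.
Qed.

Lemma conf_morphism_linear (k : fieldType) (V W : confAlgType k) (f : V -> W) :
  conf_morphism f -> [/\ f 0 = 0, {morph f : u v / u + v}, {morph f : u / - u} &
    forall a, {morph f : u / a *: u}].
Proof.
case=> fL _ _.
have f0 : f 0 = 0 by have := fL (-1) 0 0; rewrite scaler0 addr0 scaleN1r addNr.
have fZ a u : f (a *: u) = a *: f u by have := fL a u 0; rewrite f0 !addr0.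
split=> // [u v|u]; first by have := fL 1 u v; rewrite !scale1r.
by rewrite -scaleN1r fZ scaleN1r.
Qed.

Lemma conf_morphism_sum (k : fieldType) (V W : confAlgType k) (f : V -> W)
    (I : Type) (r : seq I) (c : I -> k) (F : I -> V) :
  conf_morphism f ->
  f (\sum_(i <- r) c i *: F i) = \sum_(i <- r) c i *: f (F i).
Proof.
move=> /conf_morphism_linear [f0 fD _ fZ].
by elim: r => [|i r IH]; rewrite ?big_nil // !big_cons fD fZ IH.
Qed.

Lemma conf_morphism_word_val (k : fieldType) (V W : confAlgType k) (f : V -> W)
    (Y : Type) (i : Y -> V) (w : word Y) :
  conf_morphism f -> f (word_val i w) = word_val (f \o i) w.
Proof.
case=> _ fD fM; case: w => [[l s] z] /=.
elim: l => [|[n x] l IH] /=; last by rewrite fM IH.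
by elim: s => //= s <-; rewrite fD.
Qed.

Definition act (k : fieldType) (V : confAlgType k) (Y : Type) (j : Y -> V)
    (l : seq (nat * Y)) (v : V) : V :=
  foldr (fun (na : nat * Y) r => j na.2 *_(na.1) r) v l.

Lemma act_cat (k : fieldType) (V : confAlgType k) (Y : Type) (j : Y -> V) l l' v :
  act j (l ++ l') v = act j l (act j l' v).
Proof. exact: foldr_cat. Qed.

Lemma act_cons (k : fieldType) (V : confAlgType k) (Y : Type) (j : Y -> V) n x l v :
  act j ((n, x) :: l) v = j x *_(n) act j l v.
Proof. by []. Qed.

Definition indexed (Y : Type) n (l : seq (nat * Y)) : seq Y := [seq p.2 | p <- l & p.1 == n].

Lemma indexed_cat (Y : Type) n (l l' : seq (nat * Y)) :
  indexed n (l ++ l') = indexed n l ++ indexed n l'.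
Proof. by rewrite /indexed filter_cat map_cat. Qed.

Lemma indexed_Lpow (Y : Type) n m (xs : seq Y) :
  indexed n (Lpow m xs) = if m == n then xs else [::].
Proof.
rewrite /indexed; elim: xs => [|x xs IH] /=; first by case: eqP.
by case: eqP IH => //= _ ->.
Qed.

(** * Current conformal algebras *)

Section Current.
Variables (k : fieldType) (P : algType k).

(* 'X stands for partial, so that the coefficient of 'X^i in f is the coefficient of
   partial^i; the products extend cst p *_(0) cst q = cst (p * q) sesquilinearly. *)
Definition cur : Type := {poly P}.
HB.instance Definition _ := GRing.Zmodule.copy cur {poly P}.

Implicit Types (f g h : cur) (a b : k) (p : P).

(** [{poly P}] is scaled by P; the field acts through its image [a%:A] in P. *)
Definition cur_scale a f : cur := a%:A *: (f : {poly P}).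

Lemma cur_scaleA a b f : cur_scale a (cur_scale b f) = cur_scale (a * b) f.
Proof. by rewrite /cur_scale scalerA -scalerAl mul1r scalerA. Qed.
Lemma cur_scale1 : left_id 1 cur_scale.
Proof. by move=> f; rewrite /cur_scale scale1r scale1r. Qed.
Lemma cur_scaleDr : right_distributive cur_scale +%R.
Proof. by move=> a f g; apply: scalerDr. Qed.
Lemma cur_scaleDl f : {morph cur_scale^~ f : a b / a + b}.
Proof. by move=> a b; rewrite /cur_scale scalerDl scalerDl. Qed.
HB.instance Definition _ := GRing.Zmodule_isLmodule.Build k cur
  cur_scaleA cur_scale1 cur_scaleDr cur_scaleDl.

Definition cst (p : P) : cur := p%:P.

Lemma coef_curZ a f i : (a *: f : {poly P})`_i = a *: (f : {poly P})`_i.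
Proof. by rewrite coefZ mulr_algl. Qed.
Lemma coef_curD f g i :
  (f + g : {poly P})`_i = (f : {poly P})`_i + (g : {poly P})`_i.
Proof. by rewrite coefD. Qed.

Definition cur_der f : cur := (f : {poly P}) * 'X.

(** Taking d^i out of the left argument produces the factor (-1)^i n (n-1) ... (n-i+1) and lowers
    the index to n - i; a constant p with index m acts as p times the m-th derivative in d. *)
Definition cur_nprod n f g : cur :=
  \sum_(i < n.+1) ((-1) ^+ i * (n ^_ i)%:R : k) *:
    ((f : {poly P})`_i *: (g : {poly P})^`(n - i) : cur).

Lemma cur_der_linear : linear cur_der.
Proof.
move=> a f g; rewrite /cur_der mulrDl; congr (_ + _).
exact: (esym (scalerAl a%:A (f : {poly P}) 'X)).
Qed.

Lemma derivn_curP n a f g :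
  (a *: f + g : {poly P})^`(n) = a *: ((f : {poly P})^`(n) : cur) + (g : {poly P})^`(n).
Proof.
rewrite derivnD; congr (_ + _).
exact: (derivnZ n a%:A (f : {poly P})).
Qed.

Lemma pscale_cur a p f : p *: (a *: f : {poly P}) = a *: (p *: (f : {poly P}) : cur).
Proof.
have /= E1 := scalerA p a%:A (f : {poly P}).
have /= E2 := scalerA a%:A p (f : {poly P}).
by rewrite [LHS]E1 [RHS]E2 mulr_algr mulr_algl.
Qed.

Lemma pscale_curl a p f : (a *: p) *: (f : {poly P}) = a *: (p *: (f : {poly P}) : cur).
Proof. by have /= E := scalerA a%:A p (f : {poly P}); rewrite [RHS]E mulr_algl. Qed.

Lemma cur_nprod_bilinear n : bilinear_for *:%R *:%R (cur_nprod n).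
Proof.
split=> [g a f f'|f a g g']; rewrite /= /cur_nprod scaler_sumr -big_split /=;
  apply: eq_bigr => i _.
- rewrite coef_curD coef_curZ scalerDl pscale_curl.
  by rewrite [LHS]scalerDr !scalerA [a * _]mulrC.
- rewrite derivn_curP scalerDr pscale_cur.
  by rewrite [LHS]scalerDr !scalerA [a * _]mulrC.
Qed.

Lemma cur_nprod_local f g :
  exists M, forall n, (M <= n)%N -> cur_nprod n f g = 0.
Proof.
exists (size (f : {poly P}) + size (g : {poly P}))%N => n le_n.
rewrite /cur_nprod big1 // => i _.
have [le_i|lt_i] := leqP (size (f : {poly P})) i.
  by rewrite nth_default // scale0r scaler0.
rewrite derivn_poly0 ?scaler0 // leq_subRL; last by rewrite -ltnS ltn_ord.
by apply: leq_trans le_n; rewrite leq_add2r ltnW.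
Qed.

Lemma cur_nprod_derl n f g :
  cur_nprod n (cur_der f) g = - (n%:R *: cur_nprod n.-1 f g).
Proof.
rewrite /cur_nprod /cur_der big_ord_recl coefMX eqxx scale0r scaler0 add0r.
case: n => [|n]; first by rewrite big_ord0 scale0r oppr0.
rewrite scaler_sumr -sumrN; apply: eq_bigr => i _.
rewrite coefMX /= subSS scalerA -scaleNr ffactnS natrM exprS.
by congr (_ *: _); ring.
Qed.

Lemma derivn_mulX f n :
  ((f : {poly P}) * 'X)^`(n) = (f : {poly P})^`(n) * 'X + (f : {poly P})^`(n.-1) *+ n.
Proof.
elim: n => [|n IH]; first by rewrite !derivn0 mulr0n addr0.
rewrite derivnS IH derivD derivM derivX mulr1 derivMn -derivnS mulrSr.
case: n {IH} => [|n]; first by rewrite !mulr0n addr0 add0r.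
by rewrite /= -derivnS addrAC addrA.
Qed.

Lemma cur_nprod_derr n f g :
  cur_nprod n f (cur_der g) =
  cur_der (cur_nprod n f g) + n%:R *: cur_nprod n.-1 f g.
Proof.
have der_scale a p (q : {poly P}) :
    cur_der (a *: (p *: q : cur)) = a *: (p *: (q * 'X) : cur).
  rewrite /cur_der; have -> : (a *: (p *: q : cur) : {poly P}) * 'X =
    a *: ((p *: q : {poly P}) * 'X : cur) by exact: (esym (scalerAl a%:A _ 'X)).
  by rewrite -scalerAl.
have -> : cur_der (cur_nprod n f g) = \sum_(i < n.+1)
    ((-1) ^+ i * (n ^_ i)%:R : k) *:
    ((f : {poly P})`_i *: ((g : {poly P})^`(n - i) * 'X) : cur).
  rewrite /cur_nprod /cur_der mulr_suml; apply: eq_bigr => i _.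
  exact: der_scale.
have -> : n%:R *: cur_nprod n.-1 f g = \sum_(i < n.+1)
    ((-1) ^+ i * (n ^_ i)%:R : k) *:
    ((f : {poly P})`_i *: ((g : {poly P})^`((n - i).-1) *+ (n - i)) : cur).
  case: n => [|n]; first by rewrite scale0r big_ord1 mulr0n !scaler0.
  rewrite [RHS]big_ord_recr /= subnn mulr0n !scaler0 addr0 scaler_sumr.
  apply: eq_bigr => i _; have le_in : (i <= n)%N by rewrite -ltnS.
  rewrite subSn //= scalerA.
  have -> : (f : {poly P})`_i *: ((g : {poly P})^`(n - i) *+ (n - i).+1) =
    (n - i).+1%:R *: ((f : {poly P})`_i *: (g : {poly P})^`(n - i) : cur).
    by rewrite -scalerMnr scaler_nat.
  rewrite scalerA; congr (_ *: _).
  by rewrite mulrCA -mulrA -!natrM -subSn // -ffactnSr -ffactnS.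
rewrite -big_split /=; apply: eq_bigr => i _.
rewrite /cur_der derivn_mulX scalerDr; exact: scalerDr.
Qed.

HB.instance Definition _ := Lmodule_isConfAlg.Build k cur cur_der_linear
  cur_nprod_bilinear cur_nprod_local cur_nprod_derl cur_nprod_derr.

Lemma nprod_cst p g n :
  cst p *_(n) g = (p *: (g : {poly P})^`(n) : cur).
Proof.
rewrite [LHS]/(cur_nprod _ _ _) /cur_nprod big_ord_recl big1 => [|i _].
  by rewrite /= coefC eqxx expr0 ffactn0 mulr1 scale1r subn0 addr0.
by rewrite coefC /= scale0r scaler0.
Qed.

Lemma nprod_cstr f p n :
  f *_(n) cst p =
  ((-1) ^+ n * n`!%:R : k) *: cst ((f : {poly P})`_n * p).
Proof.
rewrite [LHS]/(cur_nprod _ _ _) /cur_nprod big_ord_recr big1 => [|i _] /=.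
  by rewrite add0r subnn derivn0 ffactnn /cst -mul_polyC -polyCM.
rewrite derivnC subn_eq0 leqNgt ltn_ord /= scaler0 scaler0 //.
Qed.

Lemma cur_ind (K : cur -> Prop) :
  (forall p, K (cst p)) -> (forall f g, K f -> K g -> K (f + g)) ->
  (forall f, K f -> K (der f)) -> forall f, K f.
Proof.
move=> Kc KD KX; apply: poly_ind => [|f p Kf]; first by rewrite -polyC0; apply: Kc.
by apply: KD => //; apply: KX.
Qed.

End Current.

(** * Associativity of the current algebra *)

Section AssociativityExtension.
Variables (k : fieldType) (V : confAlgType k).
Implicit Types u v w : V.

(** Fixing the arguments but not n and m makes the property stable under sums and under [der] in
    each argument, so that associativity has to be checked on constants only. *)
Definition assoc_at u v w := forall n m, u *_(n) (v *_(m) w) =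
  \sum_(s < n.+1) 'C(n, s)%:R *: ((u *_(n - s) v) *_(m + s) w).

Lemma assoc_atDl u u' v w :
  assoc_at u v w -> assoc_at u' v w -> assoc_at (u + u') v w.
Proof.
move=> A A' n m; rewrite nprodDl A A' -big_split; apply: eq_bigr => s _ /=.
by rewrite nprodDl nprodDl scalerDr.
Qed.

Lemma assoc_atDm u v v' w :
  assoc_at u v w -> assoc_at u v' w -> assoc_at u (v + v') w.
Proof.
move=> A A' n m; rewrite nprodDl nprodDr A A' -big_split.
by apply: eq_bigr => s _ /=; rewrite nprodDr nprodDl scalerDr.
Qed.

Lemma assoc_atDr u v w w' :
  assoc_at u v w -> assoc_at u v w' -> assoc_at u v (w + w').
Proof.
move=> A A' n m; rewrite !nprodDr A A' -big_split.
by apply: eq_bigr => s _ /=; rewrite nprodDr scalerDr.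
Qed.

Lemma assoc_at_derl u v w : assoc_at u v w -> assoc_at (der u) v w.
Proof.
move=> A n m; rewrite nprod_derl A [RHS]big_ord_recr /= subnn nprod_derl scale0r oppr0.
rewrite nprod0l scaler0 addr0.
case: n => [|n]; first by rewrite scale0r oppr0 big_ord0.
rewrite scaler_sumr -sumrN; apply: eq_bigr => s _.
have le_sn : (s <= n)%N by rewrite -ltnS.
rewrite nprod_derl nprodNl scalerN nprodZl !scalerA subSn //=.
by rewrite -!natrM (mul_bin_down n.+1 s) subSn // mulnC.
Qed.

Lemma assoc_at_derm u v w : assoc_at u v w -> assoc_at u (der v) w.
Proof.
move=> A n m; rewrite nprod_derl nprodNr nprodZr A.
pose F s := (u *_(n - s) v) *_((m + s).-1) w.
(* The terms that do not match directly are [G s.+1 - G s], because (n - s) C(n, s) = (s + 1) C(n, s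
   + 1); they telescope to 0 since C(n, n + 1) = 0. *)
pose G s : V := (s%:R * 'C(n, s)%:R : k) *: F s.
transitivity (\sum_(s < n.+1) (- ((m%:R * 'C(n, s)%:R : k) *: F s) + (G s.+1 - G s))).
  rewrite big_split /= -(big_mkord xpredT (fun s => G s.+1 - G s)).
  rewrite telescope_sumr // /G bin_small // mulr0 mul0r !scale0r subr0 addr0.
  rewrite sumrN scaler_sumr; congr (- _); apply: eq_bigr => s _.
  have [m0|m0] := posnP m; first by rewrite m0 mul0r !scale0r.
  by rewrite scalerA /F -(prednK m0) addSn.
apply: eq_bigr => s _; rewrite nprod_derr nprodDl nprod_derl nprodZl /G.
have -> : (u *_((n - s).-1) v) *_(m + s) w = F s.+1 by rewrite /F subnS addnS.
have E : s.+1%:R * 'C(n, s.+1)%:R = (n - s)%:R * 'C(n, s)%:R :> k.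
  by rewrite -!natrM mul_bin_left.
rewrite E natrD -/(F s).
by linear_combination_in k V; ring.
Qed.

Lemma assoc_at_derr u v w : assoc_at u v w -> assoc_at u v (der w).
Proof.
move=> A n m; rewrite nprod_derr nprodDr nprodZr nprod_derr !A.
pose F s := (u *_(n - s) v) *_((m + s).-1) w.
have E1 : n%:R *: (\sum_(s < n.-1.+1)
     'C(n.-1, s)%:R *: ((u *_(n.-1 - s) v) *_(m + s) w)) =
    \sum_(s < n.+1) (s%:R * 'C(n, s)%:R : k) *: F s.
  rewrite [RHS]big_ord_recl mul0r scale0r add0r.
  have [->|n0] := posnP n; first by rewrite scale0r big_ord0.
  rewrite (prednK n0) scaler_sumr; apply: eq_bigr => s _.
  rewrite lift0 scalerA -natrM mul_bin_diag natrM /F addnS /=.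
  by rewrite -subn1 -subnDA add1n.
have E2 : m%:R *: (\sum_(s < n.+1)
     'C(n, s)%:R *: ((u *_(n - s) v) *_(m.-1 + s) w)) =
    \sum_(s < n.+1) (m%:R * 'C(n, s)%:R : k) *: F s.
  rewrite scaler_sumr; apply: eq_bigr => s _; rewrite scalerA /F.
  have [->|m0] := posnP m; first by rewrite mul0r !scale0r.
  by rewrite -(prednK m0) addSn.
rewrite E1 E2 linear_sum -!big_split /=; apply: eq_bigr => s _.
rewrite nprod_derr derZ natrD -/(F s).
by linear_combination_in k V; ring.
Qed.

End AssociativityExtension.

Section CurrentAssociative.
Variables (k : fieldType) (P : algType k).
Implicit Types (f g h : cur P) (p q : P) (a : k).

Lemma nprod_cst_cst p q n :
  cst p *_(n) cst q = if n is 0 then cst (p * q) else 0.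
Proof.
rewrite nprod_cst derivnC; case: n => [|n] /=; last by rewrite scaler0.
by rewrite /cst -mul_polyC -polyCM.
Qed.

Lemma cur_nprodA n m f g h : f *_(n) (g *_(m) h) =
  \sum_(s < n.+1) 'C(n, s)%:R *: ((f *_(n - s) g) *_(m + s) h).
Proof.
apply: (_ : assoc_at f g h).
elim/cur_ind: f => [p|f f' IH IH'|f IH]; first last.
- exact: assoc_at_derl.
- exact: assoc_atDl.
elim/cur_ind: g => [q|g g' IH IH'|g IH]; first last.
- exact: assoc_at_derm.
- exact: assoc_atDm.
elim/cur_ind: h => [r|h h' IH IH'|h IH]; first last.
- exact: assoc_at_derr.
- exact: assoc_atDr.
move=> {}n {}m; rewrite big_ord_recr big1 => [|s _] /=; last first.
  rewrite nprod_cst_cst; case E: (n - s)%N => [|j]; last by rewrite nprod0l scaler0.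
  by move/eqP: E; rewrite subn_eq0 leqNgt ltn_ord.
rewrite add0r subnn binn scale1r !nprod_cst_cst.
case: m => [|m]; last by rewrite nprod0r.
by case: n => [|n]; rewrite ?nprod_cst_cst ?mulrA.
Qed.

HB.instance Definition _ := ConfAlg_isAssoc.Build k (cur P) cur_nprodA.
End CurrentAssociative.

Section NprodOpAdditive.
Variables (k : fieldType) (V : confAlgType k).
Implicit Types u v w : V.

Lemma nprod_opDr n u v v' : nprod_op n u (v + v') = nprod_op n u v + nprod_op n u v'.
Proof.
have [M HM] := nprod_local u v; have [M' HM'] := nprod_local u v'.
have l1 m : (maxn M M' <= m)%N -> u *_(m) v = 0.
  by rewrite geq_max => /andP[/HM].
have l2 m : (maxn M M' <= m)%N -> u *_(m) v' = 0.
  by rewrite geq_max => /andP[_ /HM'].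
have l3 m : (maxn M M' <= m)%N -> u *_(m) (v + v') = 0.
  by move=> le_m; rewrite nprodDr l1 // l2 // addr0.
rewrite (nprod_opE n l1) (nprod_opE n l2) (nprod_opE n l3) -big_split.
by apply: eq_bigr => s _ /=; rewrite nprodDr linearD scalerDr.
Qed.

Lemma nprod_opDl n u u' v : nprod_op n (u + u') v = nprod_op n u v + nprod_op n u' v.
Proof.
have [M HM] := nprod_local u v; have [M' HM'] := nprod_local u' v.
have l1 m : (maxn M M' <= m)%N -> u *_(m) v = 0.
  by rewrite geq_max => /andP[/HM].
have l2 m : (maxn M M' <= m)%N -> u' *_(m) v = 0.
  by rewrite geq_max => /andP[_ /HM'].
have l3 m : (maxn M M' <= m)%N -> (u + u') *_(m) v = 0.
  by move=> le_m; rewrite nprodDl l1 // l2 // addr0.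
rewrite (nprod_opE n l1) (nprod_opE n l2) (nprod_opE n l3) -big_split.
by apply: eq_bigr => s _ /=; rewrite nprodDl linearD scalerDr.
Qed.

End NprodOpAdditive.

Section CurrentCommutative.
Variables (k : fieldType) (char0 : [pchar k] =i pred0) (P : comAlgType k).

(** Both halves of the bracket are sesquilinear, so constants suffice; there only n = 0 matters, and
    P is commutative. *)
Lemma cur_nbracket_eq0 n (f g : cur P) : nbracket n f g = 0.
Proof.
elim/cur_ind: f n => [p|f f' IH IH'|f IH] n; first last.
- rewrite /nbracket nprod_derl nprod_op_derr // -opprD -scalerBr.
  by rewrite -/(nbracket n.-1 f g) IH scaler0 oppr0.
- rewrite /nbracket nprodDl nprod_opDr opprD addrACA.
  by rewrite -!/(nbracket n _ g) IH IH' addr0.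
elim/cur_ind: g n => [q|g g' IH IH'|g IH] n; first last.
- rewrite /nbracket nprod_derr nprod_op_derl // opprD addrACA -derN -derD -scalerN -scalerDr.
  by rewrite -!/(nbracket _ (cst p) g) !IH der0 scaler0 addr0.
- rewrite /nbracket nprodDr nprod_opDl opprD addrACA.
  by rewrite -!/(nbracket n (cst p) _) IH IH' addr0.
rewrite /nbracket (@nprod_opE _ _ 1) => [|m]; last by rewrite nprod_cst_cst; case: m.
rewrite big_ord1 /= addn0 fact0 divr1 !nprod_cst_cst mulrC.
by case: n => [|n]; rewrite ?scaler0 ?subr0 // expr0 scale1r subrr.
Qed.

End CurrentCommutative.

(** * Generators of locality 3 and their brackets *)

Section CurrentGenerators.
Variables (k : fieldType) (P : algType k).
Implicit Types (f g : cur P) (A B : P) (a l m : k).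

Definition cgen A B : cur P := cst A + der (cst B).

Lemma cst_linear a A B : cst (a *: A + B) = a *: cst A + cst B.
Proof.
by apply/polyP => i; rewrite coef_curD coef_curZ !coefC; case: i => //= i; rewrite scaler0 addr0.
Qed.
HB.instance Definition _ := GRing.isLinear.Build k P (cur P) _ (@cst k P) cst_linear.

Lemma coef_der (f : cur P) i :
  (der f : {poly P})`_i = if i is j.+1 then (f : {poly P})`_j else 0.
Proof. by have := coefMX (f : {poly P}) i; case: i. Qed.

Lemma coef_cgen A B i :
  (cgen A B : {poly P})`_i = if i is 0 then A else if i is 1 then B else 0.
Proof.
by rewrite /cgen coef_curD coef_der; case: i => [|[|i]]; rewrite !coefC /= ?addr0 ?add0r.
Qed.

Lemma nprod_cgen A B n f : cgen A B *_(n) f =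
  (A *: (f : {poly P})^`(n) : cur P) - n%:R *: (B *: (f : {poly P})^`(n.-1) : cur P).
Proof. by rewrite /cgen nprodDl nprod_derl !nprod_cst. Qed.

Lemma nprod_cgen_ge3 A B A' B' n : (3 <= n)%N -> cgen A B *_(n) cgen A' B' = 0.
Proof.
case: n => [|[|[|n]]] // _; rewrite /cgen nprodDl nprod_derl !nprodDr !nprod_derr.
by rewrite /= !nprod_cst_cst !(der0, scaler0, addr0, oppr0).
Qed.

Lemma nprod_cgen0 A B A' B' :
  cgen A B *_(0) cgen A' B' = cst (A * A') + der (cst (A * B')).
Proof.
rewrite /cgen nprodDl nprod_derl !nprodDr !nprod_derr /= !nprod_cst_cst.
by rewrite !scale0r oppr0 !addr0.
Qed.

Lemma nprod_cgen1 A B A' B' :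
  cgen A B *_(1) cgen A' B' = cst (A * B') - cst (B * A') - der (cst (B * B')).
Proof.
rewrite /cgen nprodDl nprod_derl !nprodDr !nprod_derr /= !nprod_cst_cst.
by rewrite !der0 !scale1r !scale0r !addr0 !add0r opprD addrA.
Qed.

Lemma nprod_cgen2 A B A' B' :
  cgen A B *_(2) cgen A' B' = - (2%:R *: cst (B * B')).
Proof.
rewrite /cgen nprodDl nprod_derl !nprodDr !nprod_derr /= !nprod_cst_cst.
by rewrite !der0 !scaler0 !scale1r !addr0 !add0r.
Qed.

(** Every bracket of two generators is built from commutators in P. With e sent to 0, the relations
    of U thus become commutation relations in P: those of A = x and B = x eps in g tensor
    k[eps]/(eps^2). *)
Lemma nbracket_cgen0 A B A' B' : (2%:R : k) != 0 ->
  nbracket 0 (cgen A B) (cgen A' B') =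
  cst (A * A') - cst (A' * A) + der (cst (A * B') - cst (B' * A)).
Proof.
move=> k2; rewrite /nbracket nprod_op0; last exact: nprod_cgen_ge3.
rewrite !nprod_cgen0 nprod_cgen1 nprod_cgen2 !(derD, derN, derZ).
by linear_combination_in k (cur P); field.
Qed.

Lemma nbracket_cgen1 A B A' B' :
  nbracket 1 (cgen A B) (cgen A' B') =
  cst (A * B') - cst (B' * A) - (cst (B * A') - cst (A' * B))
  - der (cst (B * B') - cst (B' * B)).
Proof.
rewrite /nbracket nprod_op1; last exact: nprod_cgen_ge3.
rewrite !nprod_cgen1 nprod_cgen2 !(derD, derN, derZ).
by linear_combination_in k (cur P); ring.
Qed.

Lemma nbracket_cgen2 A B A' B' :
  nbracket 2 (cgen A B) (cgen A' B') =
  - (2%:R *: (cst (B * B') - cst (B' * B))).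
Proof.
rewrite /nbracket nprod_op2; last exact: nprod_cgen_ge3.
rewrite !nprod_cgen2.
by linear_combination_in k (cur P); ring.
Qed.

Lemma nbracket_cgen_ge3 A B A' B' n : (3 <= n)%N ->
  nbracket n (cgen A B) (cgen A' B') = 0.
Proof.
move=> n3; rewrite /nbracket nprod_op_ge3 ?subr0 ?nprod_cgen_ge3 //.
exact: nprod_cgen_ge3.
Qed.

End CurrentGenerators.

(** * Evaluation at scalars and generating series *)

Section Evaluation.
Variables (k : fieldType) (char0 : [pchar k] =i pred0) (P : algType k).
Implicit Types (f g : cur P) (A B p : P) (a l nu : k).

Definition ev nu f : P := (f : {poly P}).[nu%:A].

Lemma ev_linear nu : linear (ev nu).
Proof.
move=> a f g; rewrite /ev hornerD; congr (_ + _).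
have /= -> := hornerZ a%:A (f : {poly P}) nu%:A; exact: mulr_algl.
Qed.
HB.instance Definition _ nu := GRing.isLinear.Build k (cur P) P _ (ev nu) (ev_linear nu).

Lemma comm_alg a p : GRing.comm p a%:A.
Proof. by rewrite /GRing.comm mulr_algl mulr_algr. Qed.

Lemma ev_der nu f : ev nu (der f) = nu *: ev nu f.
Proof. by rewrite /ev hornerMX mulr_algr. Qed.

Lemma ev_cst nu p : ev nu (cst p) = p.
Proof. by rewrite /ev hornerC. Qed.

Lemma ev_pscale nu p f : ev nu (p *: (f : {poly P}) : cur P) = p * ev nu f.
Proof. by rewrite /ev hornerZ. Qed.

Lemma ev_taylor M nu l f : (size (f : {poly P}) <= M)%N ->
  \sum_(n < M) (l ^+ n / n`!%:R) *: ev nu ((f : {poly P})^`(n) : cur P) =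
  ev (nu + l) f.
Proof.
move=> le_M; rewrite /ev scalerDl (nderiv_taylor_wide _ le_M); last exact: comm_alg.
apply: eq_bigr => n _; rewrite nderivn_def hornerMn -scaler_nat scalerA.
by rewrite divfK ?(factf_neq0 char0) // exprZn expr1n mulr_algr.
Qed.

(** This is the lambda-product (A + d B)_l f(d) = (A - l B) f(d + l) at d = nu. The strict bound on
    the size of f leaves room for the shift from n to n - 1 in the B-term. *)
Lemma ev_nprod_cgenl M nu l A B f : (size (f : {poly P}) < M)%N ->
  \sum_(n < M) (l ^+ n / n`!%:R) *: ev nu (cgen A B *_(n) f) =
  (A - l *: B) * ev (nu + l) f.
Proof.
move=> lt_M; rewrite mulrBl -[in A * _](ev_taylor _ _ (ltnW lt_M)) mulr_sumr.
have -> : l *: B * ev (nu + l) f = \sum_(n < M)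
    (l ^+ n / n`!%:R) *: (n%:R *: (B * ev nu ((f : {poly P})^`(n.-1) : cur P))).
  case: M lt_M => // M; rewrite ltnS => le_M.
  rewrite big_ord_recl scale0r scaler0 add0r -(ev_taylor nu l le_M) mulr_sumr.
  apply: eq_bigr => n _; rewrite lift0 /= -scalerAl -!scalerAr !scalerA.
  congr (_ *: _); rewrite factS natrM exprS.
  by field; rewrite nat1r (natf_neq0S char0) (factf_neq0 char0).
rewrite -sumrB; apply: eq_bigr => n _.
rewrite nprod_cgen linearB linearZ /= !ev_pscale scalerBr.
by rewrite scalerAr.
Qed.

Lemma horner_wide M nu f : (size (f : {poly P}) <= M)%N ->
  ev nu f = \sum_(n < M) nu ^+ n *: (f : {poly P})`_n.
Proof.
move=> le_M; rewrite /ev (horner_coef_wide _ le_M); apply: eq_bigr => n _.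
by rewrite exprZn expr1n mulr_algr.
Qed.

Lemma nprod_cgenr n f A B : f *_(n) cgen A B =
  (((-1) ^+ n * n`!%:R : k) *: cst ((f : {poly P})`_n * A)) +
  der (((-1) ^+ n * n`!%:R : k) *: cst ((f : {poly P})`_n * B)) +
  n%:R *: (((-1) ^+ n.-1 * n.-1`!%:R : k) *: cst ((f : {poly P})`_n.-1 * B)).
Proof. by rewrite /cgen nprodDr nprod_derr !nprod_cstr addrA. Qed.

(** The lambda-product f(d)_l (A + d B) = f(-l) (A + (d + l) B) at d = nu: in the left argument d
    becomes the scalar -l. *)
Lemma ev_nprod_cgenr M nu l A B f : (size (f : {poly P}) < M)%N ->
  \sum_(n < M) (l ^+ n / n`!%:R) *: ev nu (f *_(n) cgen A B) =
  ev (- l) f * (A + (nu + l) *: B).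
Proof.
move=> lt_M; rewrite mulrDr scalerDl mulrDr addrA.
have E C : ev (- l) f * C =
    \sum_(n < M) ((- l) ^+ n *: ((f : {poly P})`_n * C)).
  rewrite (horner_wide _ (ltnW lt_M)) mulr_suml; apply: eq_bigr => n _.
  by rewrite scalerAl.
have -> : ev (- l) f * (l *: B) = \sum_(n < M) (l ^+ n / n`!%:R) *:
    (n%:R *: (((-1) ^+ n.-1 * n.-1`!%:R : k) *: ((f : {poly P})`_n.-1 * B))).
  case: M lt_M {E} => // M; rewrite ltnS => le_M.
  rewrite big_ord_recl scale0r scaler0 add0r (horner_wide _ le_M) mulr_suml.
  apply: eq_bigr => n _; rewrite lift0 /= -scalerAl -!scalerAr !scalerA.
  congr (_ *: _); rewrite factS natrM exprS (exprNn l).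
  by field; rewrite nat1r (natf_neq0S char0) (factf_neq0 char0).
rewrite !E -!big_split; apply: eq_bigr => n _ /=.
rewrite nprod_cgenr !linearD /= ev_der !linearZ /= !ev_cst ?scalerDr.
rewrite -!scalerAr !scalerA; congr (_ *: _ + _ *: _ + _).
- by rewrite (exprNn l); field; rewrite (factf_neq0 char0).
- by rewrite (exprNn l); field; rewrite (factf_neq0 char0).
Qed.

Lemma poly_eq0_of_root_all (q : {poly k}) : (forall l, q.[l] = 0) -> q = 0.
Proof.
move=> q0; apply: contraTeq isT => qn0.
have := @max_poly_roots k q [seq n%:R | n <- iota 0 (size q)] qn0.
rewrite size_map size_iota ltnn; apply.
  by apply/allP => l _; rewrite /root q0.
rewrite map_inj_uniq ?iota_uniq // => m n /eqP.
wlog le_mn : m n / (m <= n)%N.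
  by move=> H; case/orP: (leq_total m n) => /H // H'; rewrite eq_sym => /H' ->.
rewrite eq_sym -subr_eq0 -natrB // ((pcharf0P k).1 char0) subn_eq0 => le_nm.
by apply/eqP; rewrite eqn_leq le_mn.
Qed.

(** In characteristic zero the field is infinite and the factorials are invertible, so a generating
    series that vanishes at every scalar has zero coefficients. *)
Lemma coef_sum_eq0 M (F : nat -> k) :
  (forall l, \sum_(n < M) (l ^+ n / n`!%:R) * F n = 0) ->
  forall n, (n < M)%N -> F n = 0.
Proof.
move=> F0 n lt_n; have : \poly_(n < M) (F n / n`!%:R) = 0.
  apply: poly_eq0_of_root_all => l; rewrite horner_poly -[RHS](F0 l).
  by apply: eq_bigr => i _; ring.
move=> /polyP /(_ n) /eqP; rewrite coef_poly lt_n coef0 mulf_eq0 invr_eq0.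
by rewrite (negbTE (factf_neq0 char0 n)) orbF => /eqP.
Qed.

End Evaluation.

(** * Straightening of words *)

Section Straightening.
Variables (Z : eqType) (le : rel Z).
Hypotheses (le_total : total le) (le_trans : transitive le).

Fixpoint first_descent (w : seq Z) : option (seq Z * Z * Z * seq Z) :=
  if w is x :: w' then
    if w' is y :: v then
      if le x y then
        omap (fun d : seq Z * Z * Z * seq Z =>
                let: (u, a, b, v') := d in (x :: u, a, b, v')) (first_descent w')
      else Some ([::], x, y, v)
    else None
  else None.

Local Arguments first_descent : simpl never.

Lemma first_descent_cons2 x y v : first_descent (x :: y :: v) =
  if le x y then
    omap (fun d : seq Z * Z * Z * seq Z =>
            let: (u, a, b, v') := d in (x :: u, a, b, v')) (first_descent (y :: v))
  else Some ([::], x, y, v).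
Proof. by []. Qed.

Lemma first_descentN w : first_descent w = None -> sorted le w.
Proof.
elim: w => [|x [|y v] IH] //; rewrite first_descent_cons2 [sorted _ _]/=.
case: (le x y) => //.
by case E: (first_descent _) => [p|] //= _; apply: IH.
Qed.

Lemma first_descentS w u x y v : first_descent w = Some (u, x, y, v) ->
  w = u ++ x :: y :: v /\ ~~ le x y.
Proof.
elim: w u => [|a [|b w] IH] u //; rewrite first_descent_cons2; case ab: (le a b).
  case E: (first_descent _) => [[[[u' x'] y'] v']|] //= [<- ex ey ev].
  by move: E; rewrite ex ey ev => /IH [-> ->].
by case=> <- <- <- <-; rewrite ab.
Qed.

Lemma first_descent_min w u x y v u' x' y' v' :
  first_descent w = Some (u, x, y, v) -> w = u' ++ x' :: y' :: v' ->
  ~~ le x' y' -> (size u <= size u')%N.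
Proof.
elim: w u u' => [|a [|b w] IH] u u' //; rewrite first_descent_cons2.
case ab: (le a b); last by case=> <-.
case E: (first_descent _) => [[[[u1 x1] y1] v1]|] //= [<- ex ey ev].
move: E; rewrite ex ey ev => {}E.
case: u' => [|c u'] /=; first by case=> <- <- _; rewrite ab.
by case=> _ e n; rewrite ltnS; apply: IH E e n.
Qed.

Lemma descent_sorted_None w : sorted le w -> first_descent w = None.
Proof.
elim: w => [|x [|y v] IH] //= /andP[xy s].
by rewrite first_descent_cons2 xy IH.
Qed.

Fixpoint inversions (w : seq Z) : nat :=
  if w is x :: w' then (count (fun y => ~~ le x y) w' + inversions w')%N else 0%N.

Lemma inversions_swap u x y v : ~~ le x y ->
  inversions (u ++ x :: y :: v) = (inversions (u ++ y :: x :: v)).+1.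
Proof.
move=> nxy; have yx : le y x by have := le_total x y; rewrite (negbTE nxy).
elim: u => [|a u IH] /=; first by rewrite nxy yx /=; lia.
by rewrite IH !count_cat /=; lia.
Qed.

(** Induction on the length, then on the number of inversions: a bracket lowers the first, a swap
    keeps it and lowers the second. *)
Lemma straightening_ind (K : seq Z -> Prop) :
  (forall w, sorted le w -> K w) ->
  (forall u x y v, ~~ le x y -> K (u ++ y :: x :: v) ->
     (forall a, K (u ++ a :: v)) -> K (u ++ x :: y :: v)) ->
  forall w, K w.
Proof.
move=> K0 KS w; have [n] := ubnP (size w); elim: n w => // n IHn w.
have [m] := ubnP (inversions w); elim: m w => // m IHm w inv_w size_w.
case E: (first_descent w) => [[[[u x] y] v]|]; last exact/K0/first_descentN.
have [ew nxy] := first_descentS E; rewrite ew; apply: KS => //.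
- apply: IHm; first by move: inv_w; rewrite ew inversions_swap.
  by move: size_w; rewrite ew !size_cat /=.
- by move=> a; apply: IHn; move: size_w; rewrite ew !size_cat /=; lia.
Qed.

(** The relative positions of two adjacent pairs, the first not to the right of the second: equal,
    overlapping in one letter, disjoint. These are the ambiguities of the diamond lemma. *)
Lemma two_pairs u0 x0 y0 v0 u x y v : u0 ++ x0 :: y0 :: v0 = u ++ x :: y :: v ->
  (size u0 <= size u)%N ->
  [\/ [/\ u = u0, x = x0, y = y0 & v = v0 :> seq Z],
      [/\ u = rcons u0 x0, x = y0 & v0 = y :: v]
    | exists2 t, u = u0 ++ x0 :: y0 :: t & v0 = t ++ x :: y :: v].
Proof.
elim: u0 u => [|c u0 IH] u /=.
  case: u => [|a [|b t]] /=; case.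
  - by move=> -> -> -> _; apply: Or31.
  - by move=> -> -> -> _; apply: Or32.
  - by move=> -> -> -> _; apply: Or33; exists t.
case: u => // a u [-> e]; rewrite ltnS => /(IH _ e) [[-> -> -> ->]|[-> -> ->]|[t -> ->]].
- exact: Or31.
- exact: Or32.
- by apply: Or33; exists t.
Qed.

End Straightening.

Definition lin (k : fieldType) (T : Type) (V : lmodType k) (s : seq (k * T)) (phi : T -> V) : V :=
  \sum_(p <- s) p.1 *: phi p.2.

(** A list of coefficient-letter pairs represents a linear combination in many ways, so the Lie
    axioms are only required after evaluation by an arbitrary [phi]. *)
Record lie_constants (k : fieldType) (Z : Type) (br : Z -> Z -> seq (k * Z)) (Q : lmodType k) :
    Prop := LieConstants {
  constants_skew : forall x y (phi : Z -> Q), lin (br x y) phi = - lin (br y x) phi;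
  constants_alt : forall x (phi : Z -> Q), lin (br x x) phi = 0;
  constants_jacobi : forall x y z (phi : Z -> Q),
    lin (br x y) (fun a => lin (br a z) phi) +
    lin (br y z) (fun a => lin (br a x) phi) +
    lin (br z x) (fun a => lin (br a y) phi) = 0
}.

(** * The PBW theorem by straightening *)

Section PBW.
Variables (k : fieldType) (Q : lmodType k) (Z : eqType) (le : rel Z).
Hypotheses (le_total : total le) (le_trans : transitive le).
Hypothesis (le_anti : antisymmetric le).
Variable br : Z -> Z -> seq (k * Z).

Hypothesis br_lie : lie_constants br Q.
Local Notation br_skew := (constants_skew br_lie).
Local Notation br_alt := (constants_alt br_lie).
Local Notation br_jacobi := (constants_jacobi br_lie).
Variable f0 : seq Z -> Q.

(** [N] handles the shorter words. The fuel starts at the number of inversions and each swap removes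
    exactly one, so the default 0 is never reached: a word without inversions has no descent. *)
Fixpoint straighten_step (N : seq Z -> Q) (fuel : nat) (w : seq Z) : Q :=
  if first_descent le w is Some (u, x, y, v) then
    if fuel is m.+1 then
      straighten_step N m (u ++ y :: x :: v) + lin (br x y) (fun a => N (u ++ a :: v))
    else 0
  else f0 w.

Fixpoint straighten_size (n : nat) : seq Z -> Q :=
  if n is m.+1 then
    fun w => straighten_step (straighten_size m) (inversions le w) w
  else f0.

Definition straighten (w : seq Z) : Q := straighten_size (size w) w.

Lemma straighten_sorted w : sorted le w -> straighten w = f0 w.
Proof.
move=> sw; rewrite /straighten; case: (size w) => //= n.
by case: (inversions le w) => /= [|m]; rewrite descent_sorted_None.
Qed.

Lemma straightenE w u x y v : first_descent le w = Some (u, x, y, v) ->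
  straighten w = straighten (u ++ y :: x :: v) +
    lin (br x y) (fun a => straighten (u ++ a :: v)).
Proof.
move=> E; have [ew nxy] := first_descentS E.
have sz : size w = (size u + size v).+2 by rewrite ew size_cat /= !addnS.
rewrite {1}/straighten sz /= ew inversions_swap //= -ew E; congr (_ + _).
  by rewrite /straighten size_cat /= !addnS.
by apply: eq_bigr => p _; rewrite /straighten size_cat /= !addnS.
Qed.

Lemma linD (T : Type) (V : lmodType k) (s : seq (k * T)) (phi psi : T -> V) :
  lin s (fun a => phi a + psi a) = lin s phi + lin s psi.
Proof. by rewrite /lin -big_split; apply: eq_bigr => p _ /=; rewrite scalerDr. Qed.

Lemma linC (T T' : Type) (V : lmodType k) (s : seq (k * T)) (t : seq (k * T'))
    (F : T -> T' -> V) :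
  lin s (fun a => lin t (F a)) = lin t (fun b => lin s (F^~ b)).
Proof.
rewrite /lin (eq_bigr (fun p => \sum_(q <- t) p.1 *: (q.1 *: F p.2 q.2))).
  rewrite exchange_big; apply: eq_bigr => q _; rewrite scaler_sumr.
  by apply: eq_bigr => p _; rewrite !scalerA mulrC.
by move=> p _; rewrite scaler_sumr.
Qed.

Lemma eq_lin (T : Type) (V : lmodType k) (s : seq (k * T)) (phi psi : T -> V) :
  phi =1 psi -> lin s phi = lin s psi.
Proof. by move=> e; apply: eq_bigr => p _; rewrite e. Qed.

(** In length n, the statement that [straighten] factors through the enveloping algebra. *)
Definition swap_rule n := forall u x y v, size (u ++ x :: y :: v) = n ->
  straighten (u ++ x :: y :: v) = straighten (u ++ y :: x :: v) +
    lin (br x y) (fun a => straighten (u ++ a :: v)).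

(** The diamond lemma, by induction on inversions. By construction [straighten] resolves the
    leftmost descent; another descent is compared with it by rewriting both words further until they
    agree. The corrections have length n, where [swap_rule n] applies. *)
Lemma straighten_swap_descent n : swap_rule n ->
  forall u x y v, size (u ++ x :: y :: v) = n.+1 -> ~~ le x y ->
  straighten (u ++ x :: y :: v) = straighten (u ++ y :: x :: v) +
    lin (br x y) (fun a => straighten (u ++ a :: v)).
Proof.
move=> swapn u x y v; move ew: (u ++ x :: y :: v) => w.
have [m] := ubnP (inversions le w); elim: m w u x y v ew => // m IHm w u x y v ew.
rewrite ltnS => inv_w size_w nxy.
case E: (first_descent le w) => [[[[u0 x0] y0] v0]|]; last first.
  move/first_descentN: E; rewrite -ew sorted_pairwise // pairwise_cat /=.
  by rewrite (negbTE nxy) !andbF.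
have [ew0 nxy0] := first_descentS E.
rewrite (straightenE E).
have le_sz := first_descent_min E (esym ew) nxy.
move: ew0; rewrite -ew => /esym /two_pairs /(_ le_sz).
have IH u' x' y' v' : (inversions le (u' ++ x' :: y' :: v') < m)%N ->
    size (u' ++ x' :: y' :: v') = n.+1 -> ~~ le x' y' ->
    straighten (u' ++ x' :: y' :: v') = straighten (u' ++ y' :: x' :: v') +
    lin (br x' y') (fun a => straighten (u' ++ a :: v')) by exact: IHm.
case=> [[-> -> -> ->] //|[eu ex ev]|[t eu ev]].
(* Overlap a > b > c: both ways of rewriting end in c b a, and the corrections agree by the Jacobi
   identity. *)
- subst x v0; move: eu; rewrite -cats1 => eu; subst u; rename y0 into b.
  rename x0 into a; rename y into c.
  have nac : ~~ le a c.
    apply: contra nxy0 => ac; apply: le_trans ac _.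
    by have := le_total b c; rewrite (negbTE nxy).
  have ew' : u0 ++ a :: b :: c :: v = w by rewrite -ew -catA.
  have i1 := inversions_swap le_total u0 (c :: v) nxy0.
  have i2 : inversions le (u0 ++ b :: a :: c :: v) =
      (inversions le (u0 ++ b :: c :: a :: v)).+1.
    by have := inversions_swap le_total (u0 ++ [:: b]) v nac; rewrite -!catA.
  have i3 : inversions le (u0 ++ a :: b :: c :: v) =
      (inversions le (u0 ++ a :: c :: b :: v)).+1.
    by have := inversions_swap le_total (u0 ++ [:: a]) v nxy; rewrite -!catA.
  have i4 := inversions_swap le_total u0 (b :: v) nac.
  have sz : size u0 + size v = n.-2 /\ n = n.-2.+2.
    by move: size_w; rewrite -ew' size_cat /=; lia.
  have szT p q r : size (u0 ++ p :: q :: r :: v) = n.+1.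
    by rewrite size_cat /=; lia.
  have szS p q : size (u0 ++ p :: q :: v) = n by rewrite size_cat /=; lia.
  rewrite ew' in i1 i3.
  have E1 := IH (u0 ++ [:: b]) a c v; rewrite -!catA /= in E1.
  have E2 := IH u0 b c (a :: v).
  have E3 := IH u0 a c (b :: v).
  have E4 := IH (u0 ++ [:: c]) a b v; rewrite -!catA /= in E4.
  rewrite E1 ?szT //; last by lia.
  rewrite E2 ?szT //; last by lia.
  rewrite -!catA /= E3 ?szT //; last by lia.
  rewrite E4 ?szT //; last by lia.
  have J : lin (br a b) (fun d => straighten (u0 ++ d :: c :: v)) =
      lin (br a b) (fun d => straighten (u0 ++ c :: d :: v)) +
      lin (br a b) (fun d => lin (br d c) (fun e => straighten (u0 ++ e :: v))).
    by rewrite -linD; apply: eq_lin => d; rewrite swapn.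
  have J' : lin (br b c) (fun d => straighten (u0 ++ d :: a :: v)) =
      lin (br b c) (fun d => straighten (u0 ++ a :: d :: v)) +
      lin (br b c) (fun d => lin (br d a) (fun e => straighten (u0 ++ e :: v))).
    by rewrite -linD; apply: eq_lin => d; rewrite swapn.
  have J'' : lin (br a c) (fun d => straighten (u0 ++ d :: b :: v)) =
      lin (br a c) (fun d => straighten (u0 ++ b :: d :: v)) -
      lin (br c a) (fun d => lin (br d b) (fun e => straighten (u0 ++ e :: v))).
    by rewrite -br_skew -linD; apply: eq_lin => d; rewrite swapn.
  have := br_jacobi a b c (fun e => straighten (u0 ++ e :: v)).
  move/(canRL (addrK _)); rewrite sub0r => /(canRL (addrK _)) J0.
  have F s t : lin s (fun d => straighten ((u0 ++ t) ++ d :: v)) =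
      lin s (fun d => straighten (u0 ++ t ++ d :: v)).
    by apply: eq_lin => d; rewrite -catA.
  rewrite !F /= J J' J'' J0.
  by linear_combination_in k Q; ring.
(* Disjoint descents: the two swaps commute, and by [linC] so do the two brackets. *)
- subst u v0.
  have ew' : u0 ++ x0 :: y0 :: t ++ x :: y :: v = w by rewrite -ew -catA.
  have i1 := inversions_swap le_total u0 (t ++ x :: y :: v) nxy0.
  have i2 : inversions le (u0 ++ x0 :: y0 :: t ++ x :: y :: v) =
      (inversions le (u0 ++ x0 :: y0 :: t ++ y :: x :: v)).+1.
    by have := inversions_swap le_total (u0 ++ x0 :: y0 :: t) v nxy; rewrite -!catA.
  rewrite ew' in i1 i2.
  have E1 := IH (u0 ++ y0 :: x0 :: t) x y v; rewrite -!catA /= in E1.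
  have E2 := IH u0 x0 y0 (t ++ y :: x :: v).
  have szT p q r s : size (u0 ++ p :: q :: t ++ r :: s :: v) = n.+1.
    by rewrite -size_w -ew' !size_cat /= !size_cat.
  have szS p q r : size (u0 ++ p :: q :: t ++ r :: v) = n.
    by move: size_w; rewrite -ew' !size_cat /= !size_cat /=; lia.
  have szS' p q r : size (u0 ++ p :: t ++ q :: r :: v) = n.
    by move: size_w; rewrite -ew' !size_cat /= !size_cat /=; lia.
  rewrite E1 ?szT //; last by lia.
  have F s r : lin s (fun d => straighten ((u0 ++ r) ++ d :: v)) =
      lin s (fun d => straighten (u0 ++ r ++ d :: v)).
    by apply: eq_lin => d; rewrite -catA.
  rewrite -!catA /= E2 ?szT //; last by lia.
  have J : lin (br x0 y0) (fun d => straighten (u0 ++ d :: t ++ x :: y :: v)) =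
      lin (br x0 y0) (fun d => straighten (u0 ++ d :: t ++ y :: x :: v)) +
      lin (br x0 y0) (fun d => lin (br x y) (fun e => straighten (u0 ++ d :: t ++ e :: v))).
    rewrite -linD; apply: eq_lin => d.
    have := swapn (u0 ++ d :: t) x y v; rewrite -!catA /= szS' => -> //.
    by rewrite F.
  have J' : lin (br x y) (fun d => straighten ((u0 ++ x0 :: y0 :: t) ++ d :: v)) =
      lin (br x y) (fun d => straighten (u0 ++ y0 :: x0 :: t ++ d :: v)) +
      lin (br x y) (fun d => lin (br x0 y0) (fun e => straighten (u0 ++ e :: t ++ d :: v))).
    by rewrite -linD; apply: eq_lin => d; rewrite -catA /= swapn ?szS.
  rewrite J J' linC !F /=.
  by linear_combination_in k Q; ring.
Qed.

(** An ascent is a descent read backwards, by skew-symmetry; for equal letters the bracket is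
    zero. *)
Lemma straighten_swap n : swap_rule n.
Proof.
elim: n => [|n IHn] u x y v; first by rewrite size_cat /= addnS.
move=> sz; have [xy|] := boolP (le x y); last exact: (straighten_swap_descent IHn sz).
have [->|nxy] := eqVneq x y; first by rewrite br_alt addr0.
have nyx : ~~ le y x by apply: contra nxy => yx; apply/eqP/le_anti; rewrite xy yx.
rewrite (straighten_swap_descent IHn _ nyx); last by rewrite -sz !size_cat.
by rewrite br_skew -addrA addNr addr0.
Qed.

Lemma straightenS u x y v : straighten (u ++ x :: y :: v) =
  straighten (u ++ y :: x :: v) + lin (br x y) (fun a => straighten (u ++ a :: v)).
Proof. exact: straighten_swap. Qed.

End PBW.

(** * Spanning *)

Lemma perm_adjacent (T : eqType) (R : seq T -> seq T -> Prop) :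
  (forall s, R s s) -> (forall s t r, R s t -> R t r -> R s r) ->
  (forall l1 p q l2, R (l1 ++ p :: q :: l2) (l1 ++ q :: p :: l2)) ->
  forall s t, perm_eq s t -> R s t.
Proof.
move=> Rrefl Rtrans Rswap s t; rewrite -[s]cat0s -[t]cat0s; move: [::] => l.
rewrite perm_cat2l; elim: s l t => [|a s IH] l t st.
  by move/perm_size/esym/size0nil: st => ->.
have et : a \in t by rewrite -(perm_mem st) mem_head.
case/path.splitPr: et st => t1 t2; rewrite perm_sym -cat1s perm_catCA /= perm_cons perm_sym => st.
apply: (Rtrans _ (l ++ a :: t1 ++ t2)).
  by have := IH (rcons l a) (t1 ++ t2) st; rewrite !cat_rcons.
elim: t1 l {st IH} => [|b t1 IH] l //=.
apply: (Rtrans _ (l ++ b :: a :: t1 ++ t2)); first exact: Rswap.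
by have := IH (rcons l b); rewrite !cat_rcons.
Qed.

Section Envelope.
Variables (k : fieldType) (char0 : [pchar k] =i pred0) (V : assocConfAlgType k).
Variables (disp : Order.disp_t) (Y : orderType disp) (j : Y -> V) (e : V) (br : Y -> Y -> seq (k * Y)) (B : Y -> Y -> k).
Hypothesis loc3 : forall x y n, (3 <= n)%N -> j x *_(n) j y = 0.
Hypotheses (der_e : der e = 0) (gen_e : forall x n, j x *_(n) e = 0).
Hypothesis bracket0 : forall x y, nbracket 0 (j x) (j y) = lin (br x y) j.
Hypothesis bracket1 : forall x y, nbracket 1 (j x) (j y) = B x y *: e.
Hypothesis bracket2 : forall x y, nbracket 2 (j x) (j y) = 0.

Hypothesis generate : forall S : set V, conf_subalgebra S -> S e ->
  (forall x, S (j x)) -> forall v, S v.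

Local Notation L n x v := (j x *_(n) v).
Ltac lc := linear_combination_in k V.

Let two_neq0 : (2%:R : k) != 0. Proof. exact: (natf_neq0S char0 1). Qed.
Let three_neq0 : (3%:R : k) != 0. Proof. exact: (natf_neq0S char0 2). Qed.

Lemma comm0 x y : j x *_(0) j y = j y *_(0) j x - der (j y *_(1) j x) +
  (2%:R^-1 : k) *: der (der (j y *_(2) j x)) + lin (br x y) j.
Proof.
have /eqP := bracket0 x y; rewrite /nbracket subr_eq => /eqP ->.
by rewrite (nprod_op0 (@loc3 y x)) addrC.
Qed.

Lemma comm1 x y : j x *_(1) j y = - (j y *_(1) j x) + der (j y *_(2) j x) + B x y *: e.
Proof.
have /eqP := bracket1 x y; rewrite /nbracket subr_eq => /eqP ->.
by rewrite (nprod_op1 (@loc3 y x)) addrC.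
Qed.

Lemma comm2 x y : j x *_(2) j y = j y *_(2) j x.
Proof.
have /eqP := bracket2 x y; rewrite /nbracket subr_eq add0r => /eqP ->.
by rewrite (nprod_op2 (@loc3 y x)).
Qed.

(** Since d e = 0, the rule (d e)_(n+1) v = -(n + 1) e_(n) v leaves nothing else in characteristic
    zero. *)
Lemma torsion_mul n v : e *_(n) v = 0.
Proof.
have /eqP := nprod_derl n.+1 e v.
rewrite der_e nprod0l eq_sym oppr_eq0 scaler_eq0.
by rewrite (negbTE (natf_neq0S char0 n)) => /eqP.
Qed.

Lemma sum_ord_widen M a (F : nat -> V) : (a <= M)%N ->
  (forall r, (a <= r)%N -> F r = 0) -> \sum_(r < a) F r = \sum_(r < M) F r.
Proof.
move=> le_aM F0; rewrite -(subnKC le_aM) big_split_ord /= [X in _ + X]big1 ?addr0 //.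
by move=> i _; rewrite F0 ?leq_addr.
Qed.

(** Locality 3 leaves only the products x_(r) y with r < 3. Truncated indices are harmless: whenever
    one occurs, its coefficient n or C(n, 2) is 0. *)
Lemma mulLL n x m y w : L n x (L m y w) =
  (j x *_(0) j y) *_(n + m) w + n%:R *: ((j x *_(1) j y) *_((n + m).-1) w) +
  'C(n, 2)%:R *: ((j x *_(2) j y) *_((n + m).-2) w).
Proof.
pose F r := ('C(n, r)%:R : k) *: ((j x *_(r) j y) *_(n + m - r) w).
rewrite nprodA (reindex_inj rev_ord_inj) /=.
transitivity (\sum_(r < n.+1) F r).
  apply: eq_bigr => -[r /=]; rewrite ltnS => le_rn _.
  by rewrite subSS bin_sub // subKn // /F addnC addnBAC.
transitivity (\sum_(r < 3) F r).
  rewrite (@sum_ord_widen (maxn n.+1 3)) ?leq_maxl //; last first.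
    by move=> r lt_nr; rewrite /F bin_small ?scale0r.
  rewrite -(@sum_ord_widen (maxn n.+1 3) 3) ?leq_maxr // => r le_r.
  by rewrite /F loc3 // nprod0l scaler0.
rewrite !big_ord_recl big_ord0 /F /= /bump /= !add1n bin0 scale1r bin1 subn0 subn1 subn2.
by rewrite addr0 addrA.
Qed.

Lemma binomial2 n : ('C(n, 2)%:R : k) = n%:R * (n%:R - 1) / 2%:R.
Proof.
elim: n => [|n IH]; first by rewrite mul0r mul0r.
by rewrite binS bin1 natrD IH -natr1; field.
Qed.

Lemma mulr_pred n : (n%:R * n.-1%:R : k) = n%:R * (n%:R - 1).
Proof. by case: n => [|n]; rewrite ?mul0r //= -natr1 addrK. Qed.

(** The commutator formula [L_n^x, L_m^y] = L_(n+m)^[x,y]. After expansion the 1- and 2-products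
    cancel, and the form drops out because e multiplies everything to 0. *)
Lemma mulL_comm n x m y w : L n x (L m y w) =
  L m y (L n x w) + lin (br x y) (fun a => L (n + m) a w).
Proof.
(* The predecessor is truncated only for n = m = 0, where the factor in front is 0. *)
have nK : n%:R * (n + m).-1%:R = n%:R * (n%:R + m%:R - 1) :> k.
  by case: n => [|n]; rewrite ?mul0r //= natrD; ring.
have KK := mulr_pred (n + m); rewrite !natrD in KK.
rewrite !mulLL (comm0 x y) (comm1 x y) (comm2 x y) !nprodDl !nprodNl.
rewrite !nprodZl !nprod_derl.
rewrite torsion_mul /lin nprod_suml [(m + n)%N]addnC.
under [in LHS]eq_bigr => p _ do rewrite nprodZl.
set s := \sum_(_ <- _) _; rewrite natrD !binomial2.
set a0 := _ *_(n + m) w; set a1 := _ *_((n + m).-1) w; set a2 := _ *_((n + m).-2) w.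
move: (n + m).-1%:R nK KK => q nK KK.
lc; try ring.
transitivity ((n%:R + m%:R) * q / 2%:R - n%:R * q + n%:R * (n%:R - 1) / 2%:R).
  by field.
by rewrite nK KK; field.
Qed.

Lemma comm_der21 x y : der (j x *_(2) j y) = L 1 x (j y) + L 1 y (j x) - B y x *: e.
Proof. by rewrite (comm1 y x); lc; ring. Qed.

Lemma L1_der x v : L 1 x (der v) = der (L 1 x v) + L 0 x v.
Proof. by rewrite nprod_derr scale1r. Qed.

Lemma L0_der x v : L 0 x (der v) = der (L 0 x v).
Proof. by rewrite nprod_derr scale0r addr0. Qed.

Lemma lin_loc0 (s : seq (k * Y)) n y : (3 <= n)%N -> lin s (fun a => L n a (j y)) = 0.
Proof. by move=> n3; rewrite /lin big1 // => p _; rewrite loc3 // scaler0. Qed.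

Lemma L_loc0 m x n a b : (3 <= n)%N -> L m x (L n a (j b)) = 0.
Proof. by move=> n3; rewrite loc3 // nprod0r. Qed.

Lemma mul00_gen x y u m : (3 <= m)%N -> (j x *_(0) j y) *_(m) j u = 0.
Proof.
move=> m3; have := mulLL 0 x m y (j u).
by rewrite (loc3 y u m3) nprod0r scale0r bin_small // scale0r !addr0 => <-.
Qed.

Lemma mul1_gen x y u m : (j x *_(1) j y) *_(m) j u = L 1 x (L m y (j u)) - (j x *_(0) j y) *_(m.+1) j u.
Proof. by rewrite mulLL add1n scale1r bin_small // scale0r addr0 [X in X - _]addrC addrK. Qed.

Lemma mul2_gen x y u m : (j x *_(2) j y) *_(m) j u =
  L 2 x (L m y (j u)) - (j x *_(0) j y) *_(m.+2) j u - 2%:R *: ((j x *_(1) j y) *_(m.+1) j u).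
Proof. by rewrite mulLL add2n binn /=; lc; ring. Qed.

(** x_(3) (z_(1) u) vanishes, by commuting the operators and locality; its expansion by
    associativity is 3 times the product in question. *)
Lemma L2L2_gen x z u : L 2 x (L 2 z (j u)) = 0.
Proof.
have e1 : L 3 x (L 1 z (j u)) = 0.
  by rewrite mulL_comm L_loc0 // add0r lin_loc0.
move: e1; rewrite mulLL /= mul00_gen // mul1_gen (L_loc0 1) // mul00_gen //.
rewrite mul2_gen mul00_gen // mul1_gen (L_loc0 1) // mul00_gen //.
rewrite !subr0 !scaler0 subr0 !add0r (_ : 'C(3, 2) = 3)%N // => /eqP.
by rewrite scaler_eq0 (negbTE three_neq0) => /eqP.
Qed.

Lemma LnL2_gen n x z u : (2 <= n)%N -> L n x (L 2 z (j u)) = 0.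
Proof.
rewrite leq_eqVlt => /orP[/eqP<-|n3]; first exact: L2L2_gen.
have n4 : (3 <= n.+1)%N by rewrite ltnW.
have n5 : (3 <= n.+2)%N by apply: leq_trans n3 _; rewrite -addn2 leq_addr.
rewrite mulLL addn2 /= (mul00_gen _ _ _ n5) mul1_gen (L_loc0 _ _ _ _ n4).
rewrite (mul00_gen _ _ _ n5) mul2_gen (L_loc0 _ _ _ _ n3) (mul00_gen _ _ _ n5).
rewrite mul1_gen (L_loc0 _ _ _ _ n4) (mul00_gen _ _ _ n5).
by rewrite !subr0 !scaler0 subr0 scaler0 !addr0.
Qed.

(** z_(3) (y_(0) u) vanishes in the same way, and its expansion is 3 (L_2^z L_1^y u - L_1^z L_2^y
    u); L_2^z and L_1^y commute on u by locality. *)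
Lemma L1L2_swap y z u : L 1 y (L 2 z (j u)) = L 1 z (L 2 y (j u)).
Proof.
have e1 : L 3 z (L 0 y (j u)) = 0.
  by rewrite mulL_comm L_loc0 // add0r lin_loc0.
have e2 : L 2 z (L 1 y (j u)) = L 1 y (L 2 z (j u)).
  by rewrite mulL_comm lin_loc0 // addr0.
move: e1; rewrite -e2 mulLL /= mul00_gen // mul1_gen mul00_gen // subr0.
rewrite mul2_gen mul00_gen // mul1_gen mul00_gen // !subr0 add0r.
rewrite (_ : 'C(3, 2) = 3)%N // -scalerDr => /eqP.
rewrite scaler_eq0 (negbTE three_neq0) /= => /eqP e3.
have {}e3 : L 1 z (L 2 y (j u)) + (L 2 z (L 1 y (j u)) -
  2%:R *: L 1 z (L 2 y (j u))) = 0 := e3.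
by apply/eqP; rewrite -subr_eq0 -e3; apply/eqP; lc; ring.
Qed.

(* filt d contains the monomials of length at most d; all the reductions below are
   made modulo shorter monomials. *)
Inductive filt : nat -> V -> Prop :=
| filt0 d : filt d 0
| filt_lin d a u v : filt d u -> filt d v -> filt d (a *: u + v)
| filt_e d : filt d e
| filt_der d s z : filt d.+1 (iter s der (j z))
| filt_L2 d z u : filt d.+2 (L 2 z (j u))
| filt_L d n x v : (n < 2)%N -> filt d v -> filt d.+1 (L n x v).

Lemma filtZ d a u : filt d u -> filt d (a *: u).
Proof. by move=> fu; rewrite -[_ *: _]addr0; apply: filt_lin => //; apply: filt0. Qed.
Lemma filtD d u v : filt d u -> filt d v -> filt d (u + v).
Proof. by move=> fu fv; rewrite -[u]scale1r; apply: filt_lin. Qed.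
Lemma filtN d u : filt d u -> filt d (- u).
Proof. by move=> fu; rewrite -scaleN1r; apply: filtZ. Qed.
Lemma filtB d u v : filt d u -> filt d v -> filt d (u - v).
Proof. by move=> fu fv; apply: filtD => //; apply: filtN. Qed.
Lemma filt_linsum d (s : seq (k * Y)) (phi : Y -> V) :
  (forall a, filt d (phi a)) -> filt d (lin s phi).
Proof.
move=> h; rewrite /lin; elim: s => [|p s IH]; first by rewrite big_nil; apply: filt0.
by rewrite big_cons; apply: filt_lin.
Qed.

Lemma filtS d v : filt d v -> filt d.+1 v.
Proof.
elim=> {d v}.
- by move=> d; apply: filt0.
- by move=> d a u v _ fu _ fv; apply: filt_lin.
- by move=> d; apply: filt_e.
- by move=> d s z; apply: filt_der.
- by move=> d z u; apply: filt_L2.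
- by move=> d n x v n2 _ fv; apply: filt_L.
Qed.

Lemma filtW d d' v : (d <= d')%N -> filt d v -> filt d' v.
Proof. by move=> /subnKC <- fv; elim: (d' - d)%N => [|m IH]; rewrite ?addn0 ?addnS //; apply: filtS. Qed.

Lemma filt_gen d z : filt d.+1 (j z). Proof. exact: (filt_der d 0). Qed.

Lemma filt_derivation d v : filt d v -> filt d (der v).
Proof.
elim=> {d v}.
- by move=> d; rewrite der0; apply: filt0.
- by move=> d a u v _ fu _ fv; rewrite linearP; apply: filt_lin.
- by move=> d; rewrite der_e; apply: filt0.
- by move=> d s z; apply: (filt_der d s.+1).
- move=> d z u; rewrite comm_der21; apply: filtB; last exact/filtZ/filt_e.
  by apply: filtD; apply: filt_L => //; apply: filt_gen.
- move=> d n x v n2 fv IH.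
  have -> : der (L n x v) = L n x (der v) - n%:R *: L n.-1 x v.
    by rewrite nprod_derr addrK.
  apply: filtB; first exact: filt_L.
  by apply/filtZ/filt_L => //; apply: leq_ltn_trans n2; apply: leq_pred.
Qed.

(** Operators L_n with n >= 2 move to the right by [mulL_comm] until they meet an L_2 or a
    derivative of a generator; each commutator has one operator less. *)
Lemma filt_mulL d v : filt d v -> forall n x, filt d.+1 (L n x v).
Proof.
elim=> {d v}.
- by move=> d n x; rewrite nprod0r; apply: filt0.
- by move=> d a u v _ fu _ fv n x; rewrite nprodDr nprodZr; apply: filt_lin.
- by move=> d n x; rewrite gen_e; apply: filt0.
- move=> d s z; elim: s => [|s IH] n x /=.
    have [n3|] := leqP 3 n; first by rewrite loc3 //; apply: filt0.
    rewrite ltnS leq_eqVlt => /orP[/eqP->|n2]; first exact: filt_L2.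
    by apply: filt_L => //; apply: filt_gen.
  rewrite nprod_derr; apply: filtD; first exact: filt_derivation.
  exact: filtZ.
- move=> d z u n x; have [n2|n2] := ltnP n 2.
    by apply: filt_L => //; apply: filt_L2.
  rewrite LnL2_gen //; exact: filt0.
- move=> d m y v m2 fv IH n x; rewrite mulL_comm; apply: filtD.
    exact: filt_L.
  by apply: filt_linsum => a; apply: filtS.
Qed.

Lemma filt_iter_der d s v : filt d v -> filt d (iter s der v).
Proof. by move=> fv; elim: s => //= s; apply: filt_derivation. Qed.

(** Induction over the generated algebra needs a stronger property: left products by u also preserve
    the union of the filtration. It passes to products of elements by [nprodAr] and induction on the
    index. *)
Lemma filt_exhaust v : exists d, filt d v.
Proof.
pose S : set V := [set u | (exists d, filt d u) /\
  forall n d v, filt d v -> exists d', filt d' (u *_(n) v)]%classic.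
suff H : forall u, S u by have [] := H v.
have both (d d' : nat) u w : filt d u -> filt d' w -> filt (maxn d d') u /\ filt (maxn d d') w.
  by move=> fu fw; split; [apply: filtW fu|apply: filtW fw]; rewrite ?leq_maxl ?leq_maxr.
apply: (@generate S).
- split; first split.
  + by split=> [|n d w _]; [exists 0%N|exists 0%N; rewrite nprod0l]; apply: filt0.
  + move=> a u w [[d fu] mu] [[d' fw] mw]; split.
      by have [fu' fw'] := both _ _ _ _ fu fw; exists (maxn d d'); apply: filt_lin.
    move=> n c t ft; have [b fb] := mu n c t ft; have [b' fb'] := mw n c t ft.
    have [fu' fw'] := both _ _ _ _ fb fb'; exists (maxn b b').
    by rewrite nprodPl; apply: filt_lin.
  + move=> u [[d fu] mu]; split; first by exists d; apply: filt_derivation.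
    move=> n c t ft; rewrite nprod_derl; have [b fb] := mu n.-1 c t ft.
    by exists b; apply/filtN/filtZ.
  + move=> n u w [[d fu] mu] [[d' fw] mw]; split; first exact: mu fw.
    elim/ltn_ind: n => n IH m c t ft.
    have [b fb] := mw m c t ft; have [b' fb'] := mu n b _ fb.
    have [b'' fb''] : exists d', filt d' (\sum_(s < n) 'C(n, s.+1)%:R *:
        ((u *_(n - s.+1) w) *_(m + s.+1) t)).
      elim/big_ind: _ => [|x y [d1 f1] [d2 f2]|s _].
      - by exists 0%N; apply: filt0.
      - by have [f1' f2'] := both _ _ _ _ f1 f2; exists (maxn d1 d2); apply: filtD.
      have [|d1 f1] := IH (n - s.+1)%N _ (m + s.+1)%N c t ft.
        by have := ltn_ord s; lia.
      by exists d1; apply: filtZ.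
    have [f1 f2] := both _ _ _ _ fb' fb''; exists (maxn b' b'').
    by rewrite nprodAr; apply: filtB.
- split; first by exists 0%N; apply: filt_e.
  move=> n d w _; exists 0%N; rewrite torsion_mul; exact: filt0.
- move=> x; split; first by exists 1%N; apply: filt_gen.
  by move=> n d w fw; exists d.+1; apply: filt_mulL.
Qed.

(** The coefficient is (s + 1) + 2: moving L_1 through d^(s+1) gives s + 1, and d (L_1^y z - L_1^z
    y) = 2 (L_0^y z - L_0^z y) modulo generators gives 2. *)
Lemma exchange_der s y z : exists2 r, filt 1 r &
  L 1 y (iter s.+1 der (j z)) - L 1 z (iter s.+1 der (j y)) =
  s.+3%:R *: (L 0 y (iter s der (j z)) - L 0 z (iter s der (j y))) + r.
Proof.
exists (- (2%:R *: iter s der (lin (br y z) j))).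
  by apply/filtN/filtZ/filt_iter_der/filt_linsum => a; apply: filt_gen.
have L0_iter t a b : L 0 a (iter t der (j b)) = iter t der (L 0 a (j b)).
  by elim: t => //= t <-; rewrite L0_der.
have L1_iter t a b : L 1 a (iter t.+1 der (j b)) =
    iter t.+1 der (L 1 a (j b)) + t.+1%:R *: iter t der (L 0 a (j b)).
  elim: t => [|t IH]; first by rewrite /= L1_der scale1r.
  rewrite iterS L1_der IH derD derZ -!iterS L0_iter.
  have -> : (t.+2%:R : k) = t.+1%:R + 1 by rewrite natr1.
  by lc; ring.
have E0 : der (L 1 y (j z)) - der (L 1 z (j y)) =
    2%:R *: (L 0 y (j z) - L 0 z (j y)) - 2%:R *: lin (br y z) j.
  rewrite (comm0 y z) comm_der21 !(derD, derN, derZ) der_e.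
  by lc; field.
have -> : (s.+3%:R : k) = s.+1%:R + 2%:R by rewrite -natrD addn2.
rewrite !L1_iter !L0_iter !iterSr.
have itB u v : iter s der (u - v) = iter s der u - iter s der v by exact: linearB.
have itZ a u : iter s der (a *: u) = a *: iter s der u by exact: linearZ.
have /(congr1 (iter s der)) := E0; rewrite !(itB, itZ).
move=> /eqP; rewrite subr_eq => /eqP ->.
by lc; ring.
Qed.

Lemma filt_comm d n x m y w : filt d w ->
  exists2 r, filt d.+1 r & L n x (L m y w) = L m y (L n x w) + r.
Proof.
move=> fw; exists (lin (br x y) (fun a => L (n + m) a w)); last exact: mulL_comm.
by apply: filt_linsum => a; apply: filt_mulL.
Qed.

(** L_1^a moves inwards and a_(1) z is replaced through [comm1] by -(z_(1) a) + d (z_(2) a); the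
    terms d L_1 L_2 that arise for (y, z) and (z, y) cancel by [L1L2_swap], leaving the L_0 L_2
    terms. *)
Lemma exchange_L1L1 a y z : exists2 r, filt 2 r &
  L 1 a (L 1 y (j z)) - L 1 a (L 1 z (j y)) =
  L 0 y (L 2 a (j z)) - L 0 z (L 2 a (j y)) + r.
Proof.
have fg b : filt 1 (j b) by apply: filt_gen.
have [r1 f1 e1] := filt_comm 1 a 1 y (fg z).
have [r2 f2 e2] := filt_comm 1 a 1 z (fg y).
have [r3 f3 e3] := filt_comm 1 y 1 z (fg a).
exists (r1 - r2 - r3); first by do 2 apply: filtB => //.
have E b c : L 1 b (L 1 a (j c)) =
    - L 1 b (L 1 c (j a)) + der (L 1 b (L 2 c (j a))) + L 0 b (L 2 c (j a)).
  rewrite (comm1 a c) !nprodDr nprodNr nprodZr gen_e scaler0 addr0 L1_der.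
  by rewrite addrA.
by rewrite e1 e2 !E (L1L2_swap y z) e3 (comm2 z a) (comm2 y a); lc; ring.
Qed.

(** L_0^t moves inwards and t_(0) z is rewritten by [comm0] and [comm_der21]. This leaves
    derivatives of L_1 L_1 words, and the derivative of [exchange_L1L1] removes them. *)
Lemma exchange_L0L1 t y z : exists2 r, filt 2 r &
  L 0 t (L 1 y (j z)) - L 0 t (L 1 z (j y)) =
  L 0 z (L 1 y (j t)) - L 0 z (L 1 t (j y)) +
  (L 0 y (L 1 t (j z)) - L 0 y (L 1 z (j t))) + r.
Proof.
have fg b : filt 1 (j b) by apply: filt_gen.
have [r1 f1 e1] := filt_comm 0 t 1 y (fg z).
have [r2 f2 e2] := filt_comm 1 y 0 z (fg t).
have [r3 f3 e3] := exchange_L1L1 y t z.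
pose r4 := L 1 y (lin (br t z) j).
have f4 : filt 2 r4 by apply/filt_mulL/filt_linsum => a; apply: filt_gen.
exists (2%:R *: (r1 + r2 + r4) + der r3).
  by apply: filt_lin; [do 2 apply: filtD => //|apply: filt_derivation].
have E : L 1 y (L 0 t (j z)) = L 1 y (L 0 z (j t)) - der (L 1 y (L 1 z (j t))) -
    L 0 y (L 1 z (j t)) + (2%:R^-1 : k) *: (der (L 1 y (L 1 z (j t))) +
    L 0 y (L 1 z (j t)) + der (L 1 y (L 1 t (j z))) + L 0 y (L 1 t (j z))) + r4.
  rewrite (comm0 t z) comm_der21 !(derD, derN, derZ) der_e scaler0 subr0.
  rewrite !(nprodDr, nprodNr, nprodZr) !L1_der -/r4.
  by lc; ring.
(* [exchange_L1L1] differentiated; [comm_der21] turns each d (u_(2) v) into 1-products. *)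
have E3 : der (L 1 y (L 1 t (j z))) - der (L 1 y (L 1 z (j t))) =
    L 0 t (L 1 y (j z)) + L 0 t (L 1 z (j y)) - (L 0 z (L 1 y (j t)) + L 0 z (L 1 t (j y))) + der r3.
  have := congr1 (@der k V) e3; rewrite !(derD, derN) => ->.
  rewrite -!L0_der !comm_der21 !(nprodDr, nprodNr, nprodZr) !gen_e !scaler0 !subr0.
  by lc; ring.
move: e1; rewrite E e2 => e1.
have {}e1 : 2%:R *: L 0 t (L 1 y (j z)) = 2%:R *: L 0 z (L 1 y (j t)) +
    (der (L 1 y (L 1 t (j z))) - der (L 1 y (L 1 z (j t)))) +
    L 0 y (L 1 t (j z)) - L 0 y (L 1 z (j t)) + 2%:R *: (r1 + r2 + r4).
  by rewrite e1; lc; field.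
move: e1; rewrite E3 => /eqP; rewrite -subr_eq0 => /eqP e1.
by apply/eqP; rewrite -subr_eq0 -e1; apply/eqP; lc; ring.
Qed.

Lemma filt_act l b v : filt b v -> filt (b + size l) (act j l v).
Proof.
move=> fv; elim: l => [|[n x] l IH]; first by rewrite addn0.
by rewrite act_cons addnS; apply: filt_mulL.
Qed.

Lemma actD l u v : act j l (u + v) = act j l u + act j l v.
Proof. by elim: l => //= -[n x] l IH; rewrite /= -!/(act j _ _) IH nprodDr. Qed.
Lemma actZ l a v : act j l (a *: v) = a *: act j l v.
Proof. by elim: l => //= -[n x] l IH; rewrite /= -!/(act j _ _) IH nprodZr. Qed.
Lemma actN l v : act j l (- v) = - act j l v.
Proof. by rewrite -scaleN1r actZ scaleN1r. Qed.
Lemma act_rcons l n x v : act j (rcons l (n, x)) v = act j l (L n x v).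
Proof. by rewrite -cats1 act_cat. Qed.

(** The words have filtration degree b plus the number of operators; the commutator has one operator
    less, hence the predecessor. *)
Lemma act_swap l1 p q l2 b v : filt b v ->
  filt (b + size (l1 ++ p :: q :: l2)).-1
    (act j (l1 ++ p :: q :: l2) v - act j (l1 ++ q :: p :: l2) v).
Proof.
case: p q => n x [m y] fv; rewrite !act_cat !act_cons.
have [r fr ->] := filt_comm n x m y (filt_act l2 fv).
rewrite -actN -actD addrAC subrr add0r.
by apply: filtW (filt_act l1 fr); rewrite size_cat /=; lia.
Qed.

Lemma act_perm l l' b v : filt b v -> perm_eq l l' ->
  filt (b + size l).-1 (act j l v - act j l' v).
Proof.
move=> fv ll'.
suff [] : size l = size l' /\ filt (b + size l).-1 (act j l v - act j l' v) by [].
apply: (@perm_adjacent _ (fun s t => size s = size t /\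
  filt (b + size s).-1 (act j s v - act j t v))) ll'.
- by move=> s; split=> //; rewrite subrr; apply: filt0.
- move=> s t r [-> f1] [e2 f2]; split=> //.
  by rewrite -[act j s v](subrK (act j t v)) -addrA; apply: filtD.
- move=> l1 p q l2; split; first by rewrite !size_cat.
  exact: act_swap.
Qed.

(** The strict inequality accounts for the final generator, which counts as one in the length
    measured by [filt]. *)
Inductive spanned d : V -> Prop :=
| spanned0 : spanned d 0
| spanned_lin a u v : spanned d u -> spanned d v -> spanned d (a *: u + v)
| spanned_e : spanned d e
| spanned_word w : basic_word w -> (size w.1.1 < d)%N -> spanned d (word_val j w).

Lemma spannedW d d' v : (d <= d')%N -> spanned d v -> spanned d' v.
Proof.
move=> dd'; elim=> {v} [|a u v _ su _ sv||w bw sw].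
- exact: spanned0.
- exact: spanned_lin.
- exact: spanned_e.
- by apply: spanned_word => //; apply: leq_trans dd'.
Qed.

Lemma spannedZ d a u : spanned d u -> spanned d (a *: u).
Proof. by move=> su; rewrite -[_ *: _]addr0; apply: spanned_lin => //; apply: spanned0. Qed.
Lemma spannedD d u v : spanned d u -> spanned d v -> spanned d (u + v).
Proof. by move=> su sv; rewrite -[u]scale1r; apply: spanned_lin. Qed.
Lemma spannedN d u : spanned d u -> spanned d (- u).
Proof. by move=> su; rewrite -scaleN1r; apply: spannedZ. Qed.
Lemma spannedB d u v : spanned d u -> spanned d v -> spanned d (u - v).
Proof. by move=> su sv; apply: spannedD => //; apply: spannedN. Qed.

Inductive word_span d : V -> Prop :=
| word_span0 : word_span d 0
| word_span_lin a u v : word_span d u -> word_span d v -> word_span d (a *: u + v)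
| word_span_e : word_span d e
| word_span_der l s z : all (fun p => p.1 < 2)%N l -> (size l < d)%N ->
    word_span d (act j l (iter s der (j z)))
| word_span_L2 l z u : all (fun p => p.1 < 2)%N l -> ((size l).+1 < d)%N ->
    word_span d (act j l (L 2 z (j u))).

Lemma word_span_mulL d n x v : (n < 2)%N -> word_span d v -> word_span d.+1 (L n x v).
Proof.
move=> n2; elim=> {v} [|a u v _ su _ sv||l s z al sl|l z u al sl].
- by rewrite nprod0r; apply: word_span0.
- by rewrite nprodDr nprodZr; apply: word_span_lin.
- by rewrite gen_e; apply: word_span0.
- by rewrite -act_cons; apply: word_span_der; rewrite //= n2.
- by rewrite -act_cons; apply: word_span_L2; rewrite //= n2.
Qed.

Lemma filt_word_span d v : filt d v -> word_span d v.
Proof.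
elim=> {d v}.
- by move=> d; apply: word_span0.
- by move=> d a u v _ fu _ fv; apply: word_span_lin.
- by move=> d; apply: word_span_e.
- by move=> d s z; apply: (@word_span_der _ [::]).
- by move=> d z u; apply: (@word_span_L2 _ [::]).
- by move=> d n x v n2 _; apply: word_span_mulL.
Qed.

Lemma split_indexed (l : seq (nat * Y)) : all (fun p => p.1 < 2)%N l ->
  perm_eq l (Lpow 0 (indexed 0 l) ++ Lpow 1 (indexed 1 l)).
Proof.
move=> al; have E n : Lpow n (indexed n l) = [seq p <- l | p.1 == n].
  rewrite /Lpow /indexed -map_comp; elim: l {al} => //= -[m y] l IH.
  by case: (eqVneq m n) => //= ->; rewrite IH.
rewrite !E perm_sym; apply/permPl.
have -> : [seq p <- l | p.1 == 1%N] = [seq p <- l | predC (fun p => p.1 == 0%N) p].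
  by apply: eq_in_filter => -[n y] /(allP al) /=; case: n => [|[|]].
exact: perm_filterC.
Qed.

(** * Spanning: reduction modulo shorter monomials *)

Section Step.
Variable D : nat.
Hypothesis IHD : forall v, filt D v -> spanned D v.

Let good v := spanned D.+1 v.

Lemma good_filt v : filt D v -> good v.
Proof. by move=> /IHD; apply: spannedW. Qed.

Lemma good_congr u v : filt D (v - u) -> good u -> good v.
Proof. by move=> /good_filt gvu gu; rewrite -[v](subrK u); apply: spannedD. Qed.

(** All letters of L_1^ys L_2^z u are put in one list because the monomial is symmetric in them
    modulo shorter ones. Lists with fewer than two letters get a default value. *)
Let q (t : seq Y) : V :=
  if t is z :: u :: ys then act j (Lpow 1 ys) (L 2 z (j u)) else 0.

Lemma filt_q t : filt (size t) (q t).
Proof.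
case: t => [|z [|u ys]] /=; try exact: filt0.
have := filt_act (Lpow 1 ys) (filt_L2 0 z u); rewrite size_map.
by apply: filtW; rewrite add2n.
Qed.

(** Adjacent transpositions suffice. The first two letters are exchanged by [comm2], the second and
    third by [L1L2_swap], the others by commuting the operators L_1. *)
Lemma q_perm t t' : perm_eq t t' -> filt (size t).-1 (q t - q t').
Proof.
move=> tt'; suff [] : size t = size t' /\ filt (size t).-1 (q t - q t') by [].
apply: (@perm_adjacent _ (fun s t => size s = size t /\
  filt (size s).-1 (q s - q t))) tt'.
- by move=> s; split=> //; rewrite subrr; apply: filt0.
- move=> s r p [-> f1] [e2 f2]; split=> //.
  by rewrite -[q s](subrK (q r)) -addrA; apply: filtD.
move=> [|c [|c' l1]] a b l2; (split; first by rewrite !size_cat); rewrite /=.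
- by rewrite comm2 subrr; apply: filt0.
- rewrite -!/(act j _ _) -!act_cons.
  have P x : perm_eq ((1%N, x) :: Lpow 1 l2) (rcons (Lpow 1 l2) (1%N, x)).
    by rewrite perm_sym perm_rcons.
  have F x y : filt ((size l2).+2) (act j ((1%N, x) :: Lpow 1 l2) (L 2 c (j y)) -
      act j (Lpow 1 l2) (L 1 x (L 2 c (j y)))).
    rewrite -(act_rcons (Lpow 1 l2)); apply: filtW (act_perm (filt_L2 0 c y) (P x)).
    by rewrite /= size_map; lia.
  have E : L 1 a (L 2 c (j b)) = L 1 b (L 2 c (j a)).
    by rewrite (comm2 c b) (comm2 c a) L1L2_swap.
  by have := filtB (F b a) (F a b); rewrite E opprB addrA subrK.
- have P : perm_eq (Lpow 1 (l1 ++ a :: b :: l2)) (Lpow 1 (l1 ++ b :: a :: l2)).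
    by apply/perm_map; rewrite perm_cat2l (perm_catCA [:: a] [:: b]).
  apply: filtW (act_perm (filt_L2 0 c c') P).
  by rewrite size_map add2n.
Qed.

Lemma act_sub l u v : act j l u - act j l v = act j l (u - v).
Proof. by rewrite actD actN. Qed.

Lemma good_L2 xs ys z u : (size xs + size ys < D)%N ->
  good (act j (Lpow 0 xs ++ Lpow 1 ys) (L 2 z (j u))).
Proof.
move=> sz; pose t := sort <=%O (ys ++ [:: z; u]).
have pt : perm_eq (z :: u :: ys) t by rewrite perm_sym perm_sort (perm_catC ys).
have : size t = (size ys).+2 by rewrite size_sort size_cat addn2.
have st : sorted <=%O t by apply: sort_le_sorted.
case/lastP: t pt st => [|t u'] //; case/lastP: t => [|ys' z'] // pt st et.
rewrite -!cats1 -catA /= in pt st et.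
have szy : size ys' = size ys by move: et; rewrite size_cat addn2 => -[].
have pt' : perm_eq (z :: u :: ys) (z' :: u' :: ys') by rewrite (permPl pt) (perm_catC ys').
have F1 := filt_act (Lpow 0 xs) (q_perm pt').
have F2 := act_perm (filt_q (z' :: u' :: ys'))
  (perm_map (pair 0%N) (introT idP (permEl (perm_sort <=%O xs)))).
apply: (@good_congr (act j (Lpow 0 (sort <=%O xs) ++ Lpow 1 ys') (L 2 z' (j u')))).
  rewrite act_cat -/(q (z :: u :: ys)) act_cat -/(q (z' :: u' :: ys')).
  rewrite -[act j (Lpow 0 xs) _](subrK (act j (Lpow 0 xs) (q (z' :: u' :: ys')))).
  rewrite act_sub -addrA; apply: filtD.
    by apply: filtW F1; rewrite size_map /=; lia.
  rewrite -opprB; apply: filtN; apply: filtW F2.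
  by rewrite size_map size_sort /= szy; lia.
have := @spanned_word D.+1 (Lpow 0 (sort <=%O xs) ++ Lpow 1 ys' ++ [:: (2%N, z')], 0%N, u').
rewrite /word_val -/(act j _ _) catA act_cat; apply.
  by rewrite -catA; apply: basic_word1 => //; apply: sort_le_sorted.
by rewrite !size_cat !size_map size_sort szy /=; lia.
Qed.

Let g xs ys s z := act j (Lpow 0 xs ++ Lpow 1 ys) (iter s der (j z)).

Lemma g_perm xs ys xs' ys' s z : (size xs + size ys <= D)%N ->
  perm_eq xs xs' -> perm_eq ys ys' -> filt D (g xs ys s z - g xs' ys' s z).
Proof.
move=> sz px py; have P : perm_eq (Lpow 0 xs ++ Lpow 1 ys) (Lpow 0 xs' ++ Lpow 1 ys').
  by apply: perm_cat; apply: perm_map.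
apply: filtW (act_perm (filt_der 0 s z) P).
by rewrite add1n /= size_cat !size_map.
Qed.

Lemma good_g_perm xs ys xs' ys' s z : (size xs + size ys <= D)%N ->
  perm_eq xs xs' -> perm_eq ys ys' -> good (g xs' ys' s z) -> good (g xs ys s z).
Proof. by move=> sz px py; apply/good_congr/g_perm. Qed.

Lemma good_g_sorted xs ys s z : (size xs + size ys <= D)%N ->
  sorted <=%O (rcons ys z) -> (0 < s)%N || (size ys != 1)%N -> good (g xs ys s z).
Proof.
move=> sz sy c; have px : perm_eq xs (sort <=%O xs) by rewrite perm_sym perm_sort.
apply: (good_g_perm sz px (perm_refl ys)).
apply: (@spanned_word D.+1 (Lpow 0 (sort <=%O xs) ++ Lpow 1 ys, s, z)); last first.
  by rewrite /= size_cat !size_map size_sort ltnS.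
have sx : sorted <=%O (sort <=%O xs) by apply: sort_le_sorted.
case: s c => [|s] c; last exact: basic_word2.
by apply: basic_word3 => //; case: (size ys) c => [|[|]]; auto.
Qed.

Lemma good_g1 xs y z : (size xs < D)%N ->
  [\/ xs = [::], {in xs, forall x, x <= y}%O | (y <= z)%O] -> good (g xs [:: y] 0 z).
Proof.
move=> sz c; apply: (@good_g_perm _ _ (sort <=%O xs) [:: y]) => //.
- by rewrite addn1.
- by rewrite perm_sym perm_sort.
apply: (@spanned_word D.+1 (Lpow 0 (sort <=%O xs) ++ [:: (1%N, y)], 0%N, z)); last first.
  by rewrite /= size_cat !size_map size_sort addn1 ltnS.
apply: basic_word4; first exact: sort_le_sorted.
case: c => [->|c|c]; [exact: Or31 | apply: Or32 | exact: Or33].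
have := mem_last y (sort <=%O xs); rewrite inE => /orP[/eqP->//|].
by rewrite mem_sort; apply: c.
Qed.

Section Exchange.
Variable m : nat.
Hypothesis IHm : forall ys xs s z, (size ys < m)%N ->
  (size xs + size ys <= D)%N -> good (g xs ys s z).

(** For s > 0 the difference trades an L_1 for an L_0, so that [IHm] applies; for s = 0 with a
    further L_1 it consists of words with an L_2. A single L_1 with s = 0 is out of reach here and
    is treated in [good_g_L1]. *)
Lemma good_exchange xs ys s y z : (size ys < m)%N -> (size xs + size ys < D)%N ->
  (0 < s)%N || (0 < size ys)%N ->
  good (g xs (rcons ys y) s z - g xs (rcons ys z) s y).
Proof.
move=> lt_m sz c; rewrite /g /Lpow !map_rcons -!rcons_cat !act_rcons -/(Lpow _ _).
rewrite -/(Lpow 1 ys); set l := Lpow 0 xs ++ Lpow 1 ys; rewrite act_sub.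
have sl : size l = (size xs + size ys)%N by rewrite size_cat !size_map.
have P r a (A : seq (nat * Y)) : perm_eq (rcons (Lpow 0 xs ++ A) (r, a)) (rcons (Lpow 0 xs) (r, a) ++ A).
  by rewrite -!cats1 -!catA perm_cat2l perm_catC.
case: s c => [|s] /= c.
  case/lastP: ys c lt_m sz @l sl => // ys a _ lt_m sz l sl.
  have -> : l = rcons (Lpow 0 xs ++ Lpow 1 ys) (1%N, a).
    by rewrite /l /Lpow map_rcons rcons_cat.
  rewrite !act_rcons; have [r fr e1] := exchange_L1L1 a y z.
  rewrite nprodDr nprodNr e1 actD -act_sub.
  set l' := Lpow 0 xs ++ Lpow 1 ys.
  have G b b' : good (act j l' (L 0 b (L 2 a (j b')))).
    rewrite -act_rcons; have := act_perm (filt_L2 0 a b') (P 0%N b (Lpow 1 ys)).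
    move=> F; apply: (good_congr (u := act j (Lpow 0 (rcons xs b) ++ Lpow 1 ys) (L 2 a (j b')))).
      rewrite /Lpow map_rcons; apply: filtW F.
      by move: sz; rewrite !size_rcons size_cat !size_map; lia.
    by apply: good_L2; move: sz; rewrite !size_rcons; lia.
  apply: spannedD; first by apply: spannedB; apply: G.
  apply/good_filt/(filtW _ (filt_act l' fr)).
  by move: sz; rewrite /l' size_cat !size_map size_rcons; lia.
have [r fr e1] := exchange_der s y z.
rewrite e1 actD actZ -act_sub.
have G b b' : good (act j l (L 0 b (iter s der (j b')))).
  rewrite -act_rcons; have := act_perm (filt_der 0 s b') (P 0%N b (Lpow 1 ys)).
  move=> F; apply: (good_congr (u := g (rcons xs b) ys s b')).
    rewrite /g /Lpow map_rcons; apply: filtW F.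
    by rewrite size_rcons size_cat !size_map; lia.
  by apply: IHm => //; rewrite size_rcons.
apply: spannedD; first by apply/spannedZ/spannedB; apply: G.
by apply/good_filt/(filtW _ (filt_act l fr)); rewrite sl.
Qed.

(** The largest letter u has to come last. If it sits among the L_1 letters, it is commuted to the
    innermost of them and exchanged with z. *)
Lemma good_g_step ys xs s z : size ys = m -> (size xs + size ys <= D)%N ->
  (0 < s)%N || (size ys != 1)%N -> good (g xs ys s z).
Proof.
move=> sm sz c; pose t := sort <=%O (rcons ys z).
have pt : perm_eq (rcons ys z) t by rewrite perm_sym perm_sort.
have st : sorted <=%O t by apply: sort_le_sorted.
have : size t = (size ys).+1 by rewrite size_sort size_rcons.
case/lastP: t pt st => [|ys' u] // pt st; rewrite size_rcons => -[szy].
have goodt : good (g xs ys' s u) by apply: good_g_sorted; rewrite ?szy.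
have : u \in rcons ys z by rewrite (perm_mem pt) mem_rcons mem_head.
rewrite mem_rcons inE => /orP[/eqP eu|uy].
  subst u; apply: good_g_perm goodt => //.
  by move: pt; rewrite -!cats1 perm_cat2r.
have pu : perm_eq ys (rcons (rem u ys) u).
  by rewrite perm_sym perm_rcons perm_sym perm_to_rem.
have su := perm_size pu; rewrite size_rcons in su.
apply: (good_g_perm sz (perm_refl xs) pu).
rewrite -[g _ _ _ _](subrK (g xs (rcons (rem u ys) z) s u)).
apply: spannedD.
  apply: good_exchange; rewrite -?sm ?su //.
    by move: sz; rewrite su addnS.
  by case: s c {goodt} => //=; rewrite su; case: (size _).
apply: good_g_perm goodt => //; first by move: sz; rewrite su size_rcons.
have H : perm_eq (rcons (rcons (rem u ys) z) u) (rcons ys z).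
  rewrite -!cats1 -catA; apply: (perm_trans (y := (rem u ys ++ [:: u]) ++ [:: z])).
    by rewrite -catA perm_cat2l perm_catC.
  by rewrite perm_cat2r perm_sym cats1.
by have := perm_trans H pt; rewrite -2!cats1 -[rcons ys' u]cats1 perm_cat2r.
Qed.

(** Only z < y < t, with t the largest letter of xs, calls for a reduction. [exchange_L0L1] gives
    five words, each having either its last two letters in order or an L_1 letter above all L_0
    letters. *)
Lemma good_g_L1 xs y z : (size xs < D)%N -> good (g xs [:: y] 0 z).
Proof.
move=> sz; pose xs' := sort <=%O xs.
have px : perm_eq xs xs' by rewrite perm_sym perm_sort.
have sx : sorted <=%O xs' by apply: sort_le_sorted.
apply: (good_g_perm _ px (perm_refl _)); first by rewrite addn1.
have sz' : (size xs' < D)%N by rewrite size_sort.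
case/lastP: xs' sx sz' {px} => [|xs1 t] sx sz'; first by apply: good_g1 => //; apply: Or31.
have max_t x : x \in xs1 -> (x <= t)%O.
  move: sx; rewrite -cats1 sorted_pairwise; last exact: le_trans.
  by rewrite pairwise_cat allrel1r => /and3P[/allP h _ _] /h.
have [yz|zy] := leP y z; first by apply: good_g1 => //; apply: Or33.
have [ty|yt] := leP t y.
  apply: good_g1 => //; apply: Or32 => x; rewrite mem_rcons inE => /orP[/eqP->//|/max_t].
  by move=> xt; apply: le_trans ty.
have E x a b : g (rcons xs1 x) [:: a] 0 b = act j (Lpow 0 xs1) (L 0 x (L 1 a (j b))).
  by rewrite /g /Lpow map_rcons act_cat act_rcons.
have sz1 : ((size xs1).+1 < D)%N by move: sz'; rewrite size_rcons.
have G3 x a b : (forall c, c \in rcons xs1 x -> (c <= a)%O) \/ (a <= b)%O ->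
    good (act j (Lpow 0 xs1) (L 0 x (L 1 a (j b)))).
  move=> c; rewrite -E; apply: good_g1; first by rewrite size_rcons.
  by case: c => c; [apply: Or32|apply: Or33].
have max_t' c : (c <= t)%O -> forall b, b \in rcons xs1 c -> (b <= t)%O.
  by move=> ct b; rewrite mem_rcons inE => /orP[/eqP->//|/max_t].
have [r fr e1] := exchange_L0L1 t y z.
rewrite E; move/eqP: e1; rewrite subr_eq => /eqP ->; rewrite !(actD, actN).
have zt := lt_trans zy yt.
apply: spannedD; last by apply: G3; right; apply: ltW.
apply: spannedD; last first.
  apply/good_filt/(filtW _ (filt_act (Lpow 0 xs1) fr)).
  by rewrite size_map add2n.
by apply: spannedD; apply: spannedB; apply: G3;
  [right; apply: ltW|left; apply/max_t'/ltW|left; apply/max_t'/ltW|right; apply: ltW].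
Qed.

End Exchange.

Lemma good_g ys xs s z : (size xs + size ys <= D)%N -> good (g xs ys s z).
Proof.
have [m] := ubnP (size ys); elim: m ys xs s z => // m IHm ys xs s z.
rewrite ltnS leq_eqVlt => /orP[/eqP sm|]; last exact: IHm.
move=> sz; have [c|] := boolP ((0 < s)%N || (size ys != 1)%N).
  by apply: (@good_g_step m) => // *; apply: IHm.
rewrite negb_or -leqNgt leqn0 negbK => /andP[/eqP-> /eqP s1].
case: ys s1 sm sz => [|y [|]] // _ _; rewrite addn1; exact: good_g_L1.
Qed.

Lemma good_step v : filt D.+1 v -> good v.
Proof.
move/filt_word_span; elim=> {v} [|a u v _ su _ sv||l s z al sl|l z u al sl].
- exact: spanned0.
- exact: spanned_lin.
- exact: spanned_e.
- have P := split_indexed al; apply: (good_congr (u := g (indexed 0 l) (indexed 1 l) s z)).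
    by apply: filtW (act_perm (filt_der 0 s z) P); rewrite add1n.
  apply: good_g; rewrite -ltnS; move: (perm_size P) sl.
  by rewrite size_cat !size_map => ->.
- have P := split_indexed al.
  apply: (good_congr (u := act j (Lpow 0 (indexed 0 l) ++ Lpow 1 (indexed 1 l)) (L 2 z (j u)))).
    by apply: filtW (act_perm (filt_L2 0 z u) P); rewrite add2n.
  apply: good_L2; rewrite -ltnS; move: (perm_size P) sl.
  by rewrite size_cat !size_map => ->; rewrite ltnS.
Qed.

End Step.

Lemma filt_spanned D v : filt D v -> spanned D v.
Proof.
elim: D v => [|D IH] v; last exact: good_step.
by move=> /filt_word_span; elim=> {v} [|a u v _ su _ sv||//|//];
  [apply: spanned0|apply: spanned_lin|apply: spanned_e].
Qed.

Theorem basic_words_span v : exists d, spanned d v.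
Proof. by have [d /filt_spanned] := filt_exhaust v; exists d. Qed.

End Envelope.

(** * The polynomial model *)

Section Triangular.
Variables (k : fieldType) (V : lmodType k) (I : eqType) (B : set I) (f : I -> V).
Variables (rank : I -> nat) (ell : I -> {linear V -> k^o}).
Hypothesis ell_diag : forall i, B i -> ell i (f i) != 0.
Hypothesis ell_off : forall i j, B i -> B j -> j != i -> (rank j <= rank i)%N ->
  ell i (f j) = 0.

(** The coefficients vanish in order of decreasing rank: besides [f i], the functional [ell i] sees
    only elements of strictly larger rank. *)
Lemma triangular_free (s : seq I) (c : I -> k) : uniq s -> {in s, forall i, B i} ->
  {in s, forall i, ell i (\sum_(i <- s) c i *: f i) = 0} -> {in s, forall i, c i = 0}.
Proof.
move=> us sB sum0; pose R := (\max_(i <- s) rank i)%N.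
have le_R i : i \in s -> (rank i <= R)%N by move=> si; apply: leq_bigmax_seq.
move=> i; have [n] := ubnP (R - rank i)%N; elim: n i => // n IH i; rewrite ltnS.
move=> le_n si; have := sum0 i si; rewrite linear_sum /=.
rewrite (bigD1_seq i) //= big_seq_cond big1 => [|j /andP[sj ji]].
  by rewrite addr0 linearZ /= => /eqP; rewrite mulf_eq0 (negbTE (ell_diag (sB i si))) orbF => /eqP.
rewrite linearZ /=; have [le_r|lt_r] := leqP (rank j) (rank i).
  by rewrite (ell_off (sB i si) (sB j sj) ji le_r) scaler0.
rewrite IH ?scale0r //; have := le_R j sj; lia.
Qed.

End Triangular.

Section PolynomialAlgebra.
Variables (k : fieldType) (disp : Order.disp_t) (Y : orderType disp).

(* (x, false) and (x, true) are the indeterminates p_x and c_x, and pc xs ys is the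
   monomial with factors p_x for x in xs and c_y for y in ys. *)
Definition letter : choiceType := (Y * bool)%type.
Definition symalg : comAlgType k := {malg k[{cmonom letter}]}.
Implicit Types (x y z u : Y) (xs ys : seq Y).

Definition pc_monom xs ys : {cmonom letter} :=
  mmul (\big[mmul/mone]_(x <- xs) ucm (x, false))
       (\big[mmul/mone]_(y <- ys) ucm (y, true)).

Lemma prod_ucmE (r : seq letter) (a : letter) :
  (\big[mmul/mone]_(b <- r) ucm b : {cmonom letter}) a = count_mem a r.
Proof. by elim: r => [|b r IH]; rewrite ?big_nil ?cm1 // big_cons cmM cmU IH. Qed.

Lemma pc_monomE xs ys x b :
  pc_monom xs ys (x, b) = count_mem x (if b then ys else xs).
Proof.
have E b' c (r : seq Y) :
    (\big[mmul/mone]_(y <- r) ucm (y, c) : {cmonom letter}) (x, b') =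
    ((b' == c) * count_mem x r)%N.
  rewrite -(big_map (fun y => (y, c) : letter) xpredT (fun a => ucm a)).
  rewrite prod_ucmE count_map.
  rewrite (eq_count (a2 := fun y => (b' == c) && (y == x))); last first.
    by move=> y; rewrite /= xpair_eqE andbC eq_sym.
  by case: (b' == c); rewrite ?mul1n //= count_pred0.
by rewrite /pc_monom cmM !E; case: b; rewrite ?mul0n ?mul1n ?addn0.
Qed.

Lemma pc_monom_eq xs ys xs' ys' :
  (pc_monom xs ys == pc_monom xs' ys') = perm_eq xs xs' && perm_eq ys ys'.
Proof.
apply/eqP/andP => [e|[/permP ex /permP ey]].
  by split; apply/allP => x _ /=; apply/eqP;
    [have := congr1 (fun m : {cmonom letter} => m (x, false)) e
    |have := congr1 (fun m : {cmonom letter} => m (x, true)) e]; rewrite !pc_monomE.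
by apply/eqP/cmP => -[x b]; rewrite !pc_monomE; case: b.
Qed.

Definition pc xs ys : symalg := << pc_monom xs ys >>.

Lemma malgMU (m1 m2 : {cmonom letter}) : << m1 >> * << m2 >> = << mmul m1 m2 >> :> symalg.
Proof. by rewrite malgM_def fgmulUU mulr1. Qed.

Lemma pcM xs ys xs' ys' : pc xs ys * pc xs' ys' = pc (xs ++ xs') (ys ++ ys').
Proof.
rewrite malgMU /pc; congr (<< _ >>); rewrite /pc_monom !big_cat /=.
by rewrite !mulmA -[mmul (mmul _ _) (\big[_/_]_(x <- xs') _)]mulmA [mmul (\big[_/_]_(y <- ys) _) _]mulmC !mulmA.
Qed.

Lemma pc_nil : pc [::] [::] = 1.
Proof. by rewrite /pc /pc_monom !big_nil mulm1. Qed.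

Definition pc_coef xs ys (p : symalg) : k^o := p@_(pc_monom xs ys).
Lemma pc_coef_linear xs ys : linear (pc_coef xs ys).
Proof. by move=> a p q; rewrite /pc_coef mcoeffD mcoeffZ. Qed.
HB.instance Definition _ xs ys :=
  GRing.isLinear.Build k symalg k^o _ (pc_coef xs ys) (pc_coef_linear xs ys).

Lemma pc_coefE xs ys xs' ys' :
  pc_coef xs' ys' (pc xs ys) = (perm_eq xs xs' && perm_eq ys ys')%:R.
Proof. by rewrite /pc_coef /pc mcoeffU pc_monom_eq. Qed.

Lemma pc_perm xs ys xs' ys' : perm_eq xs xs' -> perm_eq ys ys' -> pc xs ys = pc xs' ys'.
Proof.
move=> ex ey; congr (<< _ >>); apply/eqP; rewrite pc_monom_eq; exact/andP.
Qed.

End PolynomialAlgebra.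

(** The independence arguments see the polynomial algebra only through these facts. *)
Record monomial_coefs (k : fieldType) (Y : eqType) (S : algType k)
    (pc : seq Y -> seq Y -> S) (pc_coef : seq Y -> seq Y -> {linear S -> k^o}) : Prop :=
  MonomialCoefs {
  monomialM : forall xs ys xs' ys', pc xs ys * pc xs' ys' = pc (xs ++ xs') (ys ++ ys');
  monomial_nil : pc [::] [::] = 1;
  monomial_perm : forall xs ys xs' ys',
    perm_eq xs xs' -> perm_eq ys ys' -> pc xs ys = pc xs' ys';
  monomial_coefE : forall xs ys xs' ys',
    pc_coef xs' ys' (pc xs ys) = (perm_eq xs xs' && perm_eq ys ys')%:R
}.

Lemma symalg_coefs (k : fieldType) (disp : Order.disp_t) (Y : orderType disp) :
  monomial_coefs (@pc k disp Y) (fun xs ys => [the {linear symalg k Y -> k^o} of pc_coef xs ys]).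
Proof. by split; [exact: pcM|exact: pc_nil|exact: pc_perm|exact: pc_coefE]. Qed.

(** * Independence in the polynomial model *)

Section SymmetricModel.
Variables (k : fieldType) (char0 : [pchar k] =i pred0).
Variables (disp : Order.disp_t) (Y : orderType disp) (symalg : algType k).
Variables (pc : seq Y -> seq Y -> symalg) (pc_coef : seq Y -> seq Y -> {linear symalg -> k^o}).
Hypothesis pc_basis : monomial_coefs pc pc_coef.
Local Notation pcM := (monomialM pc_basis).
Local Notation pc_nil := (monomial_nil pc_basis).
Local Notation pc_coefE := (monomial_coefE pc_basis).
Implicit Types (x y z u : Y) (xs ys : seq Y) (g : cur symalg).

Definition pvar x : symalg := pc [:: x] [::].
Definition cvar x : symalg := pc [::] [:: x].
Definition sgen x : cur symalg := cgen (pvar x) (cvar x).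

Lemma pvarM x xs ys : pvar x * pc xs ys = pc (x :: xs) ys.
Proof. exact: pcM. Qed.
Lemma cvarM y xs ys : cvar y * pc xs ys = pc xs (y :: ys).
Proof. exact: pcM. Qed.
Lemma cvarE y : cvar y = pc [::] [:: y]. Proof. by []. Qed.
Lemma pvarE y : pvar y = pc [:: y] [::]. Proof. by []. Qed.

Definition cf i xs ys g : k^o := pc_coef xs ys ((g : {poly symalg})`_i).

Lemma cf_linear i xs ys : linear (cf i xs ys).
Proof.
by move=> a f g; rewrite /cf coef_curD coef_curZ linearP.
Qed.
HB.instance Definition _ i xs ys :=
  GRing.isLinear.Build k (cur symalg) k^o _ (cf i xs ys) (cf_linear i xs ys).

Lemma nprod_sgen x n g : sgen x *_(n) g =
  (pvar x *: (g : {poly symalg})^`(n) : cur symalg) -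
  n%:R *: (cvar x *: (g : {poly symalg})^`(n.-1) : cur symalg).
Proof. exact: nprod_cgen. Qed.

Lemma coef_act0 xs g i :
  (act sgen (Lpow 0 xs) g : {poly symalg})`_i = pc xs [::] * (g : {poly symalg})`_i.
Proof.
elim: xs => [|x xs IH] /=.
  by rewrite pc_nil mul1r.
rewrite -/(act _ _ _) nprod_sgen scale0r subr0 derivn0 coefZ IH mulrA.
by rewrite pvarM.
Qed.

(** In the top degree D in d, the operator L_1^y is multiplication by -c_y: its p_y-term
    differentiates in d and lowers the degree. *)
Lemma lead_coef_act1 ys g D a xs zs : (size (g : {poly symalg}) <= D.+1)%N ->
  (g : {poly symalg})`_D = a *: pc xs zs ->
  (size (act sgen (Lpow 1 ys) g : {poly symalg}) <= D.+1)%N /\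
  (act sgen (Lpow 1 ys) g : {poly symalg})`_D = ((-1) ^+ size ys * a) *: pc xs (ys ++ zs).
Proof.
move=> szg gD; elim: ys => [|y ys [IHs IHd]]; first by rewrite /= expr0 mul1r.
rewrite [Lpow _ _]/= act_cons nprod_sgen /= scale1r.
set h := act _ _ _ in IHs IHd *.
have h' : (size ((h : {poly symalg})^`()) <= D)%N.
  apply/leq_sizeP => j Dj; rewrite coef_deriv nth_default ?mul0rn //.
  by apply: leq_trans IHs _; rewrite ltnS.
split.
  apply: leq_trans (size_polyD _ _) _; rewrite geq_max size_polyN.
  by rewrite !(leq_trans (size_scale_leq _ _)) // (leq_trans h').
rewrite coef_curD coefN !coefZ IHd [X in _ * X]nth_default // mulr0 add0r.
by rewrite -scalerAr cvarM exprS mulN1r mulNr scaleNr.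
Qed.

Lemma iter_derE s (g : cur symalg) : (iter s der g : {poly symalg}) = (g : {poly symalg}) * 'X^s.
Proof.
elim: s => [|s IH] /=; first by rewrite expr0 mulr1.
by rewrite exprSr mulrA -IH.
Qed.

Lemma coef_sgen z i : (sgen z : {poly symalg})`_i =
  if i is 0 then pvar z else if i is 1 then cvar z else 0.
Proof. exact: coef_cgen. Qed.

Lemma base_lead s z : (size (iter s der (sgen z) : {poly symalg}) <= s.+2)%N /\
  (iter s der (sgen z) : {poly symalg})`_s.+1 = 1 *: pc [::] [:: z].
Proof.
rewrite iter_derE coefMXn ltnNge leqnSn /= subSn // subnn coef_sgen scale1r cvarE.
split=> //; apply: leq_trans (size_polyMleq _ _) _; rewrite size_polyXn addnS /=.
rewrite -addn2 addnC leq_add2l; apply/leq_sizeP => -[|[|j]] // _.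
by rewrite coef_sgen.
Qed.

Lemma cf_size i X C g : (size (g : {poly symalg}) <= i)%N -> cf i X C g = 0.
Proof. by move=> szg; rewrite /cf nth_default // linear0. Qed.

Lemma cf_act0 xs g i a xs' ys' X C : (g : {poly symalg})`_i = a *: pc xs' ys' ->
  cf i X C (act sgen (Lpow 0 xs) g) = a * (perm_eq (xs ++ xs') X && perm_eq ys' C)%:R.
Proof.
by move=> e; rewrite /cf coef_act0 e -scalerAr pcM linearZ /= pc_coefE.
Qed.

Lemma size_act0 xs g i : (size (g : {poly symalg}) <= i)%N ->
  (size (act sgen (Lpow 0 xs) g : {poly symalg}) <= i)%N.
Proof.
by move=> szg; apply/leq_sizeP => j ij; rewrite coef_act0 nth_default ?mulr0 // (leq_trans szg).
Qed.

Definition val1 xs ys z u := word_val sgen (Lpow 0 xs ++ Lpow 1 ys ++ [:: (2%N, z)], 0%N, u).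
Definition val2 xs ys s z := word_val sgen (Lpow 0 xs ++ Lpow 1 ys, s, z).
Definition val4 xs y z := word_val sgen (Lpow 0 xs ++ [:: (1%N, y)], 0%N, z).

Lemma cf_val1 xs ys z u i X C : cf i X C (val1 xs ys z u) =
  if i == 0%N then (- (2%:R * (-1) ^+ size ys)) *
    (perm_eq xs X && perm_eq (ys ++ [:: z; u]) C)%:R else 0.
Proof.
rewrite /val1 /word_val -!/(act sgen _ _) !act_cat /= /sgen nprod_cgen2.
set h : cur symalg := - _.
have szh : (size (h : {poly symalg}) <= 1)%N.
  by rewrite size_polyN (leq_trans (size_scale_leq _ _)) // size_polyC_leq1.
have h0 : (h : {poly symalg})`_0 = (- 2%:R) *: pc [::] [:: z; u].
  by rewrite coefN coef_curZ coefC /= !cvarE pcM scaleNr.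
have [szg g0] := lead_coef_act1 ys szh h0.
case: eqP => [->|/eqP i0]; last first.
  by rewrite cf_size // size_act0 // (leq_trans szg) // lt0n.
by rewrite (cf_act0 _ _ _ g0) cats0; congr (_ * _); ring.
Qed.

Lemma cf_val2 xs ys s z X C : cf s.+1 X C (val2 xs ys s z) =
  (-1) ^+ size ys * (perm_eq xs X && perm_eq (ys ++ [:: z]) C)%:R.
Proof.
rewrite /val2 /word_val -!/(act sgen _ _) act_cat.
have [szb b1] := base_lead s z.
have [szg g0] := lead_coef_act1 ys szb b1.
by rewrite (cf_act0 _ _ _ g0) cats0 mulr1.
Qed.

Lemma cf_val2_gt xs ys s z X C i : (s.+1 < i)%N -> cf i X C (val2 xs ys s z) = 0.
Proof.
move=> si; rewrite /val2 /word_val -!/(act sgen _ _) act_cat.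
have [szb b1] := base_lead s z.
have [szg g0] := lead_coef_act1 ys szb b1.
by rewrite cf_size // size_act0 // (leq_trans szg).
Qed.

Lemma cf_val4_0 xs y z X C : cf 0 X C (val4 xs y z) =
  (perm_eq (xs ++ [:: y]) X && perm_eq [:: z] C)%:R -
  (perm_eq (xs ++ [:: z]) X && perm_eq [:: y] C)%:R.
Proof.
rewrite /val4 /word_val -!/(act sgen _ _) act_cat /= /cf coef_act0.
rewrite nprod_cgen1 coef_curD coef_curD !coefN.
rewrite coef_der !coefC /= subr0.
by rewrite !cvarE !pvarE !pcM mulrBr !pcM linearB /= !pc_coefE /= ?cats0.
Qed.

Lemma cf_val4_1 xs y z X C : cf 1 X C (val4 xs y z) =
  - (perm_eq xs X && perm_eq [:: y; z] C)%:R.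
Proof. by have := cf_val2 xs [:: y] 0 z X C; rewrite /= expr1 mulN1r. Qed.

(* The offset 9 only has to exceed the ranks 0, 1, 2, 3 of families 1 and 4. *)
Definition rank (w : word Y) : nat :=
  let: (l, s, z) := w in let xs := indexed 0 l in
  if indexed 2 l is _ :: _ then 0%N
  else if (0 < s)%N || (size (indexed 1 l) != 1)%N then (s + 9)%N
  else let y := head z (indexed 1 l) in
    if (z < y)%O then 2%N
    else if (y == z) || ~~ (last z xs <= z)%O then 3%N else 1%N.

(** Families 2 and 3 are read in their top degree s + 1 in d, family 1 in degree 0. In family 4,
    L_1^y z is p_y c_z - c_y p_z - d c_y c_z: for z < y the difference of coefficients is 2 on it
    and 0 on L_1^z y, and for y <= z the coefficient of d is read. *)
Definition ellf (w : word Y) (g : cur symalg) : k^o :=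
  let: (l, s, z) := w in let xs := indexed 0 l in let ys := indexed 1 l in
  if indexed 2 l is z' :: _ then cf 0 xs (ys ++ [:: z'; z]) g
  else if (0 < s)%N || (size ys != 1)%N then cf s.+1 xs (ys ++ [:: z]) g
  else let y := head z ys in
    if (z < y)%O then cf 0 (xs ++ [:: y]) [:: z] g - cf 1 xs [:: y; z] g
    else cf 1 xs [:: y; z] g.

Lemma ellf_linear w : linear (ellf w).
Proof.
case: w => [[l s] z] a f g; rewrite /ellf.
case: (indexed 2 l) => [|z' r]; last by rewrite linearP.
case: ifP => _; first by rewrite linearP.
case: ifP => _; last by rewrite linearP.
rewrite !linearP /=; by linear_combination_in k (GRing.regular k : lmodType k); ring.
Qed.
HB.instance Definition _ w :=
  GRing.isLinear.Build k (cur symalg) k^o _ (ellf w) (ellf_linear w).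

Definition word1 xs ys z u : word Y := (Lpow 0 xs ++ Lpow 1 ys ++ [:: (2%N, z)], 0%N, u).
Definition word2 xs ys s z : word Y := (Lpow 0 xs ++ Lpow 1 ys, s, z).
Definition word4 xs y z : word Y := (Lpow 0 xs ++ [:: (1%N, y)], 0%N, z).

Lemma rank1 xs ys z u : rank (word1 xs ys z u) = 0%N.
Proof. by rewrite /rank /word1 !indexed_cat !indexed_Lpow. Qed.
Lemma ellf1 xs ys z u g : ellf (word1 xs ys z u) g = cf 0 xs (ys ++ [:: z; u]) g.
Proof. by rewrite /ellf /word1 !indexed_cat !indexed_Lpow /= !cats0. Qed.
Lemma rank2 xs ys s z : (0 < s)%N || (size ys != 1)%N -> rank (word2 xs ys s z) = (s + 9)%N.
Proof. by rewrite /rank /word2 !indexed_cat !indexed_Lpow /= => ->. Qed.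
Lemma ellf2 xs ys s z g : (0 < s)%N || (size ys != 1)%N ->
  ellf (word2 xs ys s z) g = cf s.+1 xs (ys ++ [:: z]) g.
Proof. by rewrite /ellf /word2 !indexed_cat !indexed_Lpow /= !cats0 => ->. Qed.
Lemma rank4 xs y z : rank (word4 xs y z) =
  if (z < y)%O then 2%N
  else if (y == z) || ~~ (last z xs <= z)%O then 3%N else 1%N.
Proof. by rewrite /rank /word4 !indexed_cat !indexed_Lpow /= !cats0. Qed.
Lemma ellf4 xs y z g : ellf (word4 xs y z) g =
  if (z < y)%O then cf 0 (xs ++ [:: y]) [:: z] g - cf 1 xs [:: y; z] g
  else cf 1 xs [:: y; z] g.
Proof. by rewrite /ellf /word4 !indexed_cat !indexed_Lpow /= !cats0. Qed.

Variant basic_form : word Y -> Prop :=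
| BasicForm1 xs ys z u of sorted <=%O xs & sorted <=%O (ys ++ [:: z; u]) :
    basic_form (word1 xs ys z u)
| BasicForm2 xs ys s z of sorted <=%O xs & sorted <=%O (ys ++ [:: z])
    & (0 < s)%N || (size ys != 1)%N : basic_form (word2 xs ys s z)
| BasicForm4 xs y z of sorted <=%O xs & (last y xs <= y)%O || (y <= z)%O :
    basic_form (word4 xs y z).

Lemma basicP w : basic_word w -> basic_form w.
Proof.
case=> {w} [xs ys z u sx sy|xs ys s z sx sy s0|xs ys z sx sy m|xs y z sx c].
- exact: BasicForm1.
- by apply: BasicForm2; rewrite ?s0 // cats1.
- by apply: (@BasicForm2 _ _ 0%N); rewrite ?cats1 //; case: m => [->|]; case: (size ys) => [|[|]].
- by apply: BasicForm4 => //; case: c => [->|->|->]; rewrite ?lexx ?orbT.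
Qed.

Lemma sorted_perm_eq (s t : seq Y) : sorted <=%O s -> sorted <=%O t -> perm_eq s t -> s = t.
Proof. exact: le_sorted_eq. Qed.

Lemma perm_eq_pair (a b a' b' : Y) : perm_eq [:: a; b] [:: a'; b'] =
  (a == a') && (b == b') || (a == b') && (b == a').
Proof.
have P1 x y : perm_eq [:: x] [:: y] = (x == y).
  apply/idP/eqP => [/perm_mem /(_ x)|->//].
  by rewrite !inE eqxx => /esym/eqP.
have P2 : perm_eq [:: b'; a'] [:: a'; b'] by rewrite (perm_catC [:: b'] [:: a']).
apply/idP/idP => [p|]; last first.
  by case/orP=> /andP[/eqP-> /eqP->] //; rewrite perm_sym.
have := perm_mem p a; rewrite !inE eqxx /= => /esym/orP[] /eqP e; subst a.
  by move: p; rewrite perm_cons P1 => /eqP->; rewrite !eqxx.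
by move: p; rewrite -(permPr P2) perm_cons P1 => /eqP->; rewrite !eqxx orbT.
Qed.

Lemma sorted_cat1 xs y : sorted <=%O xs -> (last y xs <= y)%O ->
  sorted <=%O (xs ++ [:: y]).
Proof.
by case: xs => //= x xs sx l; rewrite cat_path sx /= andbT.
Qed.

Lemma sorted_cat1_max xs y x : sorted <=%O (xs ++ [:: y]) -> x \in xs -> (x <= y)%O.
Proof.
rewrite sorted_pairwise; last exact: le_trans.
by rewrite pairwise_cat allrel1r => /and3P[/allP h _ _] /h.
Qed.

Lemma cat1_inj (xs xs' : seq Y) y y' : xs ++ [:: y] = xs' ++ [:: y'] -> xs = xs' /\ y = y'.
Proof. by rewrite !cats1 => /rcons_inj[-> ->]. Qed.

Lemma ellf_diag w : basic_form w -> ellf w (word_val sgen w) != 0.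
Proof.
have sgn n : ((-1) ^+ n : k) != 0 by rewrite expf_neq0 // oppr_eq0 oner_neq0.
case=> {w} [xs ys z u _ _|xs ys s z _ _ c|xs y z sx c].
- rewrite ellf1 cf_val1 eqxx !perm_refl mulr1 oppr_eq0 mulf_neq0 //.
  exact: (natf_neq0S char0 1).
- by rewrite ellf2 // cf_val2 !perm_refl mulr1.
- rewrite ellf4 cf_val4_0 cf_val4_1 !perm_refl; case: ltP => [zy|_].
    have -> : perm_eq [:: y] [:: z] = false.
      by apply/negP => /perm_mem /(_ y); rewrite !inE eqxx gt_eqF.
    by rewrite andbF subr0 opprK; exact: (natf_neq0S char0 1).
  by rewrite oppr_eq0 oner_neq0.
Qed.

(** The coefficient of d determines xs and the unordered pair of y and z. For y < z only the
    exchanged word can interfere; it lies in family 4 exactly when xs is bounded by z, and then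
    [rank] puts it at 2, above the 1 of the given word. *)
Lemma ellf_off4 xs y z xs' y' z' :
  sorted <=%O xs -> (last y xs <= y)%O || (y <= z)%O ->
  sorted <=%O xs' -> (last y' xs' <= y')%O || (y' <= z')%O ->
  word4 xs' y' z' != word4 xs y z ->
  (rank (word4 xs' y' z') <= rank (word4 xs y z))%N ->
  ellf (word4 xs y z) (val4 xs' y' z') = 0.
Proof.
move=> sx c sx' c' ne; rewrite !rank4 ellf4 cf_val4_0 cf_val4_1.
have ne' : xs' = xs -> (y', z') <> (y, z).
  by move=> ex [ey ez]; move: ne; rewrite ex ey ez eqxx.
have [zy|yz] /= := ltP z y; last first.
  have [b|] := boolP (perm_eq xs' xs && _); last by rewrite oppr0.
  case/andP: b => /(sorted_perm_eq sx' sx) ex; rewrite perm_eq_pair.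
  case/orP=> /andP[/eqP ey /eqP ez]; first by case: (ne' ex); rewrite ey ez.
  subst xs' y' z'; have [eyz|nyz] := eqVneq y z.
    by case: (ne' erefl); rewrite eyz.
  have lt_yz : (y < z)%O by rewrite lt_neqAle nyz.
  rewrite lt_yz; case: (boolP (last z xs <= z)%O) c' => //= _.
  by rewrite leNgt lt_yz.
(* As z < y, the letters of xs are at most y, so y is the largest p-letter of the monomial and can
   be read off from it. *)
have {}c : (last y xs <= y)%O by move: c; rewrite [(y <= z)%O]leNgt zy orbF.
have sxy := sorted_cat1 sx c.
have perm1 (a b : Y) : perm_eq [:: a] [:: b] = (a == b).
  apply/idP/eqP => [/perm_mem /(_ a)|->//].
  by rewrite !inE eqxx => /esym/eqP.
rewrite perm_eq_pair !perm1; have [zy'|yz'] := ltP z' y' => rk.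
  have {}c' : (last y' xs' <= y')%O by move: c'; rewrite [(y' <= z')%O]leNgt zy' orbF.
  have sxy' := sorted_cat1 sx' c'.
  have [/andP[p /eqP ez]|_] := boolP (perm_eq (xs' ++ [:: y']) _ && _).
    by have [ex ey] := cat1_inj (sorted_perm_eq sxy' sxy p); case: (ne' ex); rewrite ez ey.
  have [/andP[p /eqP ey]|_] := boolP (perm_eq (xs' ++ [:: z']) _ && _).
    have : y \in xs' ++ [:: z'] by rewrite (perm_mem p) mem_cat inE eqxx orbT.
    rewrite mem_cat inE => /orP[/(sorted_cat1_max sxy')|/eqP ezy].
      by rewrite ey leNgt zy.
    by move: zy'; rewrite -ezy ey ltNge (ltW zy).
  have [/andP[/(sorted_perm_eq sx' sx) ex]|_] := boolP (perm_eq xs' _ && _).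
    case/orP=> /andP[/eqP ey /eqP ez]; first by case: (ne' ex); rewrite ey ez.
    by move: zy'; rewrite ey ez ltNge (ltW zy).
  by rewrite subrr sub0r opprK.
move: rk; case: ifP => // /norP[nyz']; rewrite negbK => lz' _.
have sxz' := sorted_cat1 sx' lz'.
have lt_yz' : (y' < z')%O by rewrite lt_neqAle nyz'.
have [/andP[p /eqP ez]|_] := boolP (perm_eq (xs' ++ [:: y']) _ && _).
  have : y \in xs' ++ [:: y'] by rewrite (perm_mem p) mem_cat inE eqxx orbT.
  rewrite mem_cat inE => /orP[/(sorted_cat1_max sxz')|/eqP ey].
    by rewrite ez leNgt zy.
  by move: zy; rewrite ey -ez ltNge (ltW lt_yz').
(* Here [word4 xs' y' z'] has rank 1. It contributes in degree 0 and in degree 1 only as the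
   exchange of y and z, and the two contributions cancel. *)
suff -> : perm_eq (xs' ++ [:: z']) (xs ++ [:: y]) && (y' == z) =
    perm_eq xs' xs && ((y' == y) && (z' == z) || (y' == z) && (z' == y)).
  by rewrite sub0r opprK addNr.
apply/andP/andP => -[p].
  move=> ->; have [-> ->] := cat1_inj (sorted_perm_eq sxz' sxy p).
  by rewrite perm_refl eqxx orbT.
case/orP=> /andP[/eqP ey /eqP ez].
  by move: lt_yz'; rewrite ey ez ltNge (ltW zy).
by rewrite ey ez eqxx (sorted_perm_eq sx' sx p).
Qed.

(** Within a family sorted words are determined by their multisets of letters. Across families the
    degree in d and the number of c-letters decide: in degree 1 a word of family 4 has two
    c-letters, which the condition on [size ys] excludes for family 3; in degree 0 a word of family
    1 has at least two, while family 4 is read at one. *)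
Lemma ellf_off w w' : basic_form w -> basic_form w' -> w' != w ->
  (rank w' <= rank w)%N -> ellf w (word_val sgen w') = 0.
Proof.
have perm1F (a : Y) (s : seq Y) : size s != 1%N -> perm_eq s [:: a] = false.
  by move=> h; apply/negP => /perm_size e; rewrite e in h.
case=> {w} [xs ys z u sx sy|xs ys s z sx sy c|xs y z sx c].
- case=> {w'} [xs' ys' z' u' sx' sy' ne _|xs' ys' s' z' sx' sy' c' ne|xs' y' z' sx' c' ne].
  + rewrite ellf1 cf_val1 eqxx; have [|_] := boolP (_ && _); last by rewrite mulr0.
    case/andP=> /(sorted_perm_eq sx' sx) ex /(sorted_perm_eq sy' sy) ey.
    move: ne; rewrite /word1 ex; have := congr1 (@rev Y) ey.
    rewrite !rev_cat /= => -[-> -> /(can_inj revK) ->].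
    by rewrite eqxx.
  + by rewrite rank1 rank2 // addnS.
  + by rewrite rank1 rank4; case: ifP => // _; case: ifP.
- case=> {w'} [xs' ys' z' u' sx' sy' ne _|xs' ys' s' z' sx' sy' c' ne|xs' y' z' sx' c' ne].
  + by rewrite ellf2 // cf_val1.
  + rewrite !rank2 // leq_add2r ellf2 // leq_eqVlt => /orP[/eqP es|lt_s]; last first.
      exact: cf_val2_gt.
    subst s'; rewrite cf_val2; have [|_] := boolP (_ && _); last by rewrite mulr0.
    case/andP=> /(sorted_perm_eq sx' sx) ex /(sorted_perm_eq sy' sy) ey.
    by have [ey1 ey2] := cat1_inj ey; move: ne; rewrite ex ey1 ey2 eqxx.
  + move=> _; rewrite ellf2 //; case: s c ne => [|s] c ne; last exact: (cf_val2_gt _ [:: y']).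
    rewrite -/(val4 xs' y' z') cf_val4_1 (_ : perm_eq [:: y'; z'] _ = false) ?andbF ?oppr0 //.
    apply/negP => /perm_size; rewrite size_cat addn1 /= => -[e].
    by move: c; rewrite -e.
- case=> {w'} [xs' ys' z' u' sx' sy' ne _|xs' ys' s' z' sx' sy' c' ne|xs' y' z' sx' c' ne].
  + rewrite ellf4 !cf_val1 /= perm1F ?andbF ?mulr0 ?subr0; first by case: ifP.
    by rewrite size_cat addn2.
  + by rewrite rank4 rank2 //; case: ifP => [_|_]; [|case: ifP]; rewrite !addnS.
  + by move=> rk; apply: ellf_off4.
Qed.

Lemma basic_sgen_free (s : seq (word Y)) (c : word Y -> k) : uniq s ->
  {in s, forall w, basic_word w} ->
  (forall i X C, cf i X C (\sum_(w <- s) c w *: word_val sgen w) = 0) ->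
  {in s, forall w, c w = 0}.
Proof.
move=> us sB cf0.
apply: (@triangular_free k (cur symalg) _ (@basic_word disp Y) (word_val sgen) rank ellf) => //.
- by move=> w /basicP; apply: ellf_diag.
- by move=> w w' /basicP b /basicP b'; apply: ellf_off.
- move=> [[l i] z] _; rewrite /ellf /=; case: (indexed 2 l) => [|z' r]; last exact: cf0.
  by case: ifP => _; [|case: ifP => _]; rewrite !cf0 ?subr0.
Qed.

End SymmetricModel.

(** * Free algebras and structure constants *)

Section FreeAlgebra.
Variables (k : fieldType) (I : choiceType).
Local Open Scope fset_scope.

Definition freealg : Type := {malg k[{fmonom I}]}.
HB.instance Definition _ := GRing.Lalgebra.copy freealg {malg k[{fmonom I}]}.

Lemma freealg_scalerAr (a : k) (p q : freealg) : a *: (p * q) = p * (a *: q).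
Proof.
rewrite -[a *: q]mulr_algl mulrA -[a *: (p * q)]mulr_algl mulrA; congr (_ * q).
have -> : a%:A = a%:MP :> freealg by rewrite -[a%:A]mul_malgC mulr1.
rewrite [LHS]malgM_def fgmulUg [RHS]malgM_def fgmulgU.
by apply: eq_bigr => i _; rewrite mulm1 mul1m mulrC.
Qed.
HB.instance Definition _ := GRing.Lalgebra_isAlgebra.Build k freealg freealg_scalerAr.

Definition fword (s : seq I) : freealg := << FMonom s >>.

Lemma fwordM s t : fword s * fword t = fword (s ++ t).
Proof.
rewrite /fword [_ * _]malgM_def fgmulUU mulr1; congr (<< _ >>).
by apply/eqP; rewrite fmP fmM.
Qed.

Lemma fword_nil : fword [::] = 1.
Proof. by congr (<< _ >>); apply/eqP; rewrite fmP fm1. Qed.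

Section Extension.
Variables (Q : lmodType k) (h : seq I -> Q).

Definition freeext (p : freealg) : Q :=
  \sum_(m <- msupp (p : {malg k[{fmonom I}]})) (p : {malg k[{fmonom I}]})@_m *: h m.

Lemma freeextEw (D : {fset {fmonom I}}) (p : freealg) :
  msupp (p : {malg k[{fmonom I}]}) `<=` D ->
  freeext p = \sum_(m <- D) (p : {malg k[{fmonom I}]})@_m *: h m.
Proof.
move=> le; rewrite /freeext (big_fset_incl _ le) => //= m _ /mcoeff_outdom ->.
by rewrite scale0r.
Qed.

Lemma freeext_linear : linear freeext.
Proof.
move=> a p q; pose D := msupp (p : {malg k[{fmonom I}]}) `|` msupp (q : {malg k[{fmonom I}]}).
have sp : msupp (p : {malg k[{fmonom I}]}) `<=` D by apply: fsubsetUl.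
have sq : msupp (q : {malg k[{fmonom I}]}) `<=` D by apply: fsubsetUr.
have sr : msupp ((a *: p + q)%R : {malg k[{fmonom I}]}) `<=` D.
  apply/fsubsetP => m; rewrite -mcoeff_neq0 mcoeffD mcoeffZ => nz.
  rewrite in_fsetU -!mcoeff_neq0; apply: contraNT nz.
  by rewrite negb_or !negbK => /andP[/eqP-> /eqP->]; rewrite mulr0 addr0.
rewrite (freeextEw sp) (freeextEw sq) (freeextEw sr) scaler_sumr -big_split /=.
by apply: eq_bigr => m _; rewrite mcoeffD mcoeffZ scalerDl scalerA.
Qed.
HB.instance Definition _ := GRing.isLinear.Build k freealg Q _ freeext freeext_linear.

Lemma freeext_word s : freeext (fword s) = h s.
Proof. by rewrite /freeext msuppU1 big_seq_fset1 mcoeffU eqxx scale1r. Qed.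

End Extension.

Lemma freealg_ind (K : freealg -> Prop) : K 0 ->
  (forall a p q, K p -> K q -> K (a *: p + q)%R) -> (forall s, K (fword s)) ->
  forall p, K p.
Proof.
move=> K0 KL Kw p; rewrite [p](monalgE (p : {malg k[{fmonom I}]})).
elim/big_ind: _ => // [x y Kx Ky|m _]; first by rewrite -[x]scale1r; apply: KL.
have -> : << p@_m *g m >> = (p@_m *: fword m + 0)%R.
  rewrite addr0; apply/malgP => m'; rewrite mcoeffZ !mcoeffU fmK.
  by rewrite mulrnAr mulr1.
exact: KL.
Qed.

End FreeAlgebra.

(** [ext] extends a function on words linearly, not multiplicatively: functionals will be given by
    the normal forms of words. *)
Record is_free_algebra (k : fieldType) (I : Type) (Q : lmodType k) (P : algType k)
    (W : seq I -> P) (ext : (seq I -> Q) -> {linear P -> Q}) : Prop := IsFreeAlgebra {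
  free_wordM : forall s t, W s * W t = W (s ++ t);
  free_word_nil : W [::] = 1;
  free_ext_word : forall h s, ext h (W s) = h s;
  free_word_ind : forall K : P -> Prop, K 0 ->
    (forall a p q, K p -> K q -> K (a *: p + q)) -> (forall s, K (W s)) -> forall p, K p
}.

Section ContextKernel.
Variables (k : fieldType) (Q : lmodType k) (P : algType k).

(** The largest two-sided ideal in the kernel of [phi]; working modulo it takes the place of a
    quotient algebra of P. *)
Definition context_kernel (phi : P -> Q) (p : P) := forall u v, phi (u * p * v) = 0.

Variable phi : {linear P -> Q}.

Lemma context_kernel0 : context_kernel phi 0.
Proof. by move=> u v; rewrite mulr0 mul0r linear0. Qed.

Lemma context_kernelP a p q :
  context_kernel phi p -> context_kernel phi q -> context_kernel phi (a *: p + q).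
Proof.
move=> kp kq u v; rewrite mulrDr mulrDl -scalerAr -scalerAl linearP /=.
by rewrite kp kq scaler0 addr0.
Qed.

Lemma context_kernelB p q :
  context_kernel phi p -> context_kernel phi q -> context_kernel phi (p - q).
Proof. by move=> kp kq; rewrite addrC -scaleN1r; apply: context_kernelP. Qed.

Lemma context_kernel_words (I : Type) (W : seq I -> P) (Q' : lmodType k)
    (ext : (seq I -> Q') -> {linear P -> Q'}) p : is_free_algebra W ext ->
  (forall s t, phi (W s * p * W t) = 0) -> context_kernel phi p.
Proof.
move=> [_ _ _ word_ind] h u v; elim/word_ind: u => [|a q r Hq Hr|s].
- by rewrite !mul0r linear0.
- by rewrite mulrDl mulrDl -!scalerAl linearP /= Hq Hr scaler0 addr0.
elim/word_ind: v => [|a q r Hq Hr|t //]; first by rewrite mulr0 linear0.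
by rewrite mulrDr -!scalerAr linearP /= Hq Hr scaler0 addr0.
Qed.

End ContextKernel.

Lemma freealg_free (k : fieldType) (I : choiceType) (Q : lmodType k) :
  is_free_algebra (@fword k I) (fun h : seq I -> Q => [the {linear freealg k I -> Q} of freeext h]).
Proof.
split; [exact: fwordM|exact: fword_nil|exact: freeext_word|exact: freealg_ind].
Qed.
Lemma lin_collect (k : fieldType) (X : eqType) (V : lmodType k) (phi : X -> V)
    (u : seq (k * X)) (r : seq X) : uniq r -> {subset unzip2 u <= r} ->
  lin u phi = \sum_(x <- r) (\sum_(p <- u | p.2 == x) p.1) *: phi x.
Proof.
move=> uniq_r ur; rewrite /lin (eq_bigr (fun x => \sum_(p <- u | p.2 == x) p.1 *: phi p.2)).
  rewrite (exchange_big_dep xpredT) //= big_seq_cond [RHS]big_seq_cond.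
  apply: eq_bigr => p /andP[pu _].
  rewrite -big_filter (eq_filter (a2 := pred1 p.2)); last by move=> x; rewrite /= eq_sym.
  rewrite filter_pred1_uniq ?big_seq1 //.
  by apply: ur; apply: map_f.
by move=> x _; rewrite scaler_suml; apply: eq_bigr => p /eqP->.
Qed.

(** * Structure constants in a basis *)

Section Coordinates.
Variables (k : fieldType) (g : lmodType k) (X : eqType) (b : X -> g).
Hypothesis b_basis : is_linear_basis setT b.

Lemma lin_basis_ext (V : lmodType k) (s t : seq (k * X)) (phi : X -> V) :
  lin s b = lin t b -> lin s phi = lin t phi.
Proof.
pose r := undup (unzip2 (s ++ t)); have ur : uniq r := undup_uniq _.
have rs : {subset unzip2 s <= r} by move=> x; rewrite mem_undup /unzip2 map_cat mem_cat => ->.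
have rt : {subset unzip2 t <= r} by move=> x; rewrite mem_undup /unzip2 map_cat mem_cat orbC => ->.
rewrite !(lin_collect _ ur rs) !(lin_collect _ ur rt) => /eqP; rewrite -subr_eq0 -sumrB => /eqP e.
apply: eq_big_seq => x xr; congr (_ *: _); apply/eqP; rewrite -subr_eq0; apply/eqP.
apply: (b_basis.1 r (fun x => \sum_(p <- s | p.2 == x) p.1 - \sum_(p <- t | p.2 == x) p.1)) => //.
by rewrite -[RHS]e; apply: eq_bigr => y _; rewrite scalerBl.
Qed.

Definition pair_seq (s : seq X) (c : X -> k) : seq (k * X) := [seq (c z, z) | z <- s].

Lemma lin_pair_seq (V : lmodType k) s c (phi : X -> V) :
  lin (pair_seq s c) phi = \sum_(z <- s) c z *: phi z.
Proof. by rewrite /lin big_map. Qed.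

Lemma coords_exists v : exists sc : seq X * (X -> k), v = \sum_(z <- sc.1) sc.2 z *: b z.
Proof. by have [s [c [_ ->]]] := b_basis.2 v; exists (s, c). Qed.

Definition coords v : seq X * (X -> k) := projT1 (cid (coords_exists v)).
Definition coord_seq v : seq (k * X) := pair_seq (coords v).1 (coords v).2.

Lemma coordsP v : v = \sum_(z <- (coords v).1) (coords v).2 z *: b z.
Proof. exact: (projT2 (cid (coords_exists v))). Qed.

Lemma lin_coord_seq v : lin (coord_seq v) b = v.
Proof. by rewrite lin_pair_seq -coordsP. Qed.

Definition basis_ext (V : lmodType k) (phi : X -> V) (v : g) : V := lin (coord_seq v) phi.

Lemma basis_ext_lin (V : lmodType k) (phi : X -> V) (s : seq (k * X)) :
  basis_ext phi (lin s b) = lin s phi.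
Proof. by apply: lin_basis_ext; rewrite lin_coord_seq. Qed.

Lemma basis_ext_linear (V : lmodType k) (phi : X -> V) : linear (basis_ext phi).
Proof.
move=> a u v.
pose s := [seq (a * p.1, p.2) | p <- coord_seq u] ++ coord_seq v.
have E (W : lmodType k) (psi : X -> W) :
    lin s psi = a *: lin (coord_seq u) psi + lin (coord_seq v) psi.
  rewrite /lin big_cat big_map scaler_sumr; congr (_ + _).
  by apply: eq_bigr => p _; rewrite scalerA.
rewrite -[X in basis_ext phi X](_ : lin s b = _); last by rewrite E !lin_coord_seq.
by rewrite basis_ext_lin E.
Qed.
HB.instance Definition _ (V : lmodType k) (phi : X -> V) :=
  GRing.isLinear.Build k g V _ (basis_ext phi) (basis_ext_linear phi).

Lemma lin_coord_linear (V : lmodType k) (f : g -> V) (phi : X -> V) v :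
  linear f -> (forall x, phi x = f (b x)) -> lin (coord_seq v) phi = f v.
Proof.
move=> fL e; rewrite -[v in RHS]lin_coord_seq /lin.
have f0 : f 0 = 0 by have := fL (-1) 0 0; rewrite scaler0 addr0 scaleN1r addNr.
elim: (coord_seq v) => [|p s IH]; rewrite ?big_nil ?f0 // !big_cons.
by rewrite fL -IH e.
Qed.

End Coordinates.

Section LieStructure.
Variables (k : fieldType) (g : lieAlgType k) (X : eqType) (b : X -> g).
Hypothesis b_basis : is_linear_basis setT b.

Definition structure_const x y : seq (k * X) := coord_seq b_basis (lie (b x) (b y)).

Lemma lieDl (u v w : g) : lie (u + v) w = lie u w + lie v w.
Proof. by have /= := (@lie_bilinear k g).1 w 1 u v; rewrite !scale1r. Qed.
Lemma lieDr (u v w : g) : lie w (u + v) = lie w u + lie w v.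
Proof. by have /= := (@lie_bilinear k g).2 w 1 u v; rewrite !scale1r. Qed.

Lemma lieC (u v : g) : lie u v = - lie v u.
Proof.
have := liexx (u + v); rewrite lieDl !lieDr !liexx add0r addr0 => /eqP.
by rewrite addr_eq0 => /eqP.
Qed.

Lemma lin_structureE (V : lmodType k) x y (phi : X -> V) :
  lin (structure_const x y) phi = basis_ext b_basis phi (lie (b x) (b y)).
Proof. by []. Qed.

Lemma structure_skew (V : lmodType k) x y (phi : X -> V) :
  lin (structure_const x y) phi = - lin (structure_const y x) phi.
Proof. by rewrite !lin_structureE lieC linearN. Qed.

Lemma structure_alt (V : lmodType k) x (phi : X -> V) :
  lin (structure_const x x) phi = 0.
Proof. by rewrite lin_structureE liexx linear0. Qed.

Lemma structure_nested (V : lmodType k) x y z (phi : X -> V) :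
  lin (structure_const x y) (fun a => lin (structure_const a z) phi) =
  basis_ext b_basis phi (lie (lie (b x) (b y)) (b z)).
Proof.
apply: (lin_coord_linear b_basis (f := fun v => basis_ext b_basis phi (lie v (b z)))) => //.
move=> a u v; have /= -> := (@lie_bilinear k g).1 (b z) a u v; exact: linearP.
Qed.

Lemma structure_jacobi (V : lmodType k) x y z (phi : X -> V) :
  lin (structure_const x y) (fun a => lin (structure_const a z) phi) +
  lin (structure_const y z) (fun a => lin (structure_const a x) phi) +
  lin (structure_const z x) (fun a => lin (structure_const a y) phi) = 0.
Proof.
rewrite !structure_nested -!linearD /= -[RHS](linear0 (basis_ext b_basis phi)).
congr (basis_ext _ _ _); have := lie_jacobi (b z) (b x) (b y).
rewrite (lieC (b z)) (lieC (b x) (lie _ _)) (lieC (b y) (lie _ _)).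
by rewrite -!opprD => /eqP; rewrite oppr_eq0 => /eqP.
Qed.

Lemma structure_lie (V : lmodType k) : lie_constants structure_const V.
Proof. by split; [exact: structure_skew|exact: structure_alt|exact: structure_jacobi]. Qed.

Variable B : {biscalar g}.
Hypotheses (B_sym : forall u v, B u v = B v u)
  (B_inv : forall u v w, B (lie u v) w = B u (lie v w)).

Lemma lin_structure_form x y w :
  lin (structure_const x y) (fun z => B (b z) (b w) : k^o) = B (lie (b x) (b y)) (b w).
Proof.
apply: (lin_coord_linear b_basis (V := k^o) (f := fun v => B v (b w))) => //.
by move=> a u v; rewrite linearPl.
Qed.

Lemma structure_form_cyclic x y w :
  lin (structure_const x y) (fun z => B (b z) (b w) : k^o) =
  lin (structure_const y w) (fun z => B (b z) (b x) : k^o).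
Proof. by rewrite !lin_structure_form B_inv B_sym. Qed.

End LieStructure.

Section Orders.

Lemma well_order_total (T : eqType) (R : rel T) : well_order R -> total R.
Proof.
move=> wo x y; have [|z [[]]] := wo (pred2 x y); first by exists x; rewrite inE eqxx.
rewrite inE => /orP[] /eqP-> lb _; first by rewrite lb // inE eqxx orbT.
by rewrite (lb x) ?orbT // inE eqxx.
Qed.

Lemma well_order_anti (T : eqType) (R : rel T) : well_order R -> antisymmetric R.
Proof.
move=> wo x y /andP[xy yx]; have refl z : R z z by have := well_order_total wo z z; rewrite orbb.
have [|m [_ uniq_m]] := wo (pred2 x y); first by exists x; rewrite inE eqxx.
transitivity m; [symmetry|]; apply: uniq_m; split; rewrite ?inE ?eqxx ?orbT //.
  by move=> z; rewrite inE => /orP[] /eqP->.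
by move=> z; rewrite inE => /orP[] /eqP->.
Qed.

Lemma well_order_trans (T : eqType) (R : rel T) : well_order R -> transitive R.
Proof.
move=> wo y x z xy yz.
have anti := well_order_anti wo.
have [|m [[]]] := wo (pred3 x y z); first by exists x; rewrite inE eqxx.
rewrite inE => /or3P[] /eqP-> lb _; first by apply: lb; rewrite inE eqxx !orbT.
- have -> : x = y by apply: anti; rewrite xy lb // inE eqxx.
  by [].
- have e : y = z by apply: anti; rewrite yz lb // inE eqxx orbT.
  by rewrite -e.
Qed.

Variables (d : Order.disp_t) (Y : orderType d) (T : eqType) (R : rel T).
Hypotheses (R_total : total R) (R_trans : transitive R) (R_anti : antisymmetric R).

(** The second component is compared by a bare relation, since it will be [implb] on booleans and,
    for exponents in the field, an order obtained from the axiom of choice. *)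
Definition lexrel : rel (Y * T) :=
  fun p q => (p.1 < q.1)%O || (p.1 == q.1) && R p.2 q.2.

Lemma lexrel_total : total lexrel.
Proof.
move=> [x a] [y c]; rewrite /lexrel /=; by case: (ltgtP x y) => //= _; rewrite ?R_total.
Qed.

Lemma lexrel_trans : transitive lexrel.
Proof.
move=> [y b] [x a] [z c]; rewrite /lexrel /= => /orP[xy|/andP[/eqP-> ab]].
  by case/orP=> [/(lt_trans xy)->//|/andP[/eqP<- _]]; rewrite xy.
case/orP=> [->//|/andP[/eqP-> bc]].
by rewrite eqxx (R_trans ab bc) orbT.
Qed.

Lemma lexrel_anti : antisymmetric lexrel.
Proof.
move=> [x a] [y c]; rewrite /lexrel /=; by case: (ltgtP x y) => //= -> /R_anti ->.
Qed.

End Orders.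

(** * Ideals annihilated by functionals *)

Section Ideals.
Variables (k : fieldType) (F : assocConfAlgType k) (X : Type) (i : X -> F).
Hypothesis generate : conf_generates i.
Variable I : set F.
Hypotheses (I_sub : conf_submodule I)
  (I_mull : forall x n v, I v -> I (i x *_(n) v))
  (I_mulr : forall x n v, I v -> I (v *_(n) i x)).

(** The elements whose products with I on either side stay in I form a subalgebra, which contains
    the generators. For left products by u_(c) w this is an induction on c through [nprodAr]. *)
Lemma conf_ideal_of_generators : conf_ideal I.
Proof.
have [I0 IL ID] := I_sub.
have ID1 := conf_submoduleD I_sub; have IZ := conf_submoduleZ I_sub.
have IN := conf_submoduleN I_sub.
pose S : set F := [set u | forall n v, I v -> I (u *_(n) v) /\ I (v *_(n) u)]%classic.
suff ST : S = [set: F]%classic.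
  split=> // n u v Iu; have Sv : S v by rewrite ST.
  by have [] := Sv n u Iu.
apply: generate => [|x]; last by move=> n v Iv; split; [apply: I_mull|apply: I_mulr].
split; first split.
- by move=> n v _; rewrite nprod0l nprod0r.
- move=> a u w Su Sw n v Iv; have [u1 u2] := Su n v Iv; have [w1 w2] := Sw n v Iv.
  by rewrite nprodPl nprodDr nprodZr; split; apply: IL.
- move=> u Su n v Iv; rewrite nprod_derl nprod_derr; split.
    by apply/IN/IZ; have [] := Su n.-1 v Iv.
  apply: ID1; first by apply: ID; have [] := Su n v Iv.
  by apply: IZ; have [] := Su n.-1 v Iv.
move=> c u w Su Sw n v Iv; split; last first.
  rewrite nprodA; apply: (big_ind (fun u0 => I u0)) => // s _; apply: IZ.
  by have [_] := Su (n - s)%N v Iv => /(Sw (c + s)%N) [].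
elim/ltn_ind: c n => c IH n.
rewrite nprodAr; have Isum : I (\sum_(s < c) 'C(c, s.+1)%:R *: ((u *_(c - s.+1) w) *_(n + s.+1) v)).
  apply: (big_ind (fun u0 => I u0)) => // s _; apply: IZ; apply: IH.
  by have := ltn_ord s; lia.
have [Iwv _] := Sw n v Iv; have [Iuwv _] := Su c _ Iwv.
exact: ID1 Iuwv (IN _ Isum).
Qed.

End Ideals.

Section Contexts.
Variables (k : fieldType) (char0 : [pchar k] =i pred0) (P : algType k).
Variables (X : Type) (A B : X -> P) (psi : {linear P -> k^o}) (Omega : k -> Prop).
Implicit Types (w : cur P) (l : seq (X * k)).

(* By ev_nprod_cgenl and ev_nprod_cgenr, the generating series of the products of a
   generator with w, evaluated at nu, is a factor A x - lam *: B x times the value of w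
   at a shifted point: such products only lengthen the momentum words around w. *)
Definition momentum_word l : P := \prod_(p <- l) (A p.1 - p.2 *: B p.1).
Definition momentum l : k := \sum_(p <- l) p.2.

(** As w(nu) carries momentum -nu, [s0] is the opposite of the total momentum. [Omega] is everything
    in the model where e goes to 0, and the single value 0 in the model that detects e. *)
Definition annihilated : set (cur P) := [set w | forall l l' s0, Omega s0 ->
  psi (momentum_word l * ev (s0 + momentum l + momentum l') w * momentum_word l') = 0]%classic.

Lemma annihilated_submodule : conf_submodule annihilated.
Proof.
split.
- by move=> l l' s0 _; rewrite linear0 mulr0 mul0r linear0.
- move=> a u v Ju Jv l l' s0 O; rewrite linearP mulrDr mulrDl -scalerAr -scalerAl.
  by rewrite linearP /= Ju // Jv // scaler0 addr0.
- move=> u Ju l l' s0 O; rewrite ev_der -scalerAr -scalerAl linearZ /=.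
  by rewrite Ju // scaler0.
Qed.

(** The generating series of the products with w is the same context with a factor of momentum lam
    appended on the left, so it vanishes for every lam, and with it each coefficient. *)
Lemma annihilated_mull x n w :
  annihilated w -> annihilated (cgen (A x) (B x) *_(n) w).
Proof.
move=> Jw l l' s0 O; set nu := (_ + _ + _).
pose M := maxn n.+1 (size (w : {poly P})).+1.
have := coef_sum_eq0 char0 (M := M) (F := fun m =>
  psi (momentum_word l * ev nu (cgen (A x) (B x) *_(m) w) * momentum_word l')).
apply=> [lam|]; last exact: leq_maxl.
transitivity (psi (momentum_word (rcons l (x, lam)) *
    ev (s0 + momentum (rcons l (x, lam)) + momentum l') w * momentum_word l')); last exact: Jw.
have -> : momentum_word (rcons l (x, lam)) = momentum_word l * (A x - lam *: B x).
  by rewrite /momentum_word -cats1 big_cat big_seq1.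
have -> : s0 + momentum (rcons l (x, lam)) + momentum l' = nu + lam.
  by rewrite /nu /momentum -cats1 big_cat big_seq1 /=; ring.
rewrite -(mulrA (momentum_word l)) -(ev_nprod_cgenl char0 _ _ _ _ (leq_maxr n.+1 _)).
rewrite mulr_sumr mulr_suml linear_sum; apply: eq_bigr => m _.
by rewrite -scalerAr -scalerAl linearZ.
Qed.

Lemma annihilated_mulr x n w :
  annihilated w -> annihilated (w *_(n) cgen (A x) (B x)).
Proof.
move=> Jw l l' s0 O; set nu := (_ + _ + _).
pose M := maxn n.+1 (size (w : {poly P})).+1.
have := coef_sum_eq0 char0 (M := M) (F := fun m =>
  psi (momentum_word l * ev nu (w *_(m) cgen (A x) (B x)) * momentum_word l')).
apply=> [lam|]; last exact: leq_maxl.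
(* The right factor A + (nu + lam) B has this momentum, and w is now evaluated at -lam, so [s0] is
   unchanged. *)
pose p := (x, - (nu + lam)).
transitivity (psi (momentum_word l *
    ev (s0 + momentum l + momentum (p :: l')) w * momentum_word (p :: l'))); last exact: Jw.
have -> : momentum_word (p :: l') = (A x + (nu + lam) *: B x) * momentum_word l'.
  by rewrite /momentum_word big_cons /= scaleNr opprK.
have -> : s0 + momentum l + momentum (p :: l') = - lam.
  by rewrite /momentum big_cons /p /nu /momentum /=; ring.
rewrite mulrA -(mulrA (momentum_word l)) -(ev_nprod_cgenr char0 _ _ _ _ (leq_maxr n.+1 _)).
rewrite mulr_sumr mulr_suml linear_sum; apply: eq_bigr => m _.
by rewrite -scalerAr -scalerAl linearZ.
Qed.

Lemma ideal_gen_annihilated (F : assocConfAlgType k) (i : X -> F) (f : F -> cur P)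
    (R : set F) (v : F) :
  conf_generates i -> conf_morphism f -> (forall x, f (i x) = cgen (A x) (B x)) ->
  (forall r, R r -> annihilated (f r)) -> conf_ideal_gen R v -> annihilated (f v).
Proof.
move=> gen fm fi RJ gv.
pose I : set F := [set u | annihilated (f u)]%classic.
apply: (gv I); last exact: RJ.
have [fL fD fM] := fm; have [J0 JL JD] := annihilated_submodule.
have [f0 _ _ _] := conf_morphism_linear fm.
apply: (conf_ideal_of_generators (i := i)) => //.
- split=> [|a u w Ju Jw|u Ju]; rewrite /I /=.
  + by rewrite f0.
  + by rewrite fL; apply: JL.
  + by rewrite fD; apply: JD.
- by move=> x n u Ju; rewrite /I /= fM fi; apply: annihilated_mull.
- by move=> x n u Ju; rewrite /I /= fM fi; apply: annihilated_mulr.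
Qed.

End Contexts.

(** * Independence modulo the central element *)

Section Associated.
Variables (k : fieldType) (char0 : [pchar k] =i pred0).
Variables (disp : Order.disp_t) (Y : orderType disp) (S : algType k).
Variables (pc : seq Y -> seq Y -> S) (pc_coef : seq Y -> seq Y -> {linear S -> k^o}).
Hypothesis pc_basis : monomial_coefs pc pc_coef.
Local Notation pcM := (monomialM pc_basis).
Local Notation pc_nil := (monomial_nil pc_basis).
Local Notation pc_perm := (monomial_perm pc_basis).
Local Notation pc_coefE := (monomial_coefE pc_basis).
Variables (P : algType k) (W : seq (Y * bool) -> P)
  (ext : (seq (Y * bool) -> S) -> {linear P -> S}).
Hypothesis free_P : is_free_algebra W ext.
Local Notation WM := (free_wordM free_P).
Local Notation ext_word := (free_ext_word free_P).
Local Notation word_ind := (free_word_ind free_P).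
Variable br : Y -> Y -> seq (k * Y).
Hypothesis br_lie : lie_constants br S.
Local Notation br_skew := (constants_skew br_lie).
Local Notation br_alt := (constants_alt br_lie).
Local Notation br_jacobi := (constants_jacobi br_lie).

Local Notation Z := (Y * bool)%type.

(* The Lie algebra g tensor k[eps]/(eps^2): (x, true) stands for x eps. *)
Definition dual_br (a c : Z) : seq (k * Z) :=
  if a.2 && c.2 then [::]
  else [seq (p.1, (p.2, a.2 || c.2)) | p <- br a.1 c.1].

Lemma lin_dual_br (V : lmodType k) a c (phi : Z -> V) : lin (dual_br a c) phi =
  if a.2 && c.2 then 0 else lin (br a.1 c.1) (fun x => phi (x, a.2 || c.2)).
Proof. by rewrite /dual_br /lin; case: ifP => _; rewrite ?big_nil ?big_map. Qed.

Let dual_br_skew a c (phi : Z -> S) : lin (dual_br a c) phi = - lin (dual_br c a) phi.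
Proof. by rewrite !lin_dual_br andbC orbC; case: ifP; rewrite ?oppr0 // br_skew. Qed.

Let dual_br_alt a (phi : Z -> S) : lin (dual_br a a) phi = 0.
Proof. by rewrite lin_dual_br; case: ifP => // _; rewrite br_alt. Qed.

Lemma lin0 (T : Type) (V : lmodType k) (s : seq (k * T)) : lin s (fun _ => 0 : V) = 0.
Proof. by rewrite /lin big1 // => p _; rewrite scaler0. Qed.

Let dual_br_jacobi a b c (phi : Z -> S) :
  lin (dual_br a b) (fun z => lin (dual_br z c) phi) +
  lin (dual_br b c) (fun z => lin (dual_br z a) phi) +
  lin (dual_br c a) (fun z => lin (dual_br z b) phi) = 0.
Proof.
have E a' b' c' : lin (dual_br a' b') (fun z => lin (dual_br z c') phi) =
    if [|| a'.2 && b'.2, b'.2 && c'.2 | c'.2 && a'.2] then 0 else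
    lin (br a'.1 b'.1) (fun x => lin (br x c'.1) (fun y => phi (y, [|| a'.2, b'.2 | c'.2]))).
  rewrite lin_dual_br; case: a' b' c' => [a' []] [b' []] [c' []] //=;
  first [by []|rewrite -[0](@lin0 Y S (br a' b'))|idtac]; apply: eq_lin => x; exact: lin_dual_br.
rewrite !E; case: a b c => [a []] [b []] [c []] //=; rewrite ?addr0 //; exact: br_jacobi.
Qed.

Definition firsts c (s : seq Z) : seq Y := [seq z.1 | z <- s & z.2 == c].
Definition mono (s : seq Z) : S := pc (firsts false s) (firsts true s).

Lemma mono_cat s t : mono (s ++ t) = mono s * mono t.
Proof. by rewrite /mono pcM /firsts !filter_cat !map_cat. Qed.

Lemma mono_perm s t : perm_eq s t -> mono s = mono t.
Proof. by move=> p; apply: pc_perm; apply/perm_map/perm_filter. Qed.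

Lemma size_firsts s : (size (firsts false s) + size (firsts true s))%N = size s.
Proof.
rewrite !size_map !size_filter -(count_predC (fun z : Z => z.2 == false) s).
by congr (_ + _)%N; apply: eq_count => -[x []].
Qed.

Lemma pc_coef_mono X C s : size s != (size X + size C)%N -> pc_coef X C (mono s) = 0.
Proof.
rewrite pc_coefE -(size_firsts s); case: andP => // -[/perm_size -> /perm_size ->].
by rewrite eqxx.
Qed.

Let le_letter : rel Z := lexrel implb.
Let le_letter_total : total le_letter. Proof. by apply: lexrel_total => -[] []. Qed.
Let le_letter_trans : transitive le_letter. Proof. by apply: lexrel_trans => -[] [] []. Qed.
Let le_letter_anti : antisymmetric le_letter. Proof. by apply: lexrel_anti => -[] []. Qed.

(** The PBW identification of the enveloping algebra of g tensor k[eps]/(eps^2) with S, sorted words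
    being read as commutative monomials. *)
Definition normal : seq Z -> S := straighten le_letter dual_br mono.

Lemma normalS u x y v : normal (u ++ x :: y :: v) =
  normal (u ++ y :: x :: v) + lin (dual_br x y) (fun a => normal (u ++ a :: v)).
Proof.
exact: (straightenS le_letter_total le_letter_trans le_letter_anti
  (LieConstants dual_br_skew dual_br_alt dual_br_jacobi)).
Qed.

(** Brackets shorten words, so in degree equal to the length of the word the normal form is the
    commutative monomial, and in larger degrees both are 0. *)
Lemma normal_top X C s : (size s <= size X + size C)%N ->
  pc_coef X C (normal s) = pc_coef X C (mono s).
Proof.
elim/(straightening_ind le_letter_total): s => [s srt _|u x y v _ IH IHa le_s].
  by rewrite /normal straighten_sorted.
rewrite normalS linearD IH; last by move: le_s; rewrite !size_cat.
rewrite (mono_perm (t := u ++ y :: x :: v)); last first.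
  by rewrite perm_cat2l (perm_catCA [:: x] [:: y] v).
rewrite [X in _ + X](_ : _ = 0) ?addr0 // /lin linear_sum big1 // => p _.
have lt_s a : (size (u ++ a :: v) < size X + size C)%N.
  by move: le_s; rewrite !size_cat /= !addnS.
rewrite linearZ /= IHa ?pc_coef_mono ?scaler0 //; last exact: ltnW.
by rewrite ltn_eqF.
Qed.

Lemma killed_comm x y : context_kernel (ext normal)
  (W [:: x] * W [:: y] - W [:: y] * W [:: x] - lin (dual_br x y) (fun a => W [:: a])).
Proof.
apply: (context_kernel_words free_P) => u v.
rewrite !mulrBr !mulrBl !WM !linearB /= !ext_word -!catA /= normalS.
rewrite [X in X - _ - _]addrC addrK -[RHS](subrr (lin (dual_br x y) (fun a => normal (u ++ a :: v)))).
congr (_ - _); rewrite /lin mulr_sumr mulr_suml linear_sum; apply: eq_bigr => p _.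
by rewrite -scalerAr -scalerAl linearZ /= !WM ext_word -catA.
Qed.

(** Being a combination of words of length n, expressed dually so that no expansion of p has to be
    carried along. *)
Definition homog n (p : P) := forall phi : P -> k^o, linear phi ->
  (forall s, size s = n -> phi (W s) = 0) -> phi p = 0.

Lemma homog0 n : homog n 0.
Proof. by move=> phi L _; have := L (-1) 0 0; rewrite scaler0 addr0 scaleN1r addNr. Qed.

Lemma homogP n a p q : homog n p -> homog n q -> homog n (a *: p + q).
Proof. by move=> hp hq phi L h; rewrite L hp ?hq // scaler0 addr0. Qed.

Lemma homog_word s : homog (size s) (W s).
Proof. by move=> phi _; apply. Qed.

Lemma homog_mul z n p : homog n p -> homog n.+1 (W [:: z] * p).
Proof.
move=> hp phi L h; apply: (hp (fun q => phi (W [:: z] * q))) => [a q r|s e].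
  by rewrite mulrDr -scalerAr L.
by rewrite WM h //= e.
Qed.

Definition fgen x : cur P := cgen (W [:: (x, false)]) (W [:: (x, true)]).

Lemma coef_nprod_cgen (V : algType k) (A B : V) n (f : cur V) i :
  (cgen A B *_(n) f : {poly V})`_i =
  A * ((f : {poly V})`_(n + i) *+ (n + i) ^_ n) -
  n%:R *: (B * ((f : {poly V})`_(n.-1 + i) *+ (n.-1 + i) ^_ n.-1)).
Proof.
by rewrite nprod_cgen coef_curD coefN coef_curZ !coefZ !coef_derivn.
Qed.

Lemma coef_word_homog (w : word Y) i :
  homog (size w.1.1).+1 ((word_val fgen w : {poly P})`_i).
Proof.
case: w => [[l s] z]; rewrite /word_val -/(act fgen l _); elim: l i => [|[n x] l IH] i.
  elim: s i => [|s IH] i; last first.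
    by rewrite /= coef_der; case: i => [|i]; [apply: homog0|apply: IH].
  rewrite /= coef_cgen; case: i => [|[|i]]; last exact: homog0.
    exact: (@homog_word [:: (z, false)]).
  exact: (@homog_word [:: (z, true)]).
have hM m p q : homog m p -> homog m (p *+ q).
  move=> hp; rewrite -scaler_nat -[_ *: p]addr0; apply: homogP => //; exact: homog0.
rewrite act_cons coef_nprod_cgen addrC -scaleNr; apply: homogP; apply: homog_mul; exact/hM/IH.
Qed.

Let sgen : Y -> cur S := sgen pc.

Lemma ext_mono_mul z p : ext mono (W [:: z] * p) = mono [:: z] * ext mono p.
Proof.
elim/word_ind: p => [|a p q Hp Hq|s]; first by rewrite mulr0 !linear0 mulr0.
  by rewrite mulrDr -scalerAr !linearP /= Hp Hq mulrDr -scalerAr.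
by rewrite WM !ext_word (mono_cat [:: z]).
Qed.

(** Abelianization carries the model over the free algebra to the polynomial model. *)
Lemma ext_mono_coef (w : word Y) i :
  ext mono ((word_val fgen w : {poly P})`_i) = (word_val sgen w : {poly S})`_i.
Proof.
have E x j : ext mono ((fgen x : {poly P})`_j) = (sgen x : {poly S})`_j.
  by rewrite !coef_cgen; case: j => [|[|j]]; rewrite ?linear0 ?ext_word.
case: w => [[l s] z]; rewrite /word_val -/(act fgen l _) -/(act sgen l _).
elim: l i => [|[n x] l IH] i.
  by elim: s i => [|s IH] i; rewrite ?E //= !coef_der; case: i => [|i]; rewrite ?linear0 ?IH.
rewrite !act_cons !coef_nprod_cgen linearB linearZ /= !ext_mono_mul.
by rewrite !raddfMn /= !IH.
Qed.

(** Descending induction on the number n of operators. In coefficients of total degree n + 1 the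
    shorter words do not appear, the longer ones have coefficient 0 already, and words with n
    operators contribute as in the polynomial model. *)
Lemma basic_fgen_free (s : seq (word Y)) (c : word Y -> k) : uniq s ->
  {in s, forall w, basic_word w} ->
  (forall i X C, pc_coef X C (ext normal
     ((\sum_(w <- s) c w *: word_val fgen w : cur P) : {poly P})`_i) = 0) ->
  {in s, forall w, c w = 0}.
Proof.
move=> us sB s0.
pose M := (\max_(w <- s) size w.1.1)%N.
have leM w : w \in s -> (size w.1.1 <= M)%N.
  by move=> sw; apply: (@leq_bigmax_seq _ s xpredT (fun w : word Y => size w.1.1) w).
move=> w; have [m] := ubnP (M - size w.1.1)%N; elim: m w => // m IH w.
rewrite ltnS => le_m sw; set n := size w.1.1.
have IHn w' : w' \in s -> (n < size w'.1.1)%N -> c w' = 0.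
  by move=> sw' lt; apply: IH => //; have := leM _ sw'; lia.
pose t := [seq w' <- s | size w'.1.1 == n].
apply: (basic_sgen_free char0 pc_basis (s := t) (c := c)); last first.
- by rewrite mem_filter eqxx.
- move=> i X C; rewrite linear_sum /=.
  have cfE w' : cf pc_coef i X C (word_val sgen w') =
      pc_coef X C (ext mono ((word_val fgen w' : {poly P})`_i)).
    by rewrite ext_mono_coef.
  (* A word with n operators has n + 1 letters; in any other total degree its polynomial value has
     no coefficient. *)
  have [e|ne] := eqVneq n.+1 (size X + size C)%N; last first.
    rewrite big_filter big1 // => w' /eqP sz; rewrite linearZ /= cfE.
    rewrite (@coef_word_homog w' i (fun p => pc_coef X C (ext mono p))) ?scaler0 //.
      by move=> a p q; rewrite !linearP.
    by move=> r szr; rewrite ext_word pc_coef_mono // szr sz.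
  rewrite -[RHS](s0 i X C).
  have coef_sum : ((\sum_(w <- s) c w *: word_val fgen w : cur P) : {poly P})`_i =
      \sum_(w <- s) c w *: (word_val fgen w : {poly P})`_i.
    elim: (s) => [|w' r IHr]; first by rewrite !big_nil coef0.
    by rewrite !big_cons coef_curD coef_curZ IHr.
  rewrite coef_sum !linear_sum big_filter big_mkcond /=; apply: eq_big_seq => w' sw'.
  rewrite !linearZ /=; case: eqP => [sz|/eqP nsz].
    rewrite cfE; congr (_ *: _); apply/eqP; rewrite -subr_eq0; apply/eqP.
    apply: (@coef_word_homog w' i (fun p => pc_coef X C (ext mono p) - pc_coef X C (ext normal p))).
      by move=> a p q; rewrite !linearP /= scalerDr addrACA.
    by move=> r szr; rewrite !ext_word normal_top ?subrr // szr sz e.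
  have [lt|le] := ltnP n (size w'.1.1); first by rewrite IHn // scale0r.
  have {nsz}le : (size w'.1.1 < n)%N by rewrite ltn_neqAle nsz.
  rewrite (@coef_word_homog w' i (fun p => pc_coef X C (ext normal p))) ?scaler0 //.
    by move=> a p q; rewrite !linearP.
  have lt r : size r = (size w'.1.1).+1 -> (size r < size X + size C)%N by move=> ->; rewrite -e ltnS.
  move=> r /lt lt_r; rewrite ext_word normal_top 1?ltnW //.
  by rewrite pc_coef_mono // ltn_eqF.
- by move=> w'; rewrite mem_filter => /andP[_ /sB].
- exact: filter_uniq.
Qed.

End Associated.

Section ZeroBracket.
Variables (k : fieldType) (V : confAlgType k).

Lemma nbracket0r n (u : V) : nbracket n u 0 = 0.
Proof.
rewrite /nbracket nprod0r (@nprod_opE _ _ 0) ?big_ord0 ?subr0 // => m _.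
exact: nprod0l.
Qed.

Lemma nbracket0l n (u : V) : nbracket n 0 u = 0.
Proof.
rewrite /nbracket nprod0l (@nprod_opE _ _ 0) ?big_ord0 ?subr0 // => m _.
exact: nprod0r.
Qed.

End ZeroBracket.

Lemma conf_morphism_nbracket (k : fieldType) (V W : confAlgType k) (f : V -> W) n u v :
  conf_morphism f -> f (nbracket n u v) = nbracket n (f u) (f v).
Proof.
move=> fm; have [_ fD fN _] := conf_morphism_linear fm; have [_ _ fM] := fm.
by rewrite /nbracket fD fN fM conf_morphism_nprod_op.
Qed.

Section AssociatedIdeal.
Variables (k : fieldType) (char0 : [pchar k] =i pred0).
Variables (g : lieAlgType k) (form : g -> g -> k).
Variables (disp : Order.disp_t) (Y : orderType disp) (b : Y -> g).
Hypothesis b_basis : is_linear_basis setT b.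
Variables (S : algType k) (pc : seq Y -> seq Y -> S).
Variables (P : algType k) (W : seq (Y * bool) -> P)
  (ext : (seq (Y * bool) -> S) -> {linear P -> S}).
Hypothesis free_P : is_free_algebra W ext.
Variables (F : assocConfAlgType k) (i : option Y -> F) (f : F -> cur P).
Hypotheses (generate : conf_generates i) (fm : conf_morphism f).

Local Notation letterf c := (fun x : option Y => if x is Some y then W [:: (y, c)] else 0).
Hypothesis fi : forall x, f (i x) = cgen (letterf false x) (letterf true x).
Local Notation br := (structure_const b_basis).
Local Notation killed := (context_kernel (ext (normal pc br))).

Let killed_letters x y c d (s : seq Y) (e : Y -> k) :
  lie (b x) (b y) = \sum_(z <- s) e z *: b z ->
  killed (W [:: (x, c)] * W [:: (y, d)] - W [:: (y, d)] * W [:: (x, c)] -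
    if c && d then 0 else \sum_(z <- s) e z *: W [:: (z, c || d)]).
Proof.
move=> exy; have := killed_comm pc free_P (structure_lie b_basis S) (x, c) (y, d).
rewrite lin_dual_br /=; case: ifP => // _.
rewrite -(lin_pair_seq s e (fun z => W [:: (z, c || d)])).
rewrite (lin_basis_ext b_basis (t := pair_seq s e)) //.
by rewrite lin_coord_seq lin_pair_seq.
Qed.

Variables (X C : seq Y) (pc_coef : {linear S -> k^o}).
Let psi : {linear P -> k^o} := [the {linear _ -> _} of pc_coef \o ext (normal pc br)].

Let annih : set (cur P) := annihilated (letterf false) (letterf true) psi setT.

Let annih_submodule : conf_submodule annih.
Proof. exact: annihilated_submodule. Qed.

Let annihD := conf_submoduleD annih_submodule.
Let annihZ := conf_submoduleZ annih_submodule.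
Let annihN := conf_submoduleN annih_submodule.

Let annih_cst p : killed p -> annih (cst p).
Proof. by move=> kp l l' s0 _; rewrite ev_cst /= kp linear0. Qed.

Lemma Kac_annihilated r : Kac_relation form b i r -> annih (f r).
Proof.
have [J0 JL JD] := annih_submodule.
have [f0 fD fN fZ] := conf_morphism_linear fm; have [_ fder _] := fm.
have fe : f (i None) = 0 by rewrite fi /cgen !linear0 addr0.
have k2 : (2%:R : k) != 0 := natf_neq0S char0 1.
case=> {r}.
- by rewrite fder fe linear0.
- move=> x y s c exy; rewrite fD fN (conf_morphism_sum _ _ _ fm).
  rewrite (conf_morphism_nbracket _ _ _ fm) !fi nbracket_cgen0 //.
  have -> : \sum_(z <- s) c z *: f (i (Some z)) =
      cst (\sum_(z <- s) c z *: W [:: (z, false)]) +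
      der (cst (\sum_(z <- s) c z *: W [:: (z, true)])).
    rewrite !linear_sum -big_split; apply: eq_bigr => z _ /=.
    by rewrite fi /cgen scalerDr !linearZ.
  have K1 := killed_letters false false exy; have K2 := killed_letters false true exy.
  rewrite /= in K1 K2; rewrite opprD addrACA -!linearB /=.
  by apply: annihD; [|apply: JD]; apply: annih_cst.
- move=> x y; rewrite fD fN fZ fe scaler0 oppr0 addr0 (conf_morphism_nbracket _ _ _ fm) !fi.
  rewrite nbracket_cgen1 -!linearB /=.
  have exy := coordsP b_basis (lie (b x) (b y)).
  have K1 := killed_letters false true exy; have K2 := killed_letters true false exy.
  have := killed_letters true true exy; rewrite /= subr0 in K1 K2 * => K3.
  apply: annihD; last by apply/annihN/JD/annih_cst.
  apply: annih_cst; have := context_kernelB K1 K2.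
  by rewrite opprB addrA subrK.
- move=> x y n; rewrite leq_eqVlt => /orP[/eqP <-|n3]; rewrite (conf_morphism_nbracket _ _ _ fm) !fi.
    rewrite nbracket_cgen2 -scaleNr -linearB /=; apply/annihZ/annih_cst.
    by have := killed_letters true true (coordsP b_basis (lie (b x) (b y))); rewrite /= subr0.
  by rewrite nbracket_cgen_ge3.
- by move=> x n; rewrite (conf_morphism_nbracket _ _ _ fm) fe nbracket0r.
- by move=> x n; rewrite (conf_morphism_nbracket _ _ _ fm) fe nbracket0l.
- by move=> n; rewrite (conf_morphism_nbracket _ _ _ fm) fe nbracket0l.
Qed.

(** With empty contexts and arbitrary [s0], the functional vanishes on w(s0) for every scalar, hence
    on each coefficient of w. *)
Lemma Kac_ideal_normal v n : conf_ideal_gen (Kac_relation form b i) v ->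
  pc_coef (ext (normal pc br) ((f v : {poly P})`_n)) = 0.
Proof.
move=> gv; have Jv := ideal_gen_annihilated char0 generate fm fi Kac_annihilated gv.
set w := f v in Jv *.
have [lt_n|le_n] := ltnP n (size (w : {poly P})); last first.
  by rewrite nth_default // linear0 linear0.
suff : \poly_(j < size (w : {poly P})) (psi ((w : {poly P})`_j) : k) = 0.
  by move/polyP => /(_ n); rewrite coef_poly lt_n coef0.
apply: (poly_eq0_of_root_all char0) => s0.
have := Jv [::] [::] s0 I; rewrite /momentum_word /momentum !big_nil mul1r mulr1 !addr0.
rewrite (horner_wide _ (leqnn _)) linear_sum horner_poly => e; rewrite -[RHS]e.
by apply: eq_bigr => j _; rewrite linearZ mulrC.
Qed.

End AssociatedIdeal.

(** * The central element *)

Section Affine.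
Variables (k : fieldType) (char0 : [pchar k] =i pred0).
Variables (disp : Order.disp_t) (Y : orderType disp).
Variables (br : Y -> Y -> seq (k * Y)) (form : Y -> Y -> k).
Hypothesis br_lie : lie_constants br k^o.
Local Notation br_skew := (constants_skew br_lie).
Local Notation br_alt := (constants_alt br_lie).
Local Notation br_jacobi := (constants_jacobi br_lie).
Hypothesis form_sym : forall x y, form x y = form y x.
Hypothesis form_cyclic : forall x y w,
  lin (br x y) (fun z => form z w : k^o) = lin (br y w) (fun z => form z x : k^o).
Variable R : rel k.
Hypotheses (R_total : total R) (R_trans : transitive R) (R_anti : antisymmetric R).

Local Notation Z := (option (Y * k)).

(* The affine Lie algebra with exponents in k: Some (x, m) stands for x t^m and None for
   the central element. *)
Definition affine_br (a c : Z) : seq (k * Z) :=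
  if (a, c) is (Some (x, m), Some (y, n)) then
    [seq (p.1, Some (p.2, m + n)) | p <- br x y] ++
    (if m + n == 0 then [:: (m * form x y, None)] else [::])
  else [::].

Lemma lin_affine_br x m y n (phi : Z -> k^o) :
  lin (affine_br (Some (x, m)) (Some (y, n))) phi =
  lin (br x y) (fun a => phi (Some (a, m + n))) +
  (if m + n == 0 then (m * form x y) *: phi None else 0).
Proof.
rewrite /affine_br /lin big_cat big_map; congr (_ + _).
by case: ifP => _; rewrite ?big_nil ?big_seq1.
Qed.

Lemma lin_affine_None a (phi : Z -> k^o) :
  lin (affine_br a None) phi = 0 /\ lin (affine_br None a) phi = 0.
Proof. by case: a => [[]|] *; rewrite /lin !big_nil. Qed.

Let affine_skew a c (phi : Z -> k^o) : lin (affine_br a c) phi = - lin (affine_br c a) phi.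
Proof.
case: a c => [[x m]|] [[y n]|]; rewrite ?(lin_affine_None _ _).1 ?(lin_affine_None _ _).2 ?oppr0 //.
rewrite !lin_affine_br br_skew opprD [n + m]addrC; congr (_ + _).
case: eqP => [e|_]; last by rewrite oppr0.
by rewrite (form_sym y) -scaleNr -mulNr (_ : - n = m) //; apply/eqP; rewrite eq_sym -addr_eq0 e.
Qed.

Let affine_alt a (phi : Z -> k^o) : lin (affine_br a a) phi = 0.
Proof.
case: a => [[x m]|]; last by rewrite (lin_affine_None _ _).1.
rewrite lin_affine_br br_alt add0r -mulr2n -mulr_natr mulf_eq0.
by rewrite (negbTE (natf_neq0S char0 1)) orbF; case: eqP => // ->; rewrite mul0r scale0r.
Qed.

Lemma affine_nested x m y n z q (phi : Z -> k^o) :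
  lin (affine_br (Some (x, m)) (Some (y, n))) (fun a => lin (affine_br a (Some (z, q))) phi) =
  lin (br x y) (fun a => lin (br a z) (fun c => phi (Some (c, m + n + q)))) +
  (if m + n + q == 0 then (m + n) * lin (br x y) (fun a => form a z : k^o) * phi None else 0).
Proof.
rewrite lin_affine_br (lin_affine_None _ _).2 scaler0 if_same addr0.
rewrite (eq_lin _ (fun a => lin_affine_br a (m + n) z q phi)) linD; congr (_ + _).
case: ifP => _; last exact: lin0.
rewrite /lin mulr_sumr mulr_suml; apply: eq_bigr => p _.
by rewrite /GRing.scale /=; ring.
Qed.

Let affine_jacobi a b c (phi : Z -> k^o) :
  lin (affine_br a b) (fun z => lin (affine_br z c) phi) +
  lin (affine_br b c) (fun z => lin (affine_br z a) phi) +
  lin (affine_br c a) (fun z => lin (affine_br z b) phi) = 0.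
Proof.
have E s : lin s (fun z => lin (affine_br z None) phi) = 0.
  by rewrite -[RHS](@lin0 k Z k^o s); apply: eq_lin => z; rewrite (lin_affine_None _ _).1.
case: a b c => [[x m]|] [[y n]|] [[z q]|];
  rewrite ?(lin_affine_None _ _).1 ?(lin_affine_None _ _).2 ?E ?addr0 //.
rewrite !affine_nested (_ : n + q + m = m + n + q) 1?(_ : q + m + n = m + n + q); try by ring.
have := br_jacobi x y z (fun c => phi (Some (c, m + n + q))).
case: eqP => [e|_]; last by rewrite !addr0.
have sum3 (A1 A2 A3 t1 t2 t3 : k^o) : A1 + A2 + A3 = 0 ->
    A1 + t1 + (A2 + t2) + (A3 + t3) = t1 + t2 + t3.
  by move=> e0; rewrite -[RHS]add0r -e0; ring.
(* By invariance the three central terms share the same form value; their factors add up to 2 (m + n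
   + q) = 0. *)
move/sum3=> ->; rewrite (form_cyclic x y z) (form_cyclic y z x).
rewrite -!mulrDl (_ : m + n + (n + q) + (q + m) = 0) ?mul0r //.
by rewrite (_ : _ + _ = (m + n + q) *+ 2); [rewrite e mul0rn|ring].
Qed.

Definition le_affine : rel Z := fun a c =>
  if a is Some p then if c is Some q then lexrel R p q else false else true.

Lemma le_affine_total : total le_affine.
Proof. by move=> [a|] [c|] //=; apply: lexrel_total. Qed.
Lemma le_affine_trans : transitive le_affine.
Proof. by move=> [a|] [c|] [d|] //=; apply: lexrel_trans. Qed.
Lemma le_affine_anti : antisymmetric le_affine.
Proof. by move=> [a|] [c|] //= /(lexrel_anti R_anti) ->. Qed.

(* The value on x t^m x t^-m is half of the central term of [x t^m, x t^-m]; this choice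
   makes central_coef linear in the exponents (central_coef_linear). *)
Definition central_coef0 (s : seq Z) : k^o :=
  match s with
  | [:: None] => 1
  | [:: Some (x, m); Some (y, n)] =>
      if (x == y) && (m + n == 0) then m / 2%:R * form x x else 0
  | _ => 0
  end.

Definition central_coef : seq Z -> k^o := straighten le_affine affine_br central_coef0.

Lemma central_coefS u x y v : central_coef (u ++ x :: y :: v) =
  central_coef (u ++ y :: x :: v) + lin (affine_br x y) (fun a => central_coef (u ++ a :: v)).
Proof.
exact: (straightenS le_affine_total le_affine_trans le_affine_anti
  (LieConstants affine_skew affine_alt affine_jacobi)).
Qed.

Lemma central_coef_sorted s : sorted le_affine s -> central_coef s = central_coef0 s.
Proof. exact: straighten_sorted. Qed.

(** The central letter has zero brackets, so rewriting keeps it together with at least one other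
    letter, and sorted words of this shape have value 0. *)
Lemma central_coef_None s : None \in s -> (1 < size s)%N -> central_coef s = 0.
Proof.
elim/(straightening_ind le_affine_total): s => [s srt Ns sz|u x y v nxy IH IHa Ns sz].
  rewrite central_coef_sorted //; move: Ns sz.
  by case: s {srt} => [|[[x m]|] [|[[y n]|] [|c s]]]; rewrite ?inE.
rewrite central_coefS IH ?add0r; first last.
- by move: sz; rewrite !size_cat.
- by move: Ns; rewrite !mem_cat !inE; case: (_ \in u) => //=; rewrite orbCA.
case: x y nxy IH IHa Ns sz => [[x m]|] [[y n]|] nxy IH IHa Ns sz;
  rewrite ?(lin_affine_None _ _).1 ?(lin_affine_None _ _).2 //.
have Nuv a : None \in u ++ a :: v.
  by move: Ns; rewrite !mem_cat !inE /=; case: (_ \in u) => //= ->; rewrite orbT.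
have suv a : (1 < size (u ++ a :: v))%N.
  by move: Ns; rewrite size_cat mem_cat !inE /= addnS ltnS lt0n addn_eq0 !size_eq0; case: u {IH IHa sz Nuv} => //=; case: v.
by rewrite -[RHS](@lin0 k Z k^o (affine_br (Some (x, m)) (Some (y, n)))); apply: eq_lin => a; rewrite IHa.
Qed.

Definition modes (l : seq (Y * k)) : seq Z := [seq Some p | p <- l].

Lemma central_coef_swap u x m y n v :
  central_coef (modes u ++ Some (x, m) :: Some (y, n) :: modes v) =
  central_coef (modes u ++ Some (y, n) :: Some (x, m) :: modes v) +
  lin (br x y) (fun a => central_coef (modes u ++ Some (a, m + n) :: modes v)) +
  (if (m + n == 0) && (size u + size v == 0)%N then m * form x y else 0).
Proof.
rewrite central_coefS lin_affine_br -addrA; congr (_ + (_ + _)).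
case: eqP => //= _; have [/eqP|nz] := eqVneq (size u + size v)%N 0%N.
  rewrite addn_eq0 !size_eq0 => /andP[/eqP-> /eqP->].
  by rewrite central_coef_sorted //= /GRing.scale /= mulr1.
rewrite central_coef_None ?scaler0 ?mem_cat ?inE ?orbT //.
by move: nz; rewrite size_cat /= !size_map; lia.
Qed.

(** Letters with the same x may be out of order for R only. Exchanging them costs no bracket, and
    the central term of a two-letter word is absorbed by the half: n/2 + m = m/2 when n = -m. So the
    choice of R does not matter. *)
Lemma central_coef_sorted1 l : sorted <=%O (unzip1 l) ->
  central_coef (modes l) = central_coef0 (modes l).
Proof.
have le_tot : total (lexrel R : rel (Y * k)) by apply: lexrel_total.
elim/(straightening_ind le_tot): l => [l srt _|u [x m] [y n] v nxy IH _].
  rewrite central_coef_sorted //; move: srt; case: l => //= p l.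
  by elim: l p => //= q l IHl p /andP[-> /IHl].
rewrite /unzip1 map_cat /= => srt.
have exy : x = y.
  have : (x <= y)%O.
    move: srt; rewrite sorted_pairwise; last exact: le_trans.
    by rewrite pairwise_cat /= => /and3P[_ _ /andP[/andP[->]]].
  move: nxy; rewrite /lexrel /= negb_or => /andP[]; rewrite -leNgt => yx _ xy.
  by apply/eqP; rewrite eq_le xy yx.
subst y; rewrite /modes map_cat /= -!/(modes _) central_coef_swap br_alt addr0.
move: IH; rewrite /unzip1 map_cat /= => /(_ srt); rewrite /modes map_cat /= -!/(modes _) => ->.
have [/eqP|nz] := eqVneq (size u + size v)%N 0%N.
  rewrite addn_eq0 !size_eq0 => /andP[/eqP-> /eqP->]; rewrite /= eqxx /= andbT [n + m]addrC.
  case: eqP => [e|_]; last by rewrite addr0.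
  have -> : n = - m by apply/eqP; rewrite -addr_eq0 addrC; apply/eqP.
  by field; exact: (natf_neq0S char0 1).
rewrite andbF addr0.
have z s : (2 < size s)%N -> central_coef0 s = 0 by case: s => [|[[? ?]|] [|[[? ?]|] []]].
by rewrite !z //; rewrite size_cat /= !size_map; move: nz; rewrite -lt0n !addnS !ltnS.
Qed.

Let pick1 (l : seq (Y * (k * k))) : seq (Y * k) := [seq (p.1, p.2.1) | p <- l].
Let pick2 (l : seq (Y * (k * k))) : seq (Y * k) := [seq (p.1, p.2.2) | p <- l].
Let combine a (l : seq (Y * (k * k))) : seq (Y * k) :=
  [seq (p.1, a * p.2.1 + p.2.2) | p <- l].

(** Straightening by the letters of Y alone treats the three exponent vectors in parallel, and
    brackets add exponents. The delta matters only for two-letter words, where the sum conditions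
    make it 1 for all three. *)
Lemma central_coef_linear a (l : seq (Y * (k * k))) :
  \sum_(p <- l) p.2.1 = 0 -> \sum_(p <- l) p.2.2 = 0 ->
  central_coef (modes [seq (p.1, a * p.2.1 + p.2.2) | p <- l]) =
  a * central_coef (modes [seq (p.1, p.2.1) | p <- l]) +
  central_coef (modes [seq (p.1, p.2.2) | p <- l]).
Proof.
pose le1 : rel (Y * (k * k)) := fun p q => (p.1 <= q.1)%O.
have le1_total : total le1 by move=> p q; apply: le_total.
rewrite -/(pick1 l) -/(pick2 l) -/(combine a l).
elim/(straightening_ind le1_total): l => [l srt s1 s2|u [x [m m']] [y [n n']] v nxy IH IHa s1 s2].
  have srt1 (h : Y * (k * k) -> k) : sorted <=%O (unzip1 [seq (p.1, h p) | p <- l]).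
    rewrite /unzip1 -map_comp sorted_map.
    by move: srt; apply: sub_sorted.
  rewrite !central_coef_sorted1 /pick1 /pick2 /combine ?srt1 // {srt srt1}.
  case: l s1 s2 => [|[x [m m']] [|[y [n n']] [|p l]]] /=; rewrite ?mulr0 ?addr0 //.
  rewrite !big_cons !big_nil !addr0 /= => e e'; rewrite e e' eqxx andbT.
  rewrite (_ : a * m + m' + (a * n + n') = 0); last first.
    by rewrite addrACA e' addr0 -mulrDr e mulr0.
  rewrite eqxx andbT; case: ifP => _; last by rewrite mulr0 addr0.
  by field; exact: (natf_neq0S char0 1).
have catE (h : Y * (k * k) -> k) (w w' : seq (Y * (k * k))) :
    [seq (p.1, h p) | p <- w ++ w'] = [seq (p.1, h p) | p <- w] ++ [seq (p.1, h p) | p <- w'].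
  exact: map_cat.
have {IH}IH := IH _ _; have {}IHa z := IHa (z, (m + n, m' + n')).
have sE (h : Y * (k * k) -> k) q q' r : h q + h q' = h r ->
    \sum_(p <- u ++ q :: q' :: v) h p = \sum_(p <- u ++ r :: v) h p.
  by move=> e; rewrite !big_cat !big_cons /= -e; congr (_ + _); rewrite addrA.
have sS (h : Y * (k * k) -> k) q q' :
    \sum_(p <- u ++ q' :: q :: v) h p = \sum_(p <- u ++ q :: q' :: v) h p.
  by rewrite !big_cat !big_cons /=; congr (_ + _); rewrite addrCA.
have {}IH := IH (etrans (sS (fun p => p.2.1) _ _) s1) (etrans (sS (fun p => p.2.2) _ _) s2).
have {IHa}IHa z : central_coef (modes (combine a (u ++ (z, (m + n, m' + n')) :: v))) =
    a * central_coef (modes (pick1 (u ++ (z, (m + n, m' + n')) :: v))) +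
    central_coef (modes (pick2 (u ++ (z, (m + n, m' + n')) :: v))).
  apply: IHa; first by rewrite -(sE (fun p => p.2.1) (x, (m, m')) (y, (n, n'))).
  by rewrite -(sE (fun p => p.2.2) (x, (m, m')) (y, (n, n'))).
move: IH; rewrite /combine /pick1 /pick2 !catE /modes !map_cat /= -!/(modes _).
rewrite !(central_coef_swap _ x _ y) => ->.
have L : lin (br x y) (fun z => central_coef (modes (combine a u) ++
      Some (z, a * m + m' + (a * n + n')) :: modes (combine a v))) =
    a * lin (br x y) (fun z => central_coef (modes (pick1 u) ++ Some (z, m + n) :: modes (pick1 v)))
    + lin (br x y) (fun z => central_coef (modes (pick2 u) ++ Some (z, m' + n') :: modes (pick2 v))).
  have linZ (F : Y -> k^o) : a * lin (br x y) F = lin (br x y) (fun z => a * F z : k^o).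
    by rewrite /lin mulr_sumr; apply: eq_bigr => p _; rewrite /GRing.scale /=; ring.
  rewrite linZ.
  apply: etrans (linD _ _ _); apply: eq_lin => z; have := IHa z.
  rewrite /combine /pick1 /pick2 !catE /modes !map_cat /= -!/(modes _).
  by rewrite (_ : a * (m + n) + (m' + n') = a * m + m' + (a * n + n')); last by ring.
rewrite L !size_map.
have [/eqP|nz] := eqVneq (size u + size v)%N 0%N; last by rewrite !andbF; ring.
rewrite addn_eq0 !size_eq0 => /andP[/eqP eu /eqP ev].
move: s1 s2; rewrite eu ev !big_cons !big_nil !addr0 /= => e e'; rewrite e e' eqxx /=.
rewrite (_ : a * m + m' + (a * n + n') = 0) ?eqxx; last by rewrite addrACA e' addr0 -mulrDr e mulr0.
by rewrite /=; ring.
Qed.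

End Affine.

(** * The functional that detects e *)

Section CentralElement.
Variables (k : fieldType) (char0 : [pchar k] =i pred0).
Variables (disp : Order.disp_t) (Y : orderType disp).
Variables (br : Y -> Y -> seq (k * Y)) (form : Y -> Y -> k).
Hypothesis br_lie : lie_constants br k^o.
Hypothesis form_sym : forall x y, form x y = form y x.
Hypothesis form_cyclic : forall x y w,
  lin (br x y) (fun z => form z w : k^o) = lin (br y w) (fun z => form z x : k^o).
Variable R : rel k.
Hypotheses (R_total : total R) (R_trans : transitive R) (R_anti : antisymmetric R).
Variables (P : algType k) (W : seq (option (Y * bool)) -> P)
  (ext : (seq (option (Y * bool)) -> k^o) -> {linear P -> k^o}).
Hypothesis free_P : is_free_algebra W ext.
Local Notation WM := (free_wordM free_P).
Local Notation W_nil := (free_word_nil free_P).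
Local Notation ext_word := (free_ext_word free_P).
Local Notation word_ind := (free_word_ind free_P).

Local Notation coef := (central_coef br form R).
Local Notation coef_linear := (central_coef_linear char0 br_lie form_sym form_cyclic R_total R_trans R_anti).

Definition ind_modes (t : seq (Y * bool)) : seq (Y * k) := [seq (p.1, (nat_of_bool p.2)%:R) | p <- t].

(* The first-order part of a momentum word: exponents m_i with sum 0 are the combination
   of the delta_i - delta_0 with coefficients m_i, and central_coef is linear in them. *)
Definition derivative_coef (t : seq (Y * bool)) : k^o :=
  if count snd t != 1%N then 0 else
  if t is (x, c) :: t' then - coef (modes ((x, (nat_of_bool c)%:R - 1) :: ind_modes t')) else 0.

(** Among words that contain e only e itself counts, as for the affine coefficient; the others get
    the first-order part. *)
Definition central_functional (s : seq (option (Y * bool))) : k^o :=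
  if s == [:: None] then 1 else
  if None \in s then 0 else derivative_coef (pmap id s).

Let psi : {linear P -> k^o} := ext central_functional.

(** The generator e goes to a constant of the current algebra, so its c-letter is 0. *)
Definition letter_of c (x : option Y) : P :=
  if x is Some y then W [:: Some (y, c)] else if c then 0 else W [:: None].

Local Notation mom := (momentum_word (letter_of false) (letter_of true)).

Definition mode_of (p : option Y * k) : option (Y * k) :=
  if p.1 is Some x then Some (x, p.2) else None.

Definition somes (l : seq (Y * k)) : seq (option Y * k) := [seq (Some p.1, p.2) | p <- l].

Lemma mom_cat l l' : mom (l ++ l') = mom l * mom l'.
Proof. by rewrite /momentum_word big_cat. Qed.
Lemma mom_cons p l : mom (p :: l) = (letter_of false p.1 - p.2 *: letter_of true p.1) * mom l.
Proof. by rewrite /momentum_word big_cons. Qed.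
Lemma mom_nil : mom [::] = 1.
Proof. by rewrite /momentum_word big_nil. Qed.

Definition falses (l : seq (Y * k)) : seq (Y * bool) := [seq (p.1, false) | p <- l].

(** The first-order part, up to sign, of the product of the p_x - m c_x: the words with a single
    c-letter, each with the parameter of that letter. *)
Fixpoint one_true (l : seq (Y * k)) : seq (seq (Y * bool) * k) :=
  if l is (x, m) :: l' then
    ((x, true) :: falses l', m) :: [seq ((x, false) :: q.1, q.2) | q <- one_true l']
  else [::].

Lemma mom_expand0 (phi : P -> k^o) l : linear phi ->
  (forall t, count snd t != 0%N -> phi (W [seq Some p | p <- t]) = 0) ->
  phi (mom (somes l)) = phi (W [seq Some p | p <- falses l]).
Proof.
elim: l phi => [|[x m] l IH] phi L h; first by rewrite mom_nil W_nil.
rewrite /= mom_cons mulrBl -scalerAl /= addrC -scaleNr L.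
rewrite (IH (fun p => phi (W [:: Some (x, true)] * p))); first last.
- by move=> t _; rewrite WM; apply: (h ((x, true) :: t)).
- by move=> a p q; rewrite mulrDr -scalerAr L.
rewrite WM (h ((x, true) :: falses l)) // scaler0 add0r.
rewrite (IH (fun p => phi (W [:: Some (x, false)] * p))) ?WM //.
- by move=> a p q; rewrite mulrDr -scalerAr L.
- by move=> t ht; rewrite WM; apply: (h ((x, false) :: t)).
Qed.

Lemma mom_expand1 (phi : P -> k^o) l : linear phi ->
  (forall t, count snd t != 1%N -> phi (W [seq Some p | p <- t]) = 0) ->
  phi (mom (somes l)) = - \sum_(q <- one_true l) q.2 *: phi (W [seq Some p | p <- q.1]).
Proof.
elim: l phi => [|[x m] l IH] phi L h; first by rewrite mom_nil -W_nil (h [::]) // big_nil oppr0.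
rewrite /= mom_cons mulrBl -scalerAl /= addrC -scaleNr L big_cons opprD scaleNr.
rewrite (mom_expand0 (phi := fun p => phi (W [:: Some (x, true)] * p))); first last.
- by move=> t ht; rewrite WM; apply: (h ((x, true) :: t)); rewrite /= add1n eqSS.
- by move=> a p q; rewrite mulrDr -scalerAr L.
rewrite WM; congr (_ + _).
rewrite (IH (fun p => phi (W [:: Some (x, false)] * p))); first last.
- by move=> t ht; rewrite WM; apply: (h ((x, false) :: t)).
- by move=> a p q; rewrite mulrDr -scalerAr L.
by rewrite big_map; congr (- _); apply: eq_bigr => q _; rewrite WM.
Qed.

Lemma psi_somes t : psi (W [seq Some p | p <- t]) = derivative_coef t.
Proof.
rewrite ext_word /central_functional.
have -> : ([seq Some p | p <- t] == [:: None]) = false by case: t => [|? [|? ?]].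
have -> : (None \in [seq Some p | p <- t]) = false by elim: t => // p t IH; rewrite inE.
by congr (derivative_coef _); elim: t => //= p t ->.
Qed.

Definition zeros (s : seq Y) : seq (Y * k) := [seq (y, 0) | y <- s].

(** Linearity in the exponents, applied to zero exponents. *)
Lemma coef_zeros s : coef (modes (zeros s)) = 0.
Proof.
have z l (h : Y * (k * k) -> k) : (forall p, p \in l -> h p = 0) -> \sum_(p <- l) h p = 0.
  by move=> e; rewrite big_seq big1.
have /= := @coef_linear 1 [seq (y, (0, 0)) | y <- s].
rewrite !z; try by move=> p /mapP[y _ ->].
move=> /(_ erefl erefl); rewrite -!map_comp mul1r.
have E (h : Y -> Y * k) : h =1 (fun y => (y, 0)) -> [seq h y | y <- s] = zeros s by move/eq_map=> ->.
rewrite !E => [|y|y] //=; last by rewrite mulr0 addr0.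
by move/eqP; rewrite -subr_eq0 opprD addrA subrr sub0r oppr_eq0 => /eqP.
Qed.

Lemma ind_falses l : ind_modes (falses l) = zeros (unzip1 l).
Proof. by rewrite /ind_modes /falses /zeros -!map_comp; apply: eq_map. Qed.

(** One vector m_y (delta_y - delta_0) is split off at a time by [central_coef_linear]; [s] holds
    the letters already split off, whose remaining exponent is 0. *)
Lemma coef_one_true x0 (s : seq Y) l :
  coef (modes ((x0, - \sum_(p <- l) p.2) :: zeros s ++ l)) =
  \sum_(q <- one_true l) q.2 * coef (modes ((x0, -1) :: zeros s ++ ind_modes q.1)).
Proof.
elim: l s => [|[y m] l IH] s.
  by rewrite !big_nil oppr0 cats0 -[_ :: _]/(zeros (x0 :: s)) coef_zeros.
rewrite big_cons [one_true _]/= big_cons big_map /=.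
(* The two exponent vectors: delta_y - delta_0, to be scaled by m, and the remaining exponents with
   their opposite sum at [x0]. *)
pose L : seq (Y * (k * k)) := (x0, (-1, - \sum_(p <- l) p.2)) ::
  [seq (z, (0, 0)) | z <- s] ++ (y, (1, 0)) :: [seq (p.1, (0, p.2)) | p <- l].
have z (T : Type) (r : seq T) : \sum_(p <- r) (0 : k) = 0 by rewrite big1.
have maps (h : Y * (k * k) -> Y * k) (l1 : seq (Y * k)) : (forall u, h (u, (0, 0)) = (u, 0)) ->
    [seq h (p.1, (0, p.2)) | p <- l] = l1 ->
    map h L = h (x0, (-1, - \sum_(p <- l) p.2)) :: zeros s ++ h (y, (1, 0)) :: l1.
  move=> hz <-; rewrite /L /= map_cat /= -!map_comp; congr (_ :: _ ++ _).
  by apply: eq_map => u; apply: hz.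
have s1 : \sum_(p <- L) p.2.1 = 0.
  by rewrite /L big_cons big_cat big_cons !big_map /= !z add0r addr0 addNr.
have s2 : \sum_(p <- L) p.2.2 = 0.
  by rewrite /L big_cons big_cat big_cons !big_map /= z !add0r addNr.
clearbody L; have := @coef_linear m L s1 s2.
rewrite (maps (fun p => (p.1, m * p.2.1 + p.2.2)) l) /= => [|u|]; first last.
- by rewrite -[RHS]map_id; apply: eq_map => -[u c]; rewrite /= mulr0 add0r.
- by rewrite mulr0 addr0.
rewrite (maps (fun p => (p.1, p.2.1)) (zeros (unzip1 l))) //=; last by rewrite /zeros -map_comp.
rewrite (maps (fun p => (p.1, p.2.2)) l) //=; last first.
  by rewrite -[RHS]map_id; apply: eq_map => -[].
rewrite mulr1 addr0 mulrN1 -opprD => ->.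
congr (_ * _ + _); first by rewrite ind_falses.
have := IH (rcons s y); rewrite /zeros map_rcons -!cats1 -!catA /= => ->.
by apply: eq_bigr => q _; rewrite -catA.
Qed.

Lemma count_one_true l q : q \in one_true l -> count snd q.1 = 1%N.
Proof.
elim: l q => [|[x m] l IH] q //=; rewrite inE => /orP[/eqP->|/mapP[q' /IH e ->]] //=.
by rewrite add1n; congr _.+1; rewrite /falses; elim: (l).
Qed.

(** Balance makes the affine coefficient linear in the exponents, so nothing is lost in keeping the
    first-order part. *)
Lemma psi_mom_somes l : \sum_(p <- l) p.2 = 0 -> psi (mom (somes l)) = coef (modes l).
Proof.
move=> s0; rewrite (mom_expand1 _ (linearP psi)) => [|t ht]; last first.
  by rewrite psi_somes /derivative_coef ht.
case: l s0 => [_|[x0 m0] l]; first by rewrite big_nil oppr0 -[LHS]/0 -(coef_zeros [::]).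
rewrite big_cons /= => /eqP; rewrite addr_eq0 => /eqP->.
have := coef_one_true x0 [::] l; rewrite /= => ->.
rewrite big_cons psi_somes /derivative_coef /= subrr ind_falses.
have -> : count snd (falses l) = 0%N by rewrite /falses; elim: (l).
(* The word whose c-letter comes first has exponent 1 - 1 = 0 there and 0 elsewhere, so it
   contributes nothing. *)
have /= -> := coef_zeros (x0 :: unzip1 l); rewrite oppr0 scaler0 add0r big_map -sumrN.
apply: eq_big_seq => q ql; rewrite (psi_somes ((x0, false) :: q.1)) /derivative_coef /= (count_one_true ql) /=.
by rewrite sub0r /GRing.scale /= mulrN opprK.
Qed.

Lemma central_killed_word s : None \in s -> (1 < size s)%N -> context_kernel psi (W s).
Proof.
move=> Ns sz; apply: (context_kernel_words free_P) => u v.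
rewrite !WM ext_word /central_functional.
have -> : ((u ++ s) ++ v == [:: None]) = false.
  by apply/negP => /eqP /(congr1 size); rewrite !size_cat /= => e; move: sz e; case: (size s) => [|[|n]] // _; rewrite !addnS !addSn.
by rewrite !mem_cat Ns orbT.
Qed.

Lemma central_killed_letter c x :
  context_kernel psi (letter_of c x * W [:: None]) /\ context_kernel psi (W [:: None] * letter_of c x).
Proof.
case: x => [x|] /=; first by rewrite !WM; split; apply: central_killed_word.
case: c; first by rewrite mul0r mulr0; split; apply: context_kernel0.
by rewrite !WM; split; apply: central_killed_word.
Qed.

Lemma psi_mom_None l l' :
  psi (mom l * W [:: None] * mom l') =
  coef ([seq mode_of p | p <- l] ++ None :: [seq mode_of p | p <- l']).
Proof.
have z : (0 < size l + size l')%N ->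
    coef ([seq mode_of p | p <- l] ++ None :: [seq mode_of p | p <- l']) = 0.
  move=> h; apply: (central_coef_None char0) => //; first by rewrite mem_cat inE eqxx orbT.
  by rewrite size_cat /= !size_map addnS ltnS.
case: l' z => [|[x m] l'] z; last first.
  rewrite z ?addnS // mom_cons mulrA -(mulrA (mom l)) mulrBr -scalerAr addrC -scaleNr.
  apply: context_kernelP; exact: (central_killed_letter _ _).2.
case/lastP: l z => [|l [x m]] z; last first.
  rewrite z ?size_rcons // -cats1 mom_cat mom_cons mom_nil !mulr1 -mulrA mulrBl -scalerAl.
  rewrite addrC -scaleNr -[_ * _]mulr1.
  apply: context_kernelP; exact: (central_killed_letter _ _).1.
by rewrite mom_nil mul1r mulr1 ext_word /central_functional eqxx central_coef_sorted.
Qed.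

Lemma psi_mom l : momentum l = 0 -> psi (mom l) = coef [seq mode_of p | p <- l].
Proof.
move=> s0; have [Nl|Nl] := boolP (None \in unzip1 l).
  have [[x m] /= pl /esym ex] := mapP Nl; subst x.
  have [l1 l2] := splitPr pl.
  by rewrite mom_cat mom_cons /= scaler0 subr0 mulrA psi_mom_None map_cat.
have [l1 el] : exists l1, l = somes l1.
  elim: l Nl {s0} => [|[[x|] m] l IH]; first by exists [::].
    by rewrite inE /= => /IH[l1 ->]; exists ((x, m) :: l1).
  by rewrite inE.
move: s0; rewrite el /momentum big_map /= => /psi_mom_somes ->.
by rewrite /modes /somes -map_comp; congr (coef _); apply: eq_map => -[].
Qed.

Let A := letter_of false.
Let B := letter_of true.

(** With mu = -(nu + lam) the two factors stand for x t^lam and y t^mu, and the bracket letters for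
    exponent -nu: this is the affine bracket inside a balanced context. *)
Lemma psi_commutator x y nu lam l l' : momentum l + momentum l' = nu ->
  psi (mom l * ((A (Some x) - lam *: B (Some x)) * (A (Some y) + (nu + lam) *: B (Some y)) -
    (A (Some y) + (nu + lam) *: B (Some y)) * (A (Some x) - lam *: B (Some x)) -
    lin (br x y) (fun a => A (Some a) + nu *: B (Some a)) -
    (lam * form x y) *: W [:: None]) * mom l') = 0.
Proof.
move=> e; pose mu := - (nu + lam).
have m2 (p q : option Y * k) : p.2 + q.2 = - nu ->
    psi (mom l * ((A p.1 - p.2 *: B p.1) * (A q.1 - q.2 *: B q.1)) * mom l') =
    coef ([seq mode_of r | r <- l] ++ mode_of p :: mode_of q :: [seq mode_of r | r <- l']).
  move=> epq; rewrite -!mulrA -!mom_cons -mom_cat psi_mom ?map_cat //.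
  rewrite /momentum big_cat !big_cons /= -!/(momentum _).
  by rewrite [p.2 + _]addrA epq addrCA e addNr.
have m1 (a : Y) : psi (mom l * (A (Some a) + nu *: B (Some a)) * mom l') =
    coef ([seq mode_of r | r <- l] ++ Some (a, - nu) :: [seq mode_of r | r <- l']).
  have -> : A (Some a) + nu *: B (Some a) = A (Some a, - nu).1 - (Some a, - nu).2 *: B (Some a, - nu).1.
    by rewrite /= scaleNr opprK.
  rewrite -!mulrA -!mom_cons -mom_cat psi_mom ?map_cat //.
  by rewrite /momentum big_cat !big_cons /= -!/(momentum _) addrCA e addNr.
have Ay : A (Some y) + (nu + lam) *: B (Some y) = A (Some y, mu).1 - (Some y, mu).2 *: B (Some y, mu).1.
  by rewrite /= /mu scaleNr opprK.
have emu : lam + mu = - nu by rewrite /mu; ring.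
have Hx := m2 (Some x, lam) (Some y, mu) emu.
have Hy := m2 (Some y, mu) (Some x, lam) (etrans (addrC _ _) emu).
have lB p q : psi (mom l * (p - q) * mom l') = psi (mom l * p * mom l') - psi (mom l * q * mom l').
  by rewrite mulrBr mulrBl linearB.
rewrite /= in Hx Hy Ay; rewrite !lB Ay Hx Hy -scalerAr -scalerAl linearZ /= psi_mom_None.
rewrite (central_coefS char0 br_lie form_sym form_cyclic R_total R_trans R_anti).
rewrite lin_affine_br emu.
have -> : psi (mom l * lin (br x y) (fun a => A (Some a) + nu *: B (Some a)) * mom l') =
    lin (br x y) (fun a => coef ([seq mode_of r | r <- l] ++ Some (a, - nu) :: [seq mode_of r | r <- l'])).
  rewrite /lin mulr_sumr mulr_suml linear_sum; apply: eq_bigr => p _ /=.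
  by rewrite -scalerAr -scalerAl linearZ /= m1.
have -> : (if - nu == 0 then (lam * form x y) *: (coef ([seq mode_of r | r <- l] ++ None :: [seq mode_of r | r <- l']) : k^o) else 0)
    = (lam * form x y) *: (coef ([seq mode_of r | r <- l] ++ None :: [seq mode_of r | r <- l']) : k^o).
  case: eqP => // nu0; rewrite (central_coef_None char0) ?scaler0 //.
    by rewrite mem_cat inE eqxx orbT.
  rewrite size_cat /= !size_map addnS ltnS lt0n addn_eq0 !size_eq0.
  by apply/negP => /andP[/eqP l0 /eqP l0']; apply: nu0; rewrite -e l0 l0' /momentum !big_nil addr0 oppr0.
rewrite [X in X - _ - _ - _]addrC addrK [X in X - _ - _]addrC addrK; exact: subrr.
Qed.

End CentralElement.

Section CentralIdeal.
Variables (k : fieldType) (char0 : [pchar k] =i pred0).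
Variables (g : lieAlgType k) (form : {biscalar g}).
Hypotheses (form_sym : forall u v, form u v = form v u)
  (form_inv : forall u v w, form (lie u v) w = form u (lie v w)).
Variables (disp : Order.disp_t) (Y : orderType disp) (b : Y -> g).
Hypothesis b_basis : is_linear_basis setT b.
Variable R : rel k.
Hypotheses (R_total : total R) (R_trans : transitive R) (R_anti : antisymmetric R).
Variables (P : algType k) (W : seq (option (Y * bool)) -> P)
  (ext : (seq (option (Y * bool)) -> k^o) -> {linear P -> k^o}).
Hypothesis free_P : is_free_algebra W ext.
Variables (F : assocConfAlgType k) (i : option Y -> F) (f : F -> cur P).
Hypotheses (generate : conf_generates i) (fm : conf_morphism f).

Let A := letter_of W false.
Let B := letter_of W true.
Hypothesis fi : forall x, f (i x) = cgen (A x) (B x).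

Local Notation br := (structure_const b_basis).
Local Notation E := (W [:: None]).
Let frm x y : k := form (b x) (b y).
Let psi : {linear P -> k^o} := ext (central_functional br frm R).
Let mom l := momentum_word A B l.

Let br_lie := structure_lie b_basis k^o.
Let frm_sym x y : frm x y = frm y x.
Proof. exact: form_sym. Qed.
Let frm_cyclic x y w :
  lin (br x y) (fun z => frm z w : k^o) = lin (br y w) (fun z => frm z x : k^o).
Proof. exact: structure_form_cyclic. Qed.

Let annih : set (cur P) := annihilated A B psi (fun s => s = 0).
Let annih_submodule : conf_submodule annih.
Proof. exact: annihilated_submodule. Qed.

Lemma quadratic_coefs (c0 c1 c2 : k) :
  (forall t, c0 + t * c1 + t ^+ 2 * c2 = 0) -> [/\ c0 = 0, c1 = 0 & c2 = 0].
Proof.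
move=> h; have := h 0; rewrite expr0n !mul0r !addr0 => e0.
have k2 : (2%:R : k) != 0 := natf_neq0S char0 1.
have e2 : c2 = 0.
  apply: (mulfI k2); rewrite mulr0.
  by transitivity ((c0 + 1 * c1 + 1 ^+ 2 * c2) + (c0 + -1 * c1 + (-1) ^+ 2 * c2));
    [rewrite e0; ring|rewrite !h addr0].
by split=> //; have := h 1; rewrite e0 e2 mulr0 add0r mul1r addr0.
Qed.

Section Brackets.
Variables (x y : Y) (nu : k) (l l' : seq (option Y * k)).
Hypothesis nuE : momentum l + momentum l' = nu.
Let D p := psi (mom l * p * mom l').
Let Ax := A (Some x). Let Bx := B (Some x). Let Ay := A (Some y). Let By := B (Some y).

(** The identity [psi_commutator] is quadratic in lam. Its coefficients are, up to scalars, the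
    brackets with n = 0, 1, 2 of two generators at d = nu, minus the values prescribed by the
    relations. *)
Lemma commutator_coefs :
  [/\ D (Ax * Ay - Ay * Ax + nu *: (Ax * By - By * Ax) -
         lin (br x y) (fun a => A (Some a) + nu *: B (Some a))) = 0,
      D (Ax * By - By * Ax - (Bx * Ay - Ay * Bx) - nu *: (Bx * By - By * Bx) -
         frm x y *: E) = 0
    & D (Bx * By - By * Bx) = 0].
Proof.
set g0 := _ - lin _ _; set g1 := _ - frm x y *: E; set g2 := Bx * By - _.
have DP a p q : D (a *: p + q) = a * D p + D q.
  by rewrite /D mulrDr mulrDl -scalerAr -scalerAl linearP.
have [t|e0 e1 e2] := @quadratic_coefs (D g0) (D g1) (D (- g2)).
  have := psi_commutator char0 br_lie frm_sym frm_cyclic R_total R_trans R_anti free_P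
    x y t nuE.
  move=> e; rewrite -[RHS]e.
  have -> : D g0 + t * D g1 + t ^+ 2 * D (- g2) = D (t ^+ 2 *: (- g2) + (t *: g1 + g0)).
    by rewrite !DP; ring.
  rewrite /D; congr (psi (_ * _ * _)).
  rewrite -/(frm x y) -/A -/B.
  transitivity (( (Ax - t *: Bx) * (Ay + (nu + t) *: By) - (Ay + (nu + t) *: By) * (Ax - t *: Bx) -
     lin (br x y) (fun a => A (Some a) + nu *: B (Some a))) - (t * frm x y) *: E); last by [].
  rewrite /g0 /g1 /g2 !(mulrBl, mulrBr, mulrDl, mulrDr, =^~ scalerAl, =^~ scalerAr).
  pose m (p q : P) : P := p * q; rewrite -!/(m _ _).
  by linear_combination_in k P; ring.
by split=> //; rewrite -[g2]opprK -scaleN1r -[_ *: _]addr0 DP e2 mulr0 add0r /D mulr0 mul0r linear0.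
Qed.

End Brackets.

Let annihD := conf_submoduleD annih_submodule.
Let annihN := conf_submoduleN annih_submodule.

Let annih_cst p : context_kernel psi p -> annih (cst p).
Proof. by move=> kp l l' s0 _; rewrite ev_cst; apply: kp. Qed.

Let E_gen : cgen E 0 = cst E.
Proof. by rewrite /cgen !linear0 addr0. Qed.

Lemma killed_commutator c x :
  context_kernel psi (letter_of W c x * E - E * letter_of W c x).
Proof.
have [k1 k2] := central_killed_letter br frm R free_P c x.
exact: context_kernelB.
Qed.

Lemma annih_bracket_xe x n : annih (nbracket n (cgen (A x) (B x)) (cst E)).
Proof.
have [J0 JL JD] := annih_submodule.
have k2 : (2%:R : k) != 0 := natf_neq0S char0 1.
rewrite -E_gen; case: n => [|[|[|n]]].
- rewrite nbracket_cgen0 // mulr0 mul0r subrr linear0 addr0 -linearB.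
  exact/annih_cst/killed_commutator.
- rewrite nbracket_cgen1 !mulr0 !mul0r linear0 !subrr linear0 subr0 sub0r -linearB.
  exact/annihN/annih_cst/killed_commutator.
- by rewrite nbracket_cgen2 !mulr0 mul0r linear0 subrr scaler0 oppr0.
- by rewrite nbracket_cgen_ge3.
Qed.

Lemma annih_bracket_ex x n : annih (nbracket n (cst E) (cgen (A x) (B x))).
Proof.
have [J0 JL JD] := annih_submodule.
have k2 : (2%:R : k) != 0 := natf_neq0S char0 1.
have annihK c y : annih (cst (E * letter_of W c y) - cst (letter_of W c y * E)).
  by rewrite -opprB; apply/annihN; rewrite -linearB; apply/annih_cst/killed_commutator.
rewrite -E_gen; case: n => [|[|[|n]]].
- by rewrite nbracket_cgen0 //; apply: annihD; [|apply: JD]; apply: annihK.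
- rewrite nbracket_cgen1 !mulr0 !mul0r linear0 !subrr subr0 der0 subr0; exact: annihK.
- by rewrite nbracket_cgen2 mulr0 mul0r linear0 subrr scaler0 oppr0.
- by rewrite nbracket_cgen_ge3.
Qed.

Lemma Kac_annihilated_central r :
  Kac_relation (fun u v => form u v) b i r -> annih (f r).
Proof.
have [J0 JL JD] := annih_submodule.
have [f0 fD fN fZ] := conf_morphism_linear fm; have [_ fder _] := fm.
have fe : f (i None) = cst E by rewrite fi E_gen.
have k2 : (2%:R : k) != 0 := natf_neq0S char0 1.
case=> {r}.
- rewrite fder fe => l l' s0 ->; rewrite ev_der ev_cst add0r -scalerAr -scalerAl linearZ /=.
  (* d e evaluates to nu times e. If nu is not 0, the context is not empty and the coefficient of e
     vanishes. *)
  have [->|nz] := eqVneq (momentum l + momentum l') 0; first by rewrite scale0r.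
  rewrite (psi_mom_None char0) // (central_coef_None char0) ?scaler0 //.
    by rewrite mem_cat inE eqxx orbT.
  rewrite size_cat /= !size_map addnS ltnS lt0n addn_eq0 !size_eq0.
  by apply: contraNN nz => /andP[/eqP-> /eqP->]; rewrite /momentum !big_nil addr0.
- move=> x y s c exy; rewrite fD fN (conf_morphism_sum _ _ _ fm) => l l' s0 ->; rewrite add0r.
  set nu := _ + _; have [e0 _ _] := commutator_coefs x y (erefl nu).
  rewrite (conf_morphism_nbracket _ _ _ fm) !fi nbracket_cgen0 // -[RHS]e0.
  congr (psi (_ * _ * _)); rewrite !(linearB, linearD) /= !ev_der !ev_cst ?scalerBr linear_sum.
  congr (_ - _); transitivity (lin (pair_seq s c) (fun a => A (Some a) + nu *: B (Some a))).
    rewrite lin_pair_seq; apply: eq_bigr => z _.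
    by rewrite fi linearZ /cgen linearD /= ev_der !ev_cst.
  by apply: (lin_basis_ext b_basis); rewrite lin_coord_seq lin_pair_seq.
- move=> x y; rewrite fD fN fZ fe (conf_morphism_nbracket _ _ _ fm) !fi => l l' s0 ->.
  rewrite add0r; set nu := _ + _; have [_ e1 _] := commutator_coefs x y (erefl nu).
  rewrite nbracket_cgen1 -[RHS]e1; congr (psi (_ * _ * _)).
  by rewrite !linearB !linearZ /= !ev_der ?linearB /= !ev_cst !(scalerDr, scalerN) ?scalerN.
- move=> x y n; rewrite leq_eqVlt => /orP[/eqP <-|n3]; rewrite (conf_morphism_nbracket _ _ _ fm) !fi.
    rewrite nbracket_cgen2 => l l' s0 ->; rewrite add0r; set nu := _ + _.
    have [_ _ e2] := commutator_coefs x y (erefl nu).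
    set w := - _; have -> : ev nu w = (- 2%:R) *: (B (Some x) * B (Some y) - B (Some y) * B (Some x)).
      by rewrite /w -scaleNr -linearB linearZ /= ev_cst.
    by rewrite -scalerAr -scalerAl linearZ /= e2 scaler0.
  by rewrite nbracket_cgen_ge3.
- by move=> x n; rewrite (conf_morphism_nbracket _ _ _ fm) fe fi; apply: annih_bracket_xe.
- by move=> x n; rewrite (conf_morphism_nbracket _ _ _ fm) fe fi; apply: annih_bracket_ex.
- move=> n; rewrite (conf_morphism_nbracket _ _ _ fm) fe.
  by have := annih_bracket_xe None n; rewrite /A /B /= E_gen.
Qed.

(** Empty contexts at nu = 0 are balanced, and there psi takes the value 1 on e. *)
Lemma central_not_in_ideal c :
  conf_ideal_gen (Kac_relation (fun u v => form u v) b i) (c *: i None) -> c = 0.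
Proof.
move=> ge; have := ideal_gen_annihilated char0 generate fm fi Kac_annihilated_central ge.
have [f0 fD fN fZ] := conf_morphism_linear fm.
move=> /(_ [::] [::] 0 erefl); rewrite fZ fi E_gen /momentum_word /momentum !big_nil mul1r mulr1 !addr0.
rewrite linearZ /= ev_cst linearZ /= (free_ext_word free_P) /central_functional eqxx.
by rewrite /GRing.scale /= mulr1.
Qed.

End CentralIdeal.

(** * Bases *)

Section CommutativeCurrent.
Variables (k : fieldType) (char0 : [pchar k] =i pred0) (P : comAlgType k).

(** The characteristic is a parameter of the type because commutativity of the current algebra is
    proved from it. *)
Definition com_cur of [pchar k] =i pred0 : Type := cur P.
HB.instance Definition _ := AssocConfAlg.copy (com_cur char0) (cur P).
HB.instance Definition _ :=
  AssocConfAlg_isCom.Build k (com_cur char0) (@cur_nbracket_eq0 k char0 P).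

End CommutativeCurrent.

Section Combinations.
Variables (k : fieldType) (V : lmodType k) (I : eqType) (Q : I -> Prop) (f : I -> V).

Definition combination (v : V) := exists2 u : seq (k * I),
  forall i, i \in unzip2 u -> Q i & v = lin u f.

Lemma combination0 : combination 0.
Proof. by exists [::]; rewrite /lin ?big_nil. Qed.

Lemma combinationP a u v : combination u -> combination v -> combination (a *: u + v).
Proof.
move=> [s sQ ->] [t tQ ->]; exists ([seq (a * p.1, p.2) | p <- s] ++ t).
  move=> i; rewrite /unzip2 map_cat -map_comp mem_cat => /orP[]; [exact: sQ|exact: tQ].
rewrite /lin big_cat big_map scaler_sumr; congr (_ + _).
by apply: eq_bigr => p _; rewrite scalerA.
Qed.

Lemma combination_gen i : Q i -> combination (f i).
Proof.
move=> Qi; exists [:: (1, i)]; last by rewrite /lin big_seq1 scale1r.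
by move=> i'; rewrite inE => /eqP->.
Qed.

Lemma combination_sum v : combination v -> exists (s : seq I) (c : I -> k),
  {in s, forall i, Q i} /\ v = \sum_(i <- s) c i *: f i.
Proof.
move=> [u uQ ->]; exists (undup (unzip2 u)), (fun i => \sum_(p <- u | p.2 == i) p.1); split.
  by move=> i; rewrite mem_undup; apply: uQ.
by apply: lin_collect; rewrite ?undup_uniq // => i; rewrite mem_undup.
Qed.

End Combinations.

Lemma spanned_combination (k : fieldType) (V : assocConfAlgType k) (disp : Order.disp_t)
    (Y : orderType disp) (j : Y -> V) (e : V) (I : eqType) (Q : I -> Prop) (f : I -> V) d v :
  combination Q f e -> (forall w, basic_word w -> combination Q f (word_val j w)) ->
  spanned j e d v -> combination Q f v.
Proof.
move=> ce cw; elim=> {v} [|a u v _ cu _ cv||w bw _].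
- exact: combination0.
- exact: combinationP.
- exact: ce.
- exact: cw.
Qed.

Lemma ComConf_basis (k : fieldType) (char0 : [pchar k] =i pred0) (d : Order.disp_t)
    (Y : orderType d) (C : comConfAlgType k) (i : Y -> C) :
  is_ComConf 3 i -> is_linear_basis (@basic_word d Y) (word_val i).
Proof.
move=> iC; have [[gen loc] _] := iC; split=> [s c us sB s0|v].
  have [f fm fi] := is_ComConf_lift (A := com_cur (symalg k Y) char0)
    (j := sgen (@pc k d Y)) iC (fun x y n => @nprod_cgen_ge3 k (symalg k Y) _ _ _ _ n).
  have [f0 _ _ _] := conf_morphism_linear fm.
  have efi : f \o i = sgen (@pc k d Y) by apply/funext.
  apply: (basic_sgen_free char0 (symalg_coefs k Y) us sB).
  move=> n X X'; have := congr1 f s0; rewrite f0 (conf_morphism_sum _ _ _ fm).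
  under eq_bigr => w _ do rewrite (conf_morphism_word_val _ _ fm) efi.
  by move=> e; rewrite [X in cf _ _ _ _ X]e linear0.
(* The commutative case of the spanning theorem: e = 0, zero structure constants and zero form. *)
have [x y|x y|x y|S Ssub _ Si u|D sp] := @basic_words_span k char0 C d Y i 0 (fun _ _ => [::]) (fun _ _ => 0) loc (der0 C)
  (fun x n => nprod0r n (i x)) _ _ _ _ v.
- by rewrite nbracket_eq0 /lin big_nil.
- by rewrite nbracket_eq0 scale0r.
- by rewrite nbracket_eq0.
- by rewrite (gen S).
apply: combination_sum; apply: spanned_combination sp; first exact: combination0.
by move=> w; apply: combination_gen.
Qed.

(** * The basis of U *)

Section Enveloping.
Variables (k : fieldType) (char0 : [pchar k] =i pred0).
Variables (g : lieAlgType k) (form : {biscalar g}).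
Hypotheses (form_sym : forall u v, form u v = form v u)
  (form_inv : forall u v w, form (lie u v) w = form u (lie v w)).
Variables (disp : Order.disp_t) (Y : orderType disp) (b : Y -> g).
Hypothesis b_basis : is_linear_basis setT b.
Variables (U : assocConfAlgType k) (j : option Y -> U).
Variables (F : assocConfAlgType k) (i : option Y -> F) (p : F -> U).
Local Notation relation := (Kac_relation (fun u v => form u v) b i).
Hypotheses (iF : is_Conf 3 i) (pU : is_conf_quotient relation p) (jE : forall x, j x = p (i x)).

Lemma quotient_relation r : relation r -> p r = 0.
Proof. by move=> rel_r; have [_ _ ker] := pU; apply/ker => S _; apply. Qed.

Lemma enveloping_spanned v : exists d, spanned (fun x => j (Some x)) (j None) d v.
Proof.
have [pm surj _] := pU; have [p0 pD pN pZ] := conf_morphism_linear pm.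
have [pL pder pM] := pm; have [[gen loc] _] := iF.
have rel0 r : relation r -> p r = 0 by exact: quotient_relation.
have der_e : der (j None) = 0.
  by rewrite jE -pder; apply: rel0; apply: Kac_rel_der_e.
have mul_e n u : j None *_(n) u = 0 := torsion_mul char0 der_e n u.
have e_mul x n : j (Some x) *_(n) j None = 0.
  have /rel0 := Kac_rel_xe (fun u v => form u v) b i x n.
  rewrite (conf_morphism_nbracket _ _ _ pm) -!jE /nbracket.
  by rewrite (@nprod_opE _ _ 0) ?big_ord0 ?subr0 // => m _; rewrite mul_e.
apply: (basic_words_span char0 (br := structure_const b_basis)
  (B := fun x y => form (b x) (b y))) => //.
- by move=> x y n n3; rewrite !jE -pM loc.
- move=> x y; have := rel0 _ (Kac_rel_lie0 (fun u v => form u v) i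
    (coordsP b_basis (lie (b x) (b y)))).
  rewrite pD pN (conf_morphism_nbracket _ _ _ pm) (conf_morphism_sum _ _ _ pm) -!jE.
  move/eqP; rewrite subr_eq0 => /eqP ->; rewrite /structure_const /coord_seq lin_pair_seq.
  by apply: eq_bigr => z _; rewrite jE.
- move=> x y; have := rel0 _ (Kac_rel_lie1 (fun u v => form u v) b i x y).
  rewrite pD pN pZ (conf_morphism_nbracket _ _ _ pm) -!jE.
  by move/eqP; rewrite subr_eq0 => /eqP.
- move=> x y; have := rel0 _ (Kac_rel_lie2 (fun u v => form u v) b i x y (leqnn 2)).
  by rewrite (conf_morphism_nbracket _ _ _ pm) -!jE.
move=> S [[S0 SL SD] SM] Se Sj u; have [w <-] := surj u.
(* Generation is known for the free algebra, so it is applied to the preimage of S under the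
   quotient map. *)
have Spre : conf_subalgebra [set w | S (p w)]%classic.
  split; first split; rewrite /= ?p0 //.
  - by move=> a u1 u2 S1 S2; rewrite /= pL; apply: SL.
  - by move=> u1 S1; rewrite /= pder; apply: SD.
  - by move=> n u1 u2 S1 S2; rewrite /= pM; apply: SM.
have := gen _ Spre; rewrite -[S (p w)]/([set w | S (p w)]%classic w) => -> //.
by case=> [x|]; rewrite /= -jE.
Qed.

Local Notation wordval i := (fun w => if w is Some w' then word_val (fun x => i (Some x)) w' else i None).

Lemma sum_option_words (V : lmodType k) (s : seq (option (word Y))) (c : option (word Y) -> k)
    (f : option (word Y) -> V) : uniq s ->
  \sum_(w <- s) c w *: f w =
  \sum_(w <- pmap id s) c (Some w) *: f (Some w) + (if None \in s then c None *: f None else 0).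
Proof.
elim: s => [|[w|] s IH] /=; first by rewrite !big_nil addr0.
  by case/andP=> _ /IH e; rewrite !big_cons e addrA ?inE.
case/andP=> nN /IH e; rewrite big_cons e (negbTE nN) ?inE ?eqxx addr0 /=.
by rewrite addrC.
Qed.

Section Functionals.
Variables (S : algType k) (pc : seq Y -> seq Y -> S) (pc_coef : seq Y -> seq Y -> {linear S -> k^o}).
Hypothesis pc_basis : monomial_coefs pc pc_coef.
Variables (P : algType k) (W : seq (Y * bool) -> P)
  (ext : (seq (Y * bool) -> S) -> {linear P -> S}).
Hypothesis free_P : is_free_algebra W ext.
Variables (P' : algType k) (W' : seq (option (Y * bool)) -> P')
  (ext' : (seq (option (Y * bool)) -> k^o) -> {linear P' -> k^o}).
Hypothesis free_P' : is_free_algebra W' ext'.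

Lemma enveloping_free_of_functionals (s : seq (option (word Y))) (c : option (word Y) -> k) : uniq s ->
  {in s, forall w, if w is Some w' then basic_word w' else True} ->
  \sum_(w <- s) c w *: wordval j w = 0 -> {in s, forall w, c w = 0}.
Proof.
move=> us sB s0; have [pm surj ker] := pU; have [gen loc] := iF.1.
pose v := \sum_(w <- s) c w *: wordval i w.
have gv : conf_ideal_gen relation v.
  apply/ker; rewrite (conf_morphism_sum _ _ _ pm) -[RHS]s0; apply: eq_bigr => -[w|] _ /=; last by rewrite jE.
  rewrite (conf_morphism_word_val _ _ pm); congr (_ *: word_val _ _).
  by apply/funext => x; rewrite /= jE.
pose s' := pmap id s.
have mem_s' w : (w \in s') = (Some w \in s) by rewrite mem_pmap map_id.
have us' : uniq s' by apply: (pmap_uniq (g := Some)) => // -[].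
(* Independence modulo e, in the model where e goes to 0; once these coefficients vanish, only a
   multiple of e is left. *)
have c0 : {in s', forall w, c (Some w) = 0}.
  pose A b0 (x : option Y) : P := if x is Some y then W [:: (y, b0)] else 0.
  have [f fm fi] := is_Conf_lift (A := cur P) (j := fun x => cgen (A false x) (A true x)) iF
    (fun x y n => @nprod_cgen_ge3 k P _ _ _ _ n).
  apply: (basic_fgen_free char0 pc_basis free_P (structure_lie b_basis S)) => //.
    by move=> w; rewrite mem_s' => /sB.
  move=> n X C.
  have := Kac_ideal_normal char0 b_basis pc free_P gen fm fi (pc_coef X C) n gv.
  rewrite /v (conf_morphism_sum _ _ _ fm) sum_option_words // fi.
  have -> : cgen (A false None) (A true None) = 0 :> cur P by rewrite /cgen !linear0 addr0.
  rewrite scaler0 if_same addr0.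
  under eq_bigr => w _ do rewrite (conf_morphism_word_val _ _ fm).
  have -> // : f \o (fun x => i (Some x)) = fgen W.
  by apply/funext => x; rewrite /= fi.
have c0N : None \in s -> c None = 0.
  move=> Ns.
  (* The field has no order of its own; a well-order serves to straighten affine words, whose
     exponents lie in it. *)
  have [R R_wo] := well_ordering_principle k.
  pose A := letter_of W'.
  have [f fm fi] := is_Conf_lift (A := cur P') (j := fun x => cgen (A false x) (A true x)) iF
    (fun x y n => @nprod_cgen_ge3 k P' _ _ _ _ n).
  apply: (central_not_in_ideal char0 form_sym form_inv b_basis
    (well_order_total R_wo) (well_order_trans R_wo) (well_order_anti R_wo) free_P' gen fm fi).
  move: gv; rewrite /v sum_option_words // Ns big_seq big1 ?add0r // => w /c0 ->.
  by rewrite scale0r.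
case=> [w|] sw; last exact: c0N.
by apply: c0; rewrite mem_s'.
Qed.

End Functionals.

Lemma enveloping_free (s : seq (option (word Y))) (c : option (word Y) -> k) : uniq s ->
  {in s, forall w, if w is Some w' then basic_word w' else True} ->
  \sum_(w <- s) c w *: wordval j w = 0 -> {in s, forall w, c w = 0}.
Proof.
exact: (enveloping_free_of_functionals (symalg_coefs k Y)
  (@freealg_free k (Y * bool)%type (symalg k Y)) (@freealg_free k (option (Y * bool)%type) k^o)).
Qed.

End Enveloping.

Theorem corollary3 (k : fieldType) (char0 : [pchar k] =i pred0) :
  (forall (d : Order.disp_t) (Y : orderType d)
          (C : comConfAlgType k) (i : Y -> C),
     is_ComConf 3 i ->
     is_linear_basis (@basic_word d Y) (word_val i)) /\
  (forall (g : lieAlgType k) (B : {biscalar g})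
          (B_sym : forall a b, B a b = B b a)
          (B_inv : forall a b c, B (lie a b) c = B a (lie b c))
          (d : Order.disp_t) (X1 : orderType d)
          (X1_wo : well_order (<=%O : rel X1))
          (b : X1 -> g) (b_basis : is_linear_basis setT b)
          (U : assocConfAlgType k) (j : option X1 -> U),
     is_UK B b 3 j ->
     is_linear_basis
       (fun w => if w is Some w' then basic_word w' else True)
       (fun w => if w is Some w' then word_val (fun x => j (Some x)) w'
                 else j None)).
Proof.
split=> [d Y C i|g B B_sym B_inv d X1 _ b b_basis U j [F [i [p [iF pU jE]]]]].
  exact: ComConf_basis.
split=> [s c us sB|v]; first exact: (enveloping_free char0 B_sym B_inv b_basis iF pU jE).
have [D sp] := enveloping_spanned char0 b_basis iF pU jE v.
apply: combination_sum; apply: spanned_combination sp.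
  exact: (@combination_gen k U _ (fun w => if w is Some w' then basic_word w' else True) _ None).
move=> w bw.
exact: (@combination_gen k U _ (fun w => if w is Some w' then basic_word w' else True) _ (Some w)).
Qed.
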